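(* For every positive integer $k$ with $k\ge 2$, there exists an extremal Type~II $\mathbb{Z}_{4k}$-code of length $72$.
   Context: $\mathbb{Z}_m$ denotes the ring of integers modulo $m$. A $\mathbb{Z}_m$-code of length $n$ is a $\mathbb{Z}_m$-submodule of $\mathbb{Z}_m^n$; it is self-dual if $C=C^\perp$ with respect to the standard inner product. The Euclidean weight of $x=(x_1,\dots,x_n)\in\mathbb{Z}_m^n$ is $\sum_{\alpha=1}^{\lfloor m/2\rfloor} n_\alpha(x)\alpha^2$, where $n_\alpha(x)$ is the number of $i$ with $x_i\equiv\pm\alpha \pmod m$; $d_E(C)$ is the minimum Euclidean weight of a nonzero codeword. A Type~II $\mathbb{Z}_{2r}$-code is a self-dual $\mathbb{Z}_{2r}$-code all of whose codewords have Euclidean weight divisible by $4r$. For a Type~II $\mathbb{Z}_{2r}$-code $C$ of length $n\le 136$ one has $d_E(C)\le 4r\lfloor n/24\rfloor+4r$, and $C$ is called extremal if equality holds. *)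

(* Defs.v *)
From HB Require Import structures.
From mathcomp Require Import all_boot all_order all_algebra.
Set Implicit Arguments. Unset Strict Implicit. Unset Printing Implicit Defensive.
Import GRing.Theory.
Local Open Scope ring_scope.

(* Codes over Z_m of length n: vectors are row vectors 'rV['Z_m]_n.
   Throughout, m is assumed > 1 (so 'Z_m really is Z/mZ). *)

Definition is_code (m n : nat) (C : {set 'rV['Z_m]_n}) : Prop :=
  [/\ 0 \in C,
      (forall x y, x \in C -> y \in C -> x + y \in C) &
      (forall (a : 'Z_m) x, x \in C -> a *: x \in C)].

Definition inner (m n : nat) (x y : 'rV['Z_m]_n) : 'Z_m :=
  \sum_(i < n) x ord0 i * y ord0 i.

Definition dual_code (m n : nat) (C : {set 'rV['Z_m]_n}) : {set 'rV['Z_m]_n} :=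
  [set y | [forall x in C, inner x y == 0]].

Definition self_dual (m n : nat) (C : {set 'rV['Z_m]_n}) : Prop :=
  C = dual_code C.

(* Euclidean weight of an entry a of Z_m: alpha^2 where a = +-alpha mod m,
   0 <= alpha <= m/2, i.e. alpha = min(a, m - a) for the representative a in [0,m). *)
Definition euclid_entry (m : nat) (a : 'Z_m) : nat :=
  (minn (val a) (m - val a)) ^ 2.

Definition euclid_weight (m n : nat) (x : 'rV['Z_m]_n) : nat :=
  (\sum_(i < n) euclid_entry (x ord0 i))%N.

(* Minimum Euclidean weight of a nonzero codeword.  The default value of the
   min (used only if C has no nonzero codeword) exceeds every possible weight. *)
Definition dE (m n : nat) (C : {set 'rV['Z_m]_n}) : nat :=
  \big[minn/(n * (m %/ 2) ^ 2).+1]_(c in C | c != 0) euclid_weight c.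

Definition typeII (r n : nat) (C : {set 'rV['Z_(2 * r)]_n}) : Prop :=
  is_code C /\ self_dual C /\
  (forall c, c \in C -> (4 * r %| euclid_weight c)%N).

(* extremal Type II Z_{2r}-code (bound valid for n <= 136) *)
Definition extremal_typeII (r n : nat) (C : {set 'rV['Z_(2 * r)]_n}) : Prop :=
  typeII C /\ dE C = (4 * r * (n %/ 24) + 4 * r)%N.

(* Main.v *)
(** Let L be the Leech lattice with a Hermitian structure over Z[alpha], where
    alpha^2 - alpha + 2 = 0, whose automorphism group is SL_2(25), and let alpha' = 1 - alpha be
    the conjugate of alpha.  Nebe's lattice consists of the (w0, w1, w2) in L^3 with
    w0 = w1 = w2 mod alpha L and w0 + w1 + w2 in alpha' L, with half the norm of L^3; it is even
    unimodular of rank 72.  Since the norms of alpha L are those of L doubled, the only vectors of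
    norm less than 8 could be triples of minimal vectors of L which are congruent modulo alpha L
    and whose sum lies in alpha' L.  The minimal vectors in a class modulo alpha L form an
    orthogonal frame up to sign, and SL_2(25) has six orbits on the nonzero classes, so it is
    enough to inspect six frames.

    A frame of 72 orthogonal vectors of norm 4k turns the lattice into a Type II Z_4k-code of
    minimum weight 4k * 8.  The lattice contains three orthogonal copies of sqrt 2 L, so a frame
    of vectors of norm 2k in L is needed.  By Lagrange's theorem (four vectors of a frame can be
    recombined by a quaternion of norm n) it suffices that k = p is prime.  L contains two
    orthogonal copies of sqrt 2 D12+, and a Williamson array with 3 x 3 circulant blocks gives a
    frame of norm p in D12+; its blocks come from representations of p and of 4p, the latter by
    odd numbers, as sums of four squares which are compatible modulo 3. *)

Require Import Defs.
From Stdlib Require Import ZArith.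
From mathcomp Require Import all_boot all_order all_algebra.
From mathcomp Require Import boolp zify ring ssrZ mxtens.
Set Implicit Arguments. Unset Strict Implicit. Unset Printing Implicit Defensive.
Import Order.TTheory GRing.Theory Num.Theory.
Local Open Scope ring_scope.
Local Delimit Scope Z_scope with BZ.


(** * Sums of four and three squares *)

(** The inner products of a vector with the frame vectors have square sum 4k times its norm, and
    their reduction modulo 4k has the span of the frame as kernel. So the Euclidean weight of a
    codeword is 4k times the least norm in a coset of that span, and self-duality of the code is
    unimodularity of the lattice. The condition k >= 2 gives k a prime divisor, and it makes the
    frame vectors so long that a suitable vector of norm 8 stays outside their span.

    The circulants u_i I + b_i J have row sums t_i = u_i + 3 b_i, and the array has orthogonal rows
    once the t_i and the u_i have the same square sum. With u_i = 2 s_i this asks for t_i = 2 s_i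
    modulo 3. Signs are free, so the compatibility modulo 3 only says that s_i and t_i are divisible
    by 3 simultaneously.

    The 196560 minimal vectors, 48 in each of the 4095 nonzero classes, are never listed. The
    computation walks through the classes, and each step of the walk is justified by an isometry
    given as an explicit matrix. *)

Definition sumsq4 (a b c d : int) : int := a ^+ 2 + b ^+ 2 + c ^+ 2 + d ^+ 2.

Definition four_squares (n : int) : Prop := exists a b c d : int, sumsq4 a b c d = n.

Lemma four_squaresM (m n : int) :
  four_squares m -> four_squares n -> four_squares (m * n).
Proof.
move=> [a [b [c [d <-]]]] [x [y [z [w <-]]]].
exists (a * x + b * y + c * z + d * w), (a * y - b * x + c * w - d * z),
  (a * z - c * x + d * y - b * w), (a * w - d * x + b * z - c * y).
by rewrite /sumsq4; ring.
Qed.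

Lemma centered_residue (m x : int) : 0 < m ->
  exists c y : int, [/\ x = y + m * c, - m < 2 * y & 2 * y <= m].
Proof.
move=> m0; set r := (x %% m)%Z.
have [r0 rm] : 0 <= r /\ r < m by rewrite /r; split; [apply: modz_ge0|apply: ltz_pmod]; lia.
have xE : x = r + m * (x %/ m)%Z by rewrite {1}(divz_eq x m) -/r; ring.
have [h|h] := leP (2 * r) m.
  by exists (x %/ m)%Z, r; split=> //; lia.
by exists ((x %/ m)%Z + 1), (r - m); split; [rewrite {1}xE; ring|lia|lia].
Qed.

(** Lagrange's descent: the centered residues y of x modulo [m] have square sum [m * r], and every
    entry of the quaternion product of x with the conjugate of y is divisible by [m]. The hypothesis
    on [p] excludes the extreme cases [r = 0] and [r = m], in which [m] would divide [p]. *)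
Lemma four_squares_descent (p m : int) : 0 < p -> 1 < m ->
  (forall d : int, p != m * d) -> four_squares (m * p) ->
  exists r : int, [/\ 0 < r, r < m & four_squares (r * p)].
Proof.
move=> p0 m1 pm [x1 [x2 [x3 [x4 xE]]]].
have m0 : 0 < m by lia.
have [c1 [y1 [e1 l1 u1]]] := centered_residue x1 m0.
have [c2 [y2 [e2 l2 u2]]] := centered_residue x2 m0.
have [c3 [y3 [e3 l3 u3]]] := centered_residue x3 m0.
have [c4 [y4 [e4 l4 u4]]] := centered_residue x4 m0.
pose r := p - 2 * (x1 * c1 + x2 * c2 + x3 * c3 + x4 * c4) + m * sumsq4 c1 c2 c3 c4.
have yE : sumsq4 y1 y2 y3 y4 = m * r.
  have -> : y1 = x1 - m * c1 by rewrite e1; ring.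
  have -> : y2 = x2 - m * c2 by rewrite e2; ring.
  have -> : y3 = x3 - m * c3 by rewrite e3; ring.
  have -> : y4 = x4 - m * c4 by rewrite e4; ring.
  transitivity (m * p - m * p + m * r); last by ring.
  by rewrite -{1}xE /r /sumsq4; ring.
have sq (y : int) : - m < 2 * y -> 2 * y <= m -> 4 * y ^+ 2 <= m ^+ 2 by nia.
have sq0 (y : int) : 0 <= y ^+ 2 by nia.
have yle : 4 * sumsq4 y1 y2 y3 y4 <= 4 * m ^+ 2.
  have := sq _ l1 u1; have := sq _ l2 u2; have := sq _ l3 u3; have := sq _ l4 u4.
  by rewrite /sumsq4; lia.
have r_ge0 : 0 <= r.
  have : 0 <= m * r by rewrite -yE /sumsq4 !addr_ge0.
  by rewrite pmulr_rge0.
have r_lem : r <= m by rewrite yE in yle; nia.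
have r_neq0 : r != 0.
  apply/eqP => r0; move: yE; rewrite r0 mulr0 /sumsq4 => yE.
  have z (y : int) : y ^+ 2 = 0 -> y = 0 by move=> /eqP; rewrite sqrf_eq0 => /eqP.
  have [a1 a2 a3 a4] : [/\ y1 = 0, y2 = 0, y3 = 0 & y4 = 0].
    have := sq0 y1; have := sq0 y2; have := sq0 y3; have := sq0 y4.
    by split; apply: z; lia.
  move: (pm (sumsq4 c1 c2 c3 c4)) => /eqP; apply.
  apply: (mulfI (lt0r_neq0 m0)); rewrite -xE e1 e2 e3 e4 a1 a2 a3 a4 /sumsq4; ring.
have r_neqm : r != m.
  apply/eqP => rm; move: yE yle; rewrite rm /sumsq4 => yE yle.
  have h (y : int) : - m < 2 * y -> 2 * y <= m -> 4 * y ^+ 2 = m ^+ 2 -> 2 * y = m.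
    move=> ly uy e; have /eqP : (2 * y - m) * (2 * y + m) = 0.
      transitivity (4 * y ^+ 2 - m ^+ 2); first by ring.
      by rewrite e subrr.
    by rewrite mulf_eq0 => /orP[] /eqP; move: ly m0; clear; lia.
  have [a1 a2 a3 a4] : [/\ 2 * y1 = m, 2 * y2 = m, 2 * y3 = m & 2 * y4 = m].
    have := sq _ l1 u1; have := sq _ l2 u2; have := sq _ l3 u3; have := sq _ l4 u4.
    by split; apply: h => //; lia.
  move: (pm (1 + c1 + c2 + c3 + c4 + sumsq4 c1 c2 c3 c4)) => /eqP; apply.
  apply: (mulfI (lt0r_neq0 m0)); rewrite -xE e1 e2 e3 e4.
  have -> : y2 = y1 by lia.
  have -> : y3 = y1 by lia.
  have -> : y4 = y1 by lia.
  by rewrite -a1 /sumsq4; ring.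
exists r; split; [by rewrite lt_neqAle eq_sym r_neq0|by rewrite lt_neqAle r_neqm|].
(* Up to sign, the entries of that product divided by [m], after substituting y = x - m c. *)
exists (p - (x1 * c1 + x2 * c2 + x3 * c3 + x4 * c4)),
  (x2 * c1 - x1 * c2 + x4 * c3 - x3 * c4), (x3 * c1 - x1 * c3 + x2 * c4 - x4 * c2),
  (x4 * c1 - x1 * c4 + x3 * c2 - x2 * c3).
apply: (mulfI (lt0r_neq0 m0)).
pose xc := x1 * c1 + x2 * c2 + x3 * c3 + x4 * c4.
rewrite [RHS](_ : _ = m * p * p - m * p * (2 * xc) + m * (m * p) * sumsq4 c1 c2 c3 c4);
  last by rewrite /r /xc; ring.
rewrite -[in X in _ = _ + X]xE [LHS](_ : _ = m * p * p - m * p * (2 * xc) +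
  m * (sumsq4 x1 x2 x3 x4 * sumsq4 c1 c2 c3 c4)); last by rewrite /xc /sumsq4; ring.
by ring.
Qed.

(** Pigeonhole: with p = 2h + 1, the h + 1 squares i^2 are distinct modulo [p], and so are the h + 1
    values -1 - j^2; hence the two sets meet. *)
Lemma sum_two_squares_opp1 (p : nat) : prime p -> odd p ->
  exists x y m : int, x ^+ 2 + y ^+ 2 + 1 = m * p%:Z /\ 0 < m < p%:Z.
Proof.
move=> pp op; have p1 := prime_gt1 pp; have p0 : (0 < p)%N by lia.
have [h ph] : exists h, p = h.*2.+1 by exists p./2; rewrite -[LHS]odd_double_half op.
pose f (i : 'I_h.+1) : 'I_p := Ordinal (ltn_pmod (i ^ 2) p0).
(* Adding [p * p] keeps -1 - i^2 within the natural numbers. *)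
pose g (i : 'I_h.+1) : 'I_p := Ordinal (ltn_pmod (p * p - 1 - i ^ 2) p0).
have key (a b : nat) : (a <= h)%N -> (b <= a)%N -> (p %| a ^ 2 - b ^ 2)%N -> a = b.
  move=> ah ba; rewrite subn_sqr Euclid_dvdM // => /orP[|] /dvdnP[[|k]]; nia.
have finj : injective f.
  move=> i j /(congr1 val) /= /eqP e; apply: val_inj => /=.
  have := ltn_ord i; have := ltn_ord j => ji ii.
  have [ij|ji'] := leqP i j.
    by move: e; rewrite eq_sym eqn_mod_dvd; [move=> /key-> //; lia|rewrite leq_sqr; lia].
  by move: e; rewrite eqn_mod_dvd; [move=> /key-> //; lia|rewrite leq_sqr; lia].
have ginj : injective g.
  move=> i j /(congr1 val) /= /eqP e; apply: val_inj => /=.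
  have := ltn_ord i; have := ltn_ord j => ji ii.
  have [ij|ji'] := leqP i j.
    move: e; rewrite eqn_mod_dvd; last by nia.
    rewrite (_ : _ - _ - _ = j ^ 2 - i ^ 2)%N; last by nia.
    by move=> /key-> //; lia.
  move: e; rewrite eq_sym eqn_mod_dvd; last by nia.
  rewrite (_ : _ - _ - _ = i ^ 2 - j ^ 2)%N; last by nia.
  by move=> /key-> //; lia.
have [z /andP[/imsetP[i _ zi] /imsetP[j _ zj]]] :
    exists z, (z \in [set f i | i in setT]) && (z \in [set g i | i in setT]).
  apply/existsP; apply: contraT; rewrite negb_exists => /forallP dis.
  have : [disjoint [set f i | i in setT] & [set g i | i in setT]].
    by rewrite disjoint_subset; apply/subsetP => z zf; have := dis z; rewrite zf.
  rewrite -leq_card_setU => /eqP.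
  rewrite !card_imset // !cardsT card_ord => e.
  have := max_card [set: 'I_p].
  have := subset_leq_card (subsetT ([set f i | i in setT] :|: [set g i | i in setT])).
  by rewrite e cardsT card_ord; lia.
have := congr1 val (etrans (esym zi) zj) => /= /eqP.
have := ltn_ord i; have := ltn_ord j => ji ii e.
have : (p %| i ^ 2 + j ^ 2 + 1)%N.
  rewrite /dvdn -(eqn_modDr (j ^ 2 + 1)) in e *.
  move: e; rewrite (_ : _ - _ - _ + _ = p * p)%N; last by nia.
  by rewrite modnMl addnA.
case/dvdnP => m me.
exists i%:Z, j%:Z, m%:Z; split; first by lia.
have ih : (i ^ 2 <= h ^ 2)%N by rewrite leq_sqr; lia.
have jh : (j ^ 2 <= h ^ 2)%N by rewrite leq_sqr; lia.
have mp : (m * p < p * p)%N.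
  rewrite -me (_ : p * p = 4 * h ^ 2 + 4 * h + 1)%N; [lia|rewrite ph -mul2n; ring].
rewrite ltn_pmul2r // in mp.
by apply/andP; split; [case: (m) me => //; lia | lia].
Qed.

Lemma four_squares_prime (p : nat) : prime p -> four_squares p%:Z.
Proof.
move=> pp; have p1 := prime_gt1 pp.
have [->|podd] := even_prime pp; first by exists 1, 1, 0, 0.
have [x [y [m [e /andP[m0 mp]]]]] := sum_two_squares_opp1 pp podd.
have : four_squares (m * p%:Z) by exists x, y, 1, 0; rewrite -e /sumsq4; ring.
clear x y e; have [n] := ubnP `|m|%N; elim: n m m0 mp => // n IH m m0 mp mn fs.
have [m1|m1] := leP m 1; first by have <- : m * p%:Z = p%:Z by (have -> : m = 1 by lia); ring.
have pm (d : int) : p%:Z != m * d.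
  apply/eqP => pmd; have dm : (`|m|%N %| p)%N by apply/dvdnP; exists `|d|%N; nia.
  by move/primeP: pp => [_ /(_ _ dm)] /orP[] /eqP; lia.
have [|r [r0 rm fr]] := four_squares_descent _ m1 pm fs; first by lia.
by apply: (IH r) => //; lia.
Qed.

Theorem lagrange_four_squares (n : nat) : four_squares n%:Z.
Proof.
have [n0|] := posnP n; first by exists 0, 0, 0, 0; rewrite n0.
elim/ltn_ind: n => n IH n0.
have [n1|n1] := leqP n 1; first by exists 1, 0, 0, 0; rewrite (_ : n = 1%N) //; lia.
have [m mE] := dvdnP (pdiv_dvd n).
have := prime_gt1 (pdiv_prime n1) => pd1.
rewrite mE PoszM; apply: four_squaresM; last exact/four_squares_prime/pdiv_prime.
by apply: IH; nia.
Qed.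

(** * Residues modulo 3 and sums of three squares *)

Definition prime_to3 (x : int) : Prop := exists q e : int, x = 3 * q + e /\ (e = 1 \/ e = -1).

Lemma mod3P (x : int) : (exists q, x = 3 * q) \/ prime_to3 x.
Proof.
case: (divz_eq x 3) (modz_ge0 x (isT : (3 : int) != 0)) (ltz_pmod x (isT : 0 < (3 : int))).
set r := (x %% 3)%Z; set q := (x %/ 3)%Z => E r0 r3.
have [r0'|[r1|r2]] : r = 0 \/ r = 1 \/ r = 2 by lia.
- by left; exists q; lia.
- by right; exists q, 1; split; [lia|left].
by right; exists (q + 1), (-1); split; [lia|right].
Qed.

Lemma prime_to3E (x : int) : prime_to3 x <-> ~ exists q, x = 3 * q.
Proof.
split; first by move=> [q [e [-> ee]]] [q']; case: ee => ->; lia.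
by case: (mod3P x).
Qed.

Lemma prime_to3_sqr (x : int) : prime_to3 x -> exists q, x ^+ 2 = 3 * q + 1.
Proof.
move=> [q [e [-> ee]]]; exists (3 * q ^+ 2 + 2 * q * e).
by case: ee => ->; ring.
Qed.

Lemma prime_to3_sign (x y : int) : prime_to3 x -> prime_to3 y ->
  exists e : int, e ^+ 2 = 1 /\ exists q, e * x = y + 3 * q.
Proof.
move=> [q [e [-> ee]]] [q' [e' [-> ee']]]; exists (e * e'); split.
  by case: ee => ->; case: ee' => ->.
exists (e * e' * q - q'); case: ee => ->; case: ee' => ->; ring.
Qed.

(* 2 (z.Y) z - 3 Y is 3 times the half-turn of Y about the axis z = (1, +-1, +-1). *)
Lemma half_turn3 (b c d : int) : prime_to3 b \/ prime_to3 c \/ prime_to3 d ->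
  exists b' c' d' : int, [/\ prime_to3 b', prime_to3 c', prime_to3 d' &
    b' ^+ 2 + c' ^+ 2 + d' ^+ 2 = 9 * (b ^+ 2 + c ^+ 2 + d ^+ 2)].
Proof.
move=> nz.
have [z [w [zz [ww s3]]]] : exists z w : int,
    (z = 1 \/ z = -1) /\ (w = 1 \/ w = -1) /\ prime_to3 (b + z * c + w * d).
  have rP (x : int) : exists q e : int, x = 3 * q + e /\ (e = 0 \/ e = 1 \/ e = -1).
    by case: (mod3P x) => [[q ->]|[q [e [-> ee]]]]; [exists q, 0|exists q, e]; split; try lia; tauto.
  have [q1 [e1 [b1 e1P]]] := rP b; have [q2 [e2 [c1 e2P]]] := rP c.
  have [q3 [e3 [d1 e3P]]] := rP d.
  have nz' : e1 != 0 \/ e2 != 0 \/ e3 != 0.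
    case: nz => [|[]] /prime_to3E nz; [left|right; left|right; right]; apply/eqP => e0; apply: nz.
    - by exists q1; lia.
    - by exists q2; lia.
    by exists q3; lia.
  have fin (z w : int) : (z = 1 \/ z = -1) -> (w = 1 \/ w = -1) ->
      ~ (exists q, e1 + z * e2 + w * e3 = 3 * q) ->
      exists z w : int, (z = 1 \/ z = -1) /\ (w = 1 \/ w = -1) /\ prime_to3 (b + z * c + w * d).
    move=> zz ww h; exists z, w; do 2!split=> //; apply/prime_to3E => -[q qE]; apply: h.
    by exists (q - q1 - z * q2 - w * q3); rewrite !mulrBr -qE b1 c1 d1; ring.
  case: e1P nz' fin => [->|[]->]; case: e2P => [->|[]->]; case: e3P => [->|[]->] nz' fin; (try by lia);
  first [by apply: (fin 1 1); [left|left|move=> []; lia]|by apply: (fin 1 (-1)); [left|right|move=> []; lia]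
    |by apply: (fin (-1) 1); [right|left|move=> []; lia]|by apply: (fin (-1) (-1)); [right|right|move=> []; lia]].
move: s3; set s := (b + _ + _) => s3.
have sE (x e : int) : (e = 1 \/ e = -1) -> prime_to3 (2 * s * e - 3 * x).
  move=> ee; apply/prime_to3E => -[q qE]; move/prime_to3E: s3; apply.
  by case: ee qE => -> qE; [exists (s - q - x)|exists (s + q + x)]; lia.
exists (2 * s * 1 - 3 * b), (2 * s * z - 3 * c), (2 * s * w - 3 * d); split; try by apply: sE; tauto.
by rewrite /s; case: zz => ->; case: ww => ->; ring.
Qed.

(** Either none or all of b, c, d are divisible by 3. In the second case a half-turn of (b, c, d) /
    3 restores the factor 9 with entries prime to 3. If (b, c, d) / 3 is itself divisible by 3, the
    induction hypothesis first replaces it by a triple prime to 3. *)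
Lemma three_squares_prime_to3 (b c d m : int) :
  b ^+ 2 + c ^+ 2 + d ^+ 2 = 3 * m -> 0 < m ->
  exists b' c' d' : int, [/\ prime_to3 b', prime_to3 c', prime_to3 d' &
    b' ^+ 2 + c' ^+ 2 + d' ^+ 2 = 3 * m].
Proof.
have [n] := ubnP `|m|%N; elim: n b c d m => // n IH b c d m mn E m0.
have tri (x : int) : (exists q, x = 3 * q /\ x ^+ 2 = 9 * q ^+ 2) \/
    (prime_to3 x /\ exists q, x ^+ 2 = 3 * q + 1).
  case: (mod3P x) => [[q ->]|h]; first by left; exists q; split=> //; ring.
  by right; split=> //; apply: prime_to3_sqr.
case: (tri b) => [[b1 [bE bE2]]|[b3 [qb bE2]]]; case: (tri c) => [[c1 [cE cE2]]|[c3 [qc cE2]]];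
case: (tri d) => [[d1 [dE dE2]]|[d3 [qd dE2]]]; (try by exfalso; lia); last by exists b, c, d.
have [|h] : (prime_to3 b1 \/ prime_to3 c1 \/ prime_to3 d1) \/
   (exists x y z, [/\ b1 = 3 * x, c1 = 3 * y & d1 = 3 * z]).
- case: (mod3P b1) => [[x xE]|]; last by tauto.
  case: (mod3P c1) => [[y yE]|]; last by tauto.
  case: (mod3P d1) => [[z zE]|]; last by tauto.
  by right; exists x, y, z.
- move=> /half_turn3 [b' [c' [d' [hb hc hd e]]]]; exists b', c', d'; split=> //.
  by rewrite e -E bE2 cE2 dE2; ring.
have [x [y [z [xE yE zE]]]] := h.
have mE : m = 27 * (x ^+ 2 + y ^+ 2 + z ^+ 2).
  have e9 (u : int) : (3 * u) ^+ 2 = 9 * u ^+ 2 by ring.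
  move: E; rewrite bE2 cE2 dE2 xE yE zE !e9; move: (x ^+ 2) (y ^+ 2) (z ^+ 2).
  by clear; lia.
have [|||b' [c' [d' [hb hc hd e]]]] := IH b1 c1 d1 (3 * (x ^+ 2 + y ^+ 2 + z ^+ 2)).
- by move: mE m0 mn; move: (_ + _ + _); clear; lia.
- by rewrite xE yE zE; ring.
- by move: mE m0; move: (_ + _ + _); clear; lia.
have [|b'' [c'' [d'' [hb' hc' hd' e']]]] := half_turn3 (b := b') (c := c') (d := d'); first by left.
exists b'', c'', d''; split=> //; rewrite e' e -E bE2 cE2 dE2 xE yE zE; ring.
Qed.

(** * Integers for the Williamson array *)

Definition odd_int (x : int) : Prop := exists q, x = 2 * q + 1.

Definition same3 (s t : int) : Prop :=
  (exists q q', s = 3 * q /\ t = 3 * q') \/ (prime_to3 s /\ prime_to3 t).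

(** Up to sign [t] is congruent to [2 * s] modulo 3, and the quotient [b] of the difference by 3 is
    odd because [t] is. *)
Lemma same3_solve (s t : int) : same3 s t -> odd_int t ->
  exists b : int, odd_int b /\ (2 * s + 3 * b) ^+ 2 = t ^+ 2.
Proof.
move=> st [r tE].
have [e [e1 [q qE]]] : exists e : int, e ^+ 2 = 1 /\ exists q, e * t = 2 * s + 3 * q.
  case: st => [[q [q' [-> ->]]]|[s3 t3]].
    by exists 1; split=> //; exists (q' - 2 * q); ring.
  apply: prime_to3_sign => //; apply/prime_to3E => -[q qE]; move/prime_to3E: s3; apply.
  by exists (s - q); lia.
exists q; split; last by rewrite -qE exprMn e1 mul1r.
have [h|h] : e = 1 \/ e = -1 by move/eqP: e1; rewrite sqrf_eq1 => /orP[]/eqP; tauto.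
  by exists (r - s - q); move: qE; rewrite h tE; lia.
by exists (- r - 1 - s - q - 0); move: qE; rewrite h tE; lia.
Qed.

(** The circulants are 2 s_i I + b_i J, with row sums 2 s_i + 3 b_i. The last clause makes the row
    sums of the whole array divisible by 4, as D12+ requires. *)
Definition williamson_data (q : int) : Prop :=
  exists s0 s1 s2 s3 b0 b1 b2 b3 : int,
  [/\ [/\ odd_int b0, odd_int b1, odd_int b2 & odd_int b3],
      sumsq4 s0 s1 s2 s3 = q,
      sumsq4 (2 * s0 + 3 * b0) (2 * s1 + 3 * b1) (2 * s2 + 3 * b2) (2 * s3 + 3 * b3) = 4 * q &
      exists r, (2 * s0 + 3 * b0) + (2 * s1 + 3 * b1) + (2 * s2 + 3 * b2) + (2 * s3 + 3 * b3) = 4 * r].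

(** The four values 2 s_i + 3 b_i are odd, so their sum is even. If it is 2 modulo 4, negating [s0]
    and [b0] changes it by twice an odd number. *)
Lemma williamson_of_same3 (q s0 s1 s2 s3 t0 t1 t2 t3 : int) :
  sumsq4 s0 s1 s2 s3 = q -> sumsq4 t0 t1 t2 t3 = 4 * q ->
  odd_int t0 -> odd_int t1 -> odd_int t2 -> odd_int t3 ->
  same3 s0 t0 -> same3 s1 t1 -> same3 s2 t2 -> same3 s3 t3 -> williamson_data q.
Proof.
move=> sq tq o0 o1 o2 o3 /same3_solve/(_ o0) [b0 [p0 e0]] /same3_solve/(_ o1) [b1 [p1 e1]].
move=> /same3_solve/(_ o2) [b2 [p2 e2]] /same3_solve/(_ o3) [b3 [p3 e3]].
have [r|[r rE]] : (exists r, (2 * s0 + 3 * b0) + (2 * s1 + 3 * b1) + (2 * s2 + 3 * b2) + (2 * s3 + 3 * b3) = 4 * r)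
  \/ exists r, (2 * s0 + 3 * b0) + (2 * s1 + 3 * b1) + (2 * s2 + 3 * b2) + (2 * s3 + 3 * b3) = 4 * r + 2.
- set x := _ + _ + _ + _.
  have [r xr] : exists r, x = 2 * r.
    move: p0 p1 p2 p3 => [r0 ->] [r1 ->] [r2 ->] [r3 ->] in @x *.
    exists (s0 + s1 + s2 + s3 + 3 * (r0 + r1 + r2 + r3) + 6); by rewrite /x; ring.
  have := divz_eq r 2; have := modz_ge0 r (isT : (2 : int) != 0); have := ltz_pmod r (isT : 0 < (2 : int)).
  move: (r %/ 2)%Z (r %% 2)%Z => u v v2 v0 rE.
  have [v1|v1] : v = 0 \/ v = 1 by move: v2 v0; clear; lia.
    by left; exists u; move: xr rE v1; clear; lia.
  by right; exists u; move: xr rE v1; clear; lia.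
- by exists s0, s1, s2, s3, b0, b1, b2, b3; split=> //; rewrite /sumsq4 e0 e1 e2 e3.
exists (- s0), s1, s2, s3, (- b0), b1, b2, b3; split.
- by split=> //; move: p0 => [x ->]; exists (- x - 1); ring.
- by rewrite -sq /sumsq4; ring.
- by rewrite /sumsq4 e1 e2 e3 (_ : 2 * - s0 + 3 * - b0 = - (2 * s0 + 3 * b0)) ?sqrrN ?e0 //; ring.
by move: p0 rE => [x ->] rE; exists (r - s0 - 3 * x - 1); move: rE; clear; lia.
Qed.

Lemma mod3_sqrP (x : int) : ((exists q, x = 3 * q) /\ exists k, x ^+ 2 = 3 * k) \/
  (prime_to3 x /\ exists k, x ^+ 2 = 3 * k + 1).
Proof.
case: (mod3P x) => [[q ->]|h]; [left|right; split=> //; exact: prime_to3_sqr].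
by split; [exists q|exists (3 * q ^+ 2); ring].
Qed.

Lemma sqr_parity (x : int) : exists k, x ^+ 2 = x + 2 * k.
Proof.
have := divz_eq x 2; have := modz_ge0 x (isT : (2 : int) != 0); have := ltz_pmod x (isT : 0 < (2 : int)).
move: (x %/ 2)%Z (x %% 2)%Z => u v v2 v0 ->.
have [->|->] : v = 0 \/ v = 1 by lia.
  by exists (2 * u ^+ 2 - u); ring.
by exists (2 * u ^+ 2 + u); ring.
Qed.

(** Exactly two of the four squares are 1 modulo 3, so only a permutation is needed; [P] lets
    oddness of the entries be carried through it. *)
Lemma two_prime_to3_first (P : int -> Prop) (x0 x1 x2 x3 n : int) :
  sumsq4 x0 x1 x2 x3 = 3 * n + 2 -> P x0 -> P x1 -> P x2 -> P x3 ->
  exists y0 y1 y2 y3 : int, [/\ sumsq4 y0 y1 y2 y3 = 3 * n + 2,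
    prime_to3 y0, prime_to3 y1, (exists q, y2 = 3 * q) /\ (exists q, y3 = 3 * q) &
    [/\ P y0, P y1, P y2 & P y3]].
Proof.
rewrite /sumsq4 => E P0 P1 P2 P3.
case: (mod3_sqrP x0) => -[h0 [k0 e0]]; case: (mod3_sqrP x1) => -[h1 [k1 e1]];
case: (mod3_sqrP x2) => -[h2 [k2 e2]]; case: (mod3_sqrP x3) => -[h3 [k3 e3]];
(try by exfalso; move: E; rewrite e0 e1 e2 e3; clear; lia).
- by exists x2, x3, x0, x1; split=> //; rewrite -E; ring.
- by exists x1, x3, x0, x2; split=> //; rewrite -E; ring.
- by exists x1, x2, x0, x3; split=> //; rewrite -E; ring.
- by exists x0, x3, x1, x2; split=> //; rewrite -E; ring.
- by exists x0, x2, x1, x3; split=> //; rewrite -E; ring.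
- by exists x0, x1, x2, x3; split=> //; rewrite -E; ring.
Qed.

Lemma odd_sumsq4 (a b c d n : int) : sumsq4 a b c d = 2 * n + 1 -> odd_int (a + b + c + d).
Proof.
move=> E; have [x xe] := sqr_parity a; have [y ye] := sqr_parity b.
have [z ze] := sqr_parity c; have [w we] := sqr_parity d.
exists (n - x - y - z - w); move: E; rewrite /sumsq4 xe ye ze we; clear; lia.
Qed.

Lemma odd_sum4 (x0 x1 x2 x3 y0 y1 y2 y3 : int) : odd_int (x0 + x1 + x2 + x3) ->
  (exists u, y0 = x0 + 2 * u) -> (exists u, y1 = x1 + 2 * u) ->
  (exists u, y2 = x2 + 2 * u) -> (exists u, y3 = x3 + 2 * u) -> odd_int (y0 + y1 + y2 + y3).
Proof.
move=> [r rE] [a ->] [b ->] [c ->] [d ->]; exists (r + a + b + c + d).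
by move: rE; clear; lia.
Qed.

Lemma mul_sign_parity (s g : int) : g = 1 \/ g = -1 -> exists u, s * g = s + 2 * u.
Proof. by case=> ->; [exists 0|exists (- s)]; ring. Qed.

Lemma opp_mul_sign_parity (s g : int) : g = 1 \/ g = -1 -> exists u, - (s * g) = s + 2 * u.
Proof. by case=> ->; [exists (- s)|exists 0]; ring. Qed.

Lemma williamson_mod2 (n m : int) : four_squares (3 * n + 2) -> 3 * n + 2 = 2 * m + 1 ->
  williamson_data (3 * n + 2).
Proof.
move=> [x0 [x1 [x2 [x3 xE]]]] od.
have [s0 [s1 [s2 [s3 [sE n0 n1 [z2 z3] _]]]]] := two_prime_to3_first (P := fun=> True) xE I I I I.
have [r rE] : odd_int (s0 + s1 + s2 + s3) by apply: (odd_sumsq4 (n := m)); rewrite sE.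
(* The quaternion product of s with 1 + i + j + k, of norm 4. Its entries have the parity of
   [s0 + s1 + s2 + s3], which is odd. *)
pose t0 := s0 - s1 - s2 - s3; pose t1 := s0 + s1 + s2 - s3.
pose t2 := s0 - s1 + s2 + s3; pose t3 := s0 + s1 - s2 + s3.
have tE : sumsq4 t0 t1 t2 t3 = 3 * (4 * n + 2) + 2.
  rewrite (_ : _ + 2 = 4 * (3 * n + 2)); last by ring.
  by rewrite -sE /sumsq4 /t0 /t1 /t2 /t3; ring.
have [|||| y0 [y1 [y2 [y3 [yE m0 m1 [w2 w3] [o0 o1 o2 o3]]]]]] := two_prime_to3_first (P := odd_int) tE.
- by exists (r - s1 - s2 - s3); rewrite /t0; move: rE; clear; lia.
- by exists (r - s3); rewrite /t1; move: rE; clear; lia.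
- by exists (r - s1); rewrite /t2; move: rE; clear; lia.
- by exists (r - s2); rewrite /t3; move: rE; clear; lia.
apply: (williamson_of_same3 sE (t0 := y0) (t1 := y1) (t2 := y2) (t3 := y3)) => //.
- by rewrite yE; ring.
- by right.
- by right.
- by left; move: z2 w2 => [a ->] [b ->]; exists a, b.
- by left; move: z3 w3 => [a ->] [b ->]; exists a, b.
Qed.

(** One or four of the entries are prime to 3. If it is one, the other three squares add up to a
    multiple of 3, positive because a prime is not a square, and are replaced by squares of numbers
    prime to 3. *)
Lemma four_squares_prime_to3 (p : nat) (n : int) : prime p -> p%:Z = 3 * n + 1 ->
  exists s0 s1 s2 s3 : int, [/\ sumsq4 s0 s1 s2 s3 = p,
    prime_to3 s0, prime_to3 s1, prime_to3 s2 & prime_to3 s3].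
Proof.
move=> pp pE.
have key (a b c d : int) : sumsq4 a b c d = p -> prime_to3 a -> (exists q, b = 3 * q) ->
    (exists q, c = 3 * q) -> (exists q, d = 3 * q) ->
    exists s0 s1 s2 s3 : int, [/\ sumsq4 s0 s1 s2 s3 = p,
    prime_to3 s0, prime_to3 s1, prime_to3 s2 & prime_to3 s3].
  move=> E ha [x xE] [y yE] [z zE].
  pose m := 3 * (x ^+ 2 + y ^+ 2 + z ^+ 2).
  have mE : b ^+ 2 + c ^+ 2 + d ^+ 2 = 3 * m by rewrite xE yE zE /m; ring.
  have m_ge0 : 0 <= m by rewrite /m mulr_ge0 // !addr_ge0 // sqr_ge0.
  have m_neq0 : m != 0.
    apply/eqP => m0; have aE : a ^+ 2 = p.
      move: E mE; rewrite m0 /sumsq4.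
      by move: (a ^+ 2) (b ^+ 2) (c ^+ 2) (d ^+ 2); clear; lia.
    have pa : p = (`|a| ^ 2)%N by rewrite -abszX aE.
    have ap : (`|a| %| p)%N by rewrite pa dvdn_exp.
    move: (prime_gt1 pp); case/primeP: pp => _ /(_ _ ap) /orP[] /eqP ea; first by rewrite pa ea.
    by move: pa; rewrite ea; clear; nia.
  have m_gt0 : 0 < m by rewrite lt_neqAle eq_sym m_neq0.
  have [b' [c' [d' [hb hc hd e]]]] := three_squares_prime_to3 mE m_gt0.
  exists a, b', c', d'; split=> //.
  by rewrite -E /sumsq4 -!addrA; congr (_ + _); rewrite !addrA e -mE.
have [x0 [x1 [x2 [x3 E]]]] := lagrange_four_squares p.
case: (mod3_sqrP x0) => -[h0 [k0 e0]]; case: (mod3_sqrP x1) => -[h1 [k1 e1]];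
case: (mod3_sqrP x2) => -[h2 [k2 e2]]; case: (mod3_sqrP x3) => -[h3 [k3 e3]];
(try by exfalso; move: E; rewrite /sumsq4 e0 e1 e2 e3 pE; clear; lia).
- by apply: (key x3 x0 x1 x2) => //; rewrite -E /sumsq4; ring.
- by apply: (key x2 x0 x1 x3) => //; rewrite -E /sumsq4; ring.
- by apply: (key x1 x0 x2 x3) => //; rewrite -E /sumsq4; ring.
- by apply: (key x0 x1 x2 x3) => //; rewrite -E /sumsq4; ring.
by exists x0, x1, x2, x3.
Qed.

(* t = s * sigma as quaternions, where sigma has entries +-1 congruent to those of s mod 3;
   so t is congruent to sigma ^ 2 = 2 sigma_0 sigma - 4, whose entries are +-2. *)
Lemma williamson_mod1 (p : nat) (n m : int) : prime p -> p%:Z = 3 * n + 1 -> p%:Z = 2 * m + 1 ->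
  williamson_data p.
Proof.
move=> pp pE od; have [s0 [s1 [s2 [s3 [sE n0 n1 n2 n3]]]]] := four_squares_prime_to3 pp pE.
have [r rE] : odd_int (s0 + s1 + s2 + s3) by apply: (odd_sumsq4 (n := m)); rewrite sE.
have od4 : odd_int (s0 + s1 + s2 + s3) by exists r.
have [q0 [g0 [f0 i0]]] := n0; have [q1 [g1 [f1 i1]]] := n1.
have [q2 [g2 [f2 i2]]] := n2; have [q3 [g3 [f3 i3]]] := n3.
have Hp := mul_sign_parity; have Hn := opp_mul_sign_parity.
apply: (williamson_of_same3 sE (t0 := s0 * g0 - s1 * g1 - s2 * g2 - s3 * g3)
  (t1 := s0 * g1 + s1 * g0 + s2 * g3 - s3 * g2) (t2 := s0 * g2 - s1 * g3 + s2 * g0 + s3 * g1)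
  (t3 := s0 * g3 + s1 * g2 - s2 * g1 + s3 * g0)).
- rewrite -sE /sumsq4; case: i0 => ->; case: i1 => ->; case: i2 => ->; case: i3 => ->; ring.
- by apply: odd_sum4 od4 _ _ _ _; auto.
- by apply: odd_sum4 od4 _ _ _ _; auto.
- by apply: odd_sum4 od4 _ _ _ _; auto.
- by apply: odd_sum4 od4 _ _ _ _; auto.
- right; split=> //; apply/prime_to3E => -[q]; move: f0 f1 f2 f3.
  by case: i0 => ->; case: i1 => ->; case: i2 => ->; case: i3 => ->; clear; lia.
- right; split=> //; apply/prime_to3E => -[q]; move: f0 f1 f2 f3.
  by case: i0 => ->; case: i1 => ->; case: i2 => ->; case: i3 => ->; clear; lia.
- right; split=> //; apply/prime_to3E => -[q]; move: f0 f1 f2 f3.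
  by case: i0 => ->; case: i1 => ->; case: i2 => ->; case: i3 => ->; clear; lia.
right; split=> //; apply/prime_to3E => -[q]; move: f0 f1 f2 f3.
by case: i0 => ->; case: i1 => ->; case: i2 => ->; case: i3 => ->; clear; lia.
Qed.

Lemma williamson_prime (p : nat) : prime p -> odd p -> williamson_data p.
Proof.
move=> pp op; have [m mE] : exists m : int, p%:Z = 2 * m + 1.
  by exists p./2%:Z; rewrite -{1}(odd_double_half p) op; lia.
have p1 := prime_gt1 pp.
have : p = (p %/ 3 * 3 + p %% 3)%N := divn_eq p 3.
have : (p %% 3 < 3)%N by rewrite ltn_mod.
case E: (p %% 3)%N => [|[|[|//]]] _ pE.
- have : (3 %| p)%N by rewrite /dvdn E.
  (* For p = 3 the vector 2s + 3b is (-1, -1, -1, 3). *)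
  rewrite dvdn_prime2 // => /eqP <-; exists 1, 1, 1, 0, (-1), (-1), (-1), 1.
  split=> //; last by exists 0.
  by split; [exists (-1)|exists (-1)|exists (-1)|exists 0].
- by apply: (williamson_mod1 (n := (p %/ 3)%N) (m := m)) => //; lia.
have pE' : p%:Z = 3 * (p %/ 3)%N%:Z + 2 by lia.
rewrite pE'; apply: (williamson_mod2 (m := m)); last by lia.
by rewrite -pE'; apply: lagrange_four_squares.
Qed.

(** * Integer matrices given by lists *)

(** Lists over the binary integers [Z] evaluate well under [vm_compute]; [mxZ] carries the results
    over to matrices, with 0 for missing entries. *)
Definition entryZ (l : seq (seq Z)) (i j : nat) : Z := nth Z0 (nth [::] l i) j.

Definition mxZ (m n : nat) (l : seq (seq Z)) : 'M[int]_(m, n) :=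
  \matrix_(i < m, j < n) int_of_Z (entryZ l i j).

Fixpoint dotZ (r s : seq Z) : Z :=
  if r is x :: r' then if s is y :: s' then Z.add (Z.mul x y) (dotZ r' s') else Z0 else Z0.

Definition mulTZ (l l' : seq (seq Z)) : seq (seq Z) := [seq [seq dotZ r s | s <- l'] | r <- l].

Definition diagZ (n : nat) (a : Z) : seq (seq Z) :=
  mkseq (fun i => mkseq (fun j => if i == j then a else Z0) n) n.

(** Transposition as the product of the identity with the transpose, so that it inherits its
    correctness from [mulTZ]. *)
Definition trZ (n : nat) (l : seq (seq Z)) : seq (seq Z) := mulTZ (diagZ n (Zpos xH)) l.

Definition mulZ (n : nat) (l l' : seq (seq Z)) : seq (seq Z) := mulTZ l (trZ n l').

Definition mapZ (f : Z -> Z) (l : seq (seq Z)) : seq (seq Z) := [seq [seq f x | x <- r] | r <- l].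

(** [dotZ] runs along whole rows, whereas a product of matrices stops at column [n]. *)
Definition widthZ (n : nat) (l : seq (seq Z)) : bool := all (fun r => size r <= n)%N l.

Lemma dotZE (n : nat) (r s : seq Z) : (size r <= n)%N ->
  int_of_Z (dotZ r s) = \sum_(k < n) int_of_Z (nth Z0 r k) * int_of_Z (nth Z0 s k).
Proof.
elim: r s n => [|x r IH] s n rn.
  by rewrite big1 // => k _; rewrite nth_nil mul0r.
case: s => [|y s]; first by rewrite big1 // => k _; rewrite nth_nil mulr0.
case: n rn => // n rn; rewrite big_ord_recl /= -IH // -rmorphM -rmorphD.
by [].
Qed.

Lemma entry_mulTZ (l l' : seq (seq Z)) (i j : nat) :
  entryZ (mulTZ l l') i j = dotZ (nth [::] l i) (nth [::] l' j).
Proof.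
rewrite /entryZ /mulTZ; have [il|il] := ltnP i (size l); last first.
  by rewrite [nth [::] (map _ _) i]nth_default ?size_map // [nth [::] l i]nth_default // nth_nil.
rewrite (nth_map [::]) //; have [jl|jl] := ltnP j (size l').
  by rewrite (nth_map [::]).
rewrite nth_default ?size_map // [nth [::] l' j]nth_default //.
by case: (nth _ _ _).
Qed.

Lemma size_row (n : nat) (l : seq (seq Z)) (i : nat) : widthZ n l -> (size (nth [::] l i) <= n)%N.
Proof.
move=> /all_nthP h; have [il|il] := ltnP i (size l); first exact: h.
by rewrite nth_default.
Qed.

Lemma mxZ_mulT (m n p : nat) (l l' : seq (seq Z)) : widthZ n l ->
  mxZ m n l *m (mxZ p n l')^T = mxZ m p (mulTZ l l').
Proof.
move=> ln; apply/matrixP => i j; rewrite !mxE entry_mulTZ (dotZE _ (n := n)) ?size_row //.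
by apply: eq_bigr => k _; rewrite !mxE.
Qed.

Lemma mxZ_diag (n : nat) (a : Z) : mxZ n n (diagZ n a) = (int_of_Z a)%:M.
Proof.
apply/matrixP => i j; rewrite !mxE /entryZ !nth_mkseq //.
by rewrite -val_eqE /=; case: eqP => _; rewrite ?mulr1n ?mulr0n.
Qed.

Lemma widthZ_diag (n : nat) (a : Z) : widthZ n (diagZ n a).
Proof. by apply/allP => r /mapP[i _ ->]; rewrite size_mkseq. Qed.

Lemma mxZ_tr (m n : nat) (l : seq (seq Z)) : (mxZ m n l)^T = mxZ n m (trZ n l).
Proof. by rewrite -(@mxZ_mulT n n m) ?widthZ_diag // mxZ_diag mul1mx. Qed.

Lemma mxZ_mul (m n p : nat) (l l' : seq (seq Z)) : widthZ n l ->
  mxZ m n l *m mxZ n p l' = mxZ m p (mulZ p l l').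
Proof. by move=> ln; rewrite -[mxZ n p l']trmxK mxZ_tr mxZ_mulT. Qed.

(** * Reduction modulo 2 *)

Definition parity (x : int) : bool := (x %% 2)%Z == 1.

Lemma parityD (x y : int) : parity (x + y) = parity x (+) parity y.
Proof. by rewrite /parity; lia. Qed.

Lemma parityM (x y : int) : parity (x * y) = parity x && parity y.
Proof.
rewrite /parity {1}(divz_eq x 2) {1}(divz_eq y 2).
have [->|->] : (x %% 2)%Z = 0 \/ (x %% 2)%Z = 1 by lia.
  by rewrite addr0 mulrAC modzMl.
have [->|->] : (y %% 2)%Z = 0 \/ (y %% 2)%Z = 1 by lia.
  by rewrite addr0 mulrA modzMl.
by rewrite mulrDl mul1r mulrAC addrA -mulrDl modzMDl.
Qed.

Lemma parity_sum (I : Type) (r : seq I) (F : I -> int) :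
  parity (\sum_(i <- r) F i) = \big[addb/false]_(i <- r) parity (F i).
Proof. by elim: r => [|i r IH]; rewrite ?big_nil // !big_cons parityD IH. Qed.

Lemma parityF (x : int) : parity x = false -> exists y, x = 2 * y.
Proof. by rewrite /parity => h; exists (x %/ 2)%Z; lia. Qed.

Lemma parity_mx (m n p : nat) (X : 'M[int]_(m, n)) (Y Y' : 'M[int]_(n, p)) (i : 'I_m) (j : 'I_p) :
  (forall k, parity (Y k j) = parity (Y' k j)) -> parity ((X *m Y) i j) = parity ((X *m Y') i j).
Proof. by move=> h; rewrite !mxE !parity_sum; apply: eq_bigr => k _; rewrite !parityM h. Qed.

Lemma parity_mxF (m n : nat) (X : 'M[int]_(m, n)) :
  (forall i j, parity (X i j) = false) -> exists Y, X = 2 *: Y.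
Proof.
move=> h; exists (\matrix_(i, j) (X i j %/ 2)%Z); apply/matrixP => i j; rewrite !mxE.
have [y ->] := parityF (h i j); rewrite mulKz //.
Qed.

Definition bits (l : seq (seq Z)) : seq (seq bool) := [seq [seq Z.odd x | x <- r] | r <- l].

Definition entryB (l : seq (seq bool)) (i j : nat) : bool := nth false (nth [::] l i) j.

Lemma parity_int_of_Z (x : Z) : parity (int_of_Z x) = Z.odd x.
Proof.
have := Z.div2_odd x; move: (Z.div2 x) (Z.odd x) => d b -> {x}; rewrite /parity.
by case: b; rewrite /Z.b2z; lia.
Qed.

Lemma parity_mxZ (m n : nat) (l : seq (seq Z)) (i : 'I_m) (j : 'I_n) :
  parity (mxZ m n l i j) = entryB (bits l) i j.
Proof.
rewrite mxE parity_int_of_Z /entryB /entryZ /bits.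
have [il|il] := ltnP i (size l); last first.
  by rewrite [nth [::] (map _ _) i]nth_default ?size_map // [nth [::] l i]nth_default // !nth_nil.
rewrite (nth_map [::]) //; have [jl|jl] := ltnP j (size (nth [::] l i)).
  by rewrite (nth_map Z0).
by rewrite [in RHS]nth_default ?size_map // nth_default.
Qed.

Definition all_iota (n : nat) (f : nat -> nat -> bool) : bool :=
  all (fun i => all (f i) (iota 0 n)) (iota 0 n).

Lemma all_iotaP (n : nat) (f : nat -> nat -> bool) :
  reflect (forall i j : 'I_n, f i j) (all_iota n f).
Proof.
apply: (iffP allP) => [h i j|h i]; last first.
  rewrite mem_iota => /andP[_ il]; apply/allP => j; rewrite mem_iota => /andP[_ jl].
  exact: (h (Ordinal il) (Ordinal jl)).
have ii (k : 'I_n) : (k : nat) \in iota 0 n by rewrite mem_iota ltn_ord.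
by have /allP/(_ _ (ii j)) := h i (ii i).
Qed.

(** * Binary words and the enumeration of their spans *)

Definition xors (r a : seq bool) : seq bool := [seq p.1 (+) p.2 | p <- zip r a].

Fixpoint span (c : seq bool) (M : seq (seq bool)) (a : seq bool) : seq bool :=
  if (c, M) is (b :: c', r :: M') then span c' M' (if b then xors r a else a) else a.

(** Visits all combinations of the rows along a binary tree, sharing partial sums. *)
Fixpoint all_span (p : seq bool -> bool) (M : seq (seq bool)) (a : seq bool) : bool :=
  if M is r :: M' then all_span p M' a && all_span p M' (xors r a) else p a.

Lemma all_spanP (p : seq bool -> bool) (c : seq bool) (M : seq (seq bool)) (a : seq bool) :
  size c = size M -> all_span p M a -> p (span c M a).
Proof.
elim: M c a => [|r M IH] [|b c] a //= [cM] /andP[h1 h2].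
by case: b; apply: IH.
Qed.

Lemma nth_xors (n : nat) (r a : seq bool) (j : nat) : size r = n -> size a = n ->
  nth false (xors r a) j = nth false r j (+) nth false a j.
Proof.
move=> rn an; have [jn|jn] := ltnP j n; last by rewrite !nth_default ?size_map ?size_zip ?rn ?an ?minnn.
by rewrite (nth_map (false, false)) ?size_zip ?rn ?an ?minnn // nth_zip ?rn ?an.
Qed.

Lemma size_xors (n : nat) (r a : seq bool) : size r = n -> size a = n -> size (xors r a) = n.
Proof. by move=> rn an; rewrite size_map size_zip rn an minnn. Qed.

Lemma size_span (n : nat) (c : seq bool) (M : seq (seq bool)) (a : seq bool) :
  all (fun r => size r == n) M -> size a = n -> size (span c M a) = n.
Proof.
elim: M c a => [|r M IH] [|b c] a //= /andP[/eqP rn Mn] an; apply: IH => //.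
by case: b => //; apply: size_xors.
Qed.

Lemma nth_span (n m : nat) (c : seq bool) (M : seq (seq bool)) (a : seq bool) (j : nat) :
  all (fun r => size r == n) M -> size a = n -> size c = m -> size M = m ->
  nth false (span c M a) j = nth false a j (+) \big[addb/false]_(k < m) (nth false c k && entryB M k j).
Proof.
elim: m c M a => [|m IH] [|b c] [|r M] a //=; first by rewrite big_ord0 addbF.
move=> /andP[/eqP rn Mn] an [cm] [Mm]; rewrite (IH c M) //; last by case: b => //; apply: size_xors.
rewrite big_ord_recl /=; case: b => /=; first by rewrite (nth_xors _ rn an) (addbC (nth false r j)) addbA.
by [].
Qed.

Definition bitsv (m : nat) (c : 'rV[int]_m) : seq bool := [seq parity (c 0 k) | k <- enum 'I_m].

Lemma size_bitsv (m : nat) (c : 'rV[int]_m) : size (bitsv c) = m.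
Proof. by rewrite size_map size_enum_ord. Qed.

Lemma nth_bitsv (m : nat) (c : 'rV[int]_m) (k : 'I_m) : nth false (bitsv c) k = parity (c 0 k).
Proof. by rewrite (nth_map k) ?size_enum_ord // nth_ord_enum. Qed.

Lemma bitsv_eqP (m : nat) (c d : 'rV[int]_m) :
  (forall k, parity (c 0 k) = parity (d 0 k)) <-> bitsv c = bitsv d.
Proof.
split=> [h|h k]; first by apply: eq_map => k.
by rewrite -!nth_bitsv h.
Qed.

Lemma bitsv_mul (m n : nat) (c : 'rV[int]_m) (l : seq (seq Z)) :
  all (fun r => size r == n) l -> size l = m ->
  bitsv (c *m mxZ m n l) = span (bitsv c) (bits l) (nseq n false).
Proof.
move=> ln lm; have bn : all (fun r => size r == n) (bits l).
  by rewrite all_map; apply: sub_all ln => r /=; rewrite size_map.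
apply: (@eq_from_nth _ false); first by rewrite size_bitsv (size_span (n := n)) ?size_nseq.
rewrite size_bitsv => j jn; rewrite -[j]/(val (Ordinal jn)) nth_bitsv.
rewrite (nth_span (m := m) (n := n)) ?size_nseq ?size_bitsv ?size_map //.
rewrite nth_nseq jn mxE parity_sum; apply: eq_bigr => k _.
by rewrite parityM nth_bitsv parity_mxZ.
Qed.

(** * Data *)

(* A basis of the Leech lattice in its standard coordinates, scaled by sqrt 8.  Only the first row
   is odd, and the first and the last twelve coordinates are complementary dodecads of the Golay
   code.  All the matrices below act on row vectors of coefficients in this basis. *)
Definition leech_basisL : seq (seq Z) := [::
  [:: 1; 1; 1; 1; 1; 1; 1; 1; 1; 1; 1; 1; 1; -3; 1; 1; 1; 1; 1; 1; 1; 1; 1; 1];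
  [:: 0; 0; 2; 0; 0; 0; 0; 2; 0; 0; 0; 0; -2; -2; 2; 0; 0; 2; 0; 0; 0; 0; 2; 2];
  [:: 0; 0; 0; 2; 0; 0; 0; 0; 0; 0; 0; 2; 2; 0; 0; 2; 0; 2; 0; 2; 2; 2; 0; 0];
  [:: 2; 0; 0; 0; 0; 0; 0; 2; 0; 2; 2; 0; -2; 0; 2; 0; 0; 0; 0; -2; 0; 0; 2; 0];
  [:: -2; -2; -2; 0; 0; 0; 0; -2; -2; -2; -2; 2; 0; 2; -2; 0; 0; -2; 0; 0; 0; 0; -2; 0];
  [:: 0; 0; 0; -2; 0; 0; 0; -2; 0; -2; 0; -2; 2; 2; 0; -2; -2; -2; 0; 0; 0; -2; -2; -2];
  [:: 0; 2; -2; 0; 0; 0; 2; 0; 0; 0; 0; 2; 0; -2; 0; 2; 2; 0; 2; 0; 0; 0; 0; 0];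
  [:: 0; 0; 0; 0; 0; -2; -2; 2; 0; 0; 0; -2; -2; 4; 0; -2; 0; 0; -2; 0; -2; 0; 0; 0];
  [:: 0; -2; -2; -2; 0; 0; 0; -2; 0; 0; 0; 0; 0; 0; 0; 0; 0; -2; 0; -2; -2; 0; 0; -2];
  [:: -2; 0; -2; -2; 0; 0; 0; -2; 0; -2; 0; -2; 0; 0; 0; 0; 0; 0; 0; 0; 0; 0; -2; -2];
  [:: 0; 0; 0; -2; 0; 0; 0; 0; -2; -2; -2; 0; -2; 0; -2; 0; 0; 0; 0; 0; -2; -2; 0; 0];
  [:: -2; 0; 0; 0; 0; 0; 2; -2; 0; -2; 0; 0; 0; 2; 0; 0; 0; -2; 0; 0; 0; -2; -2; 0];
  [:: 0; 0; 0; 0; -2; -2; 0; 0; 0; 0; 0; 0; -2; 2; 0; 0; 0; 0; -2; 0; -2; 0; 2; -2];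
  [:: -2; 0; 0; 0; 0; 0; -2; 0; 0; -2; -2; 0; -2; 0; 0; 2; 0; 2; 0; 0; -2; 0; 0; 0];
  [:: -2; -2; -2; 0; -2; 0; 0; -2; 0; 0; -2; 0; 2; 2; -2; 0; 0; 0; -2; 0; -2; 0; -2; 0];
  [:: 0; 0; 2; 0; 2; 2; 0; 0; 2; 0; 0; 0; -2; -4; 0; 0; 2; 2; 0; 0; 0; 0; 2; 0];
  [:: 2; 0; -2; 0; 0; 0; 2; 0; 2; 2; 0; 2; 0; 0; 0; 0; 2; -2; 0; 0; 0; 0; 0; 0];
  [:: 0; 0; 0; 0; -2; -2; 0; -2; -2; 0; 0; 0; 0; 2; 2; 0; -2; 0; 0; 0; 0; 0; 0; -2];
  [:: 0; -2; 0; 0; 0; 0; 0; 0; -2; -2; -2; 0; 0; 2; 0; 0; 0; 0; 0; 2; 0; -2; -2; 0];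
  [:: 0; 0; 0; -2; -2; -2; 0; 0; 0; -2; -2; -2; 0; 0; -2; -2; 0; 0; 0; -2; -2; -2; 0; -2];
  [:: 0; 0; 2; -2; 0; 0; 0; 0; 0; 0; 0; 0; 0; -2; 2; 2; 0; 2; 2; 2; 0; 0; 0; 0];
  [:: 0; 0; 2; 0; 2; 0; 0; 2; 2; 0; 0; 0; 2; -2; 0; -2; 0; 0; 2; 0; 0; 0; 0; 0];
  [:: -2; 0; 0; 0; -2; 0; 0; -2; 0; 0; -2; 0; 0; 2; -2; 2; 0; -2; 0; 0; 0; 0; 0; 0];
  [:: 0; 2; 2; 0; 0; 0; -2; 2; 2; 2; 0; 0; 0; -2; 0; 0; 0; 0; 0; 0; 0; 0; 0; 2]]%BZ.

Definition gram_invL : seq (seq Z) := [::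
  [:: 72; -12; -1; 34; 27; 6; -21; 12; -15; 17; 14; 4; -5; 8; 11; 1; 6; 14; -7; 12; 1; 0; 7; 3];
  [:: -12; 8; 7; -5; -7; 1; 7; 2; 8; -1; 1; 0; -2; -5; -1; 2; -2; 0; 3; -3; -4; 1; 2; 2];
  [:: -1; 7; 16; 3; -7; -1; 3; 7; 11; 5; 10; 5; -7; -7; 1; 4; -1; 6; 3; -1; -7; 3; 5; 6];
  [:: 34; -5; 3; 22; 14; 5; -8; 7; -8; 10; 9; 2; -3; 2; 8; 3; 2; 8; -3; 5; 0; 2; 5; 3];
  [:: 27; -7; -7; 14; 18; 7; -6; 3; -12; 2; -2; -2; 2; 5; 5; 1; 1; 1; -5; 6; 6; -3; 0; -1];
  [:: 6; 1; -1; 5; 7; 8; 4; 3; -3; -2; -3; -3; 1; 0; 3; 3; -2; -1; -1; 1; 2; -2; 1; 0];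
  [:: -21; 7; 3; -8; -6; 4; 14; 1; 7; -7; -6; -3; 1; -6; -1; 4; -6; -4; 4; -4; -1; -1; 0; 1];
  [:: 12; 2; 7; 7; 3; 3; 1; 8; 3; 3; 5; 2; -5; -3; 3; 4; -1; 5; 0; 2; -2; 0; 4; 3];
  [:: -15; 8; 11; -8; -12; -3; 7; 3; 14; -1; 3; 3; -4; -7; -3; 2; -3; 1; 5; -3; -6; 1; 2; 4];
  [:: 17; -1; 5; 10; 2; -2; -7; 3; -1; 10; 10; 3; -3; 0; 3; 0; 3; 7; 0; 1; -4; 4; 4; 3];
  [:: 14; 1; 10; 9; -2; -3; -6; 5; 3; 10; 14; 5; -6; -2; 3; 1; 3; 9; 0; 0; -6; 5; 5; 4];
  [:: 4; 0; 5; 2; -2; -3; -3; 2; 3; 3; 5; 4; -3; -1; 0; 0; 1; 3; 0; 1; -2; 1; 1; 2];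
  [:: -5; -2; -7; -3; 2; 1; 1; -5; -4; -3; -6; -3; 6; 2; -1; -2; -1; -5; 0; -1; 3; -1; -3; -2];
  [:: 8; -5; -7; 2; 5; 0; -6; -3; -7; 0; -2; -1; 2; 6; 0; -3; 3; -1; -3; 2; 3; -1; -2; -3];
  [:: 11; -1; 1; 8; 5; 3; -1; 3; -3; 3; 3; 0; -1; 0; 4; 2; 0; 3; -1; 1; 0; 1; 2; 1];
  [:: 1; 2; 4; 3; 1; 3; 4; 4; 2; 0; 1; 0; -2; -3; 2; 4; -2; 2; 1; 0; -1; 0; 2; 2];
  [:: 6; -2; -1; 2; 1; -2; -6; -1; -3; 3; 3; 1; -1; 3; 0; -2; 4; 2; -2; 1; 0; 1; 0; -1];
  [:: 14; 0; 6; 8; 1; -1; -4; 5; 1; 7; 9; 3; -5; -1; 3; 2; 2; 8; 0; 1; -4; 3; 4; 3];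
  [:: -7; 3; 3; -3; -5; -1; 4; 0; 5; 0; 0; 0; 0; -3; -1; 1; -2; 0; 4; -2; -3; 1; 1; 2];
  [:: 12; -3; -1; 5; 6; 1; -4; 2; -3; 1; 0; 1; -1; 2; 1; 0; 1; 1; -2; 4; 2; -2; 0; 0];
  [:: 1; -4; -7; 0; 6; 2; -1; -2; -6; -4; -6; -2; 3; 3; 0; -1; 0; -4; -3; 2; 6; -3; -3; -3];
  [:: 0; 1; 3; 2; -3; -2; -1; 0; 1; 4; 5; 1; -1; -1; 1; 0; 1; 3; 1; -2; -3; 4; 2; 1];
  [:: 7; 2; 5; 5; 0; 1; 0; 4; 2; 4; 5; 1; -3; -2; 2; 2; 0; 4; 1; 0; -3; 2; 4; 2];
  [:: 3; 2; 6; 3; -1; 0; 1; 3; 4; 3; 4; 2; -2; -3; 1; 2; -1; 3; 2; 0; -3; 1; 2; 4]]%BZ.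

Definition alphaL : seq (seq Z) := [::
  [:: -2; 0; -1; -1; 0; 0; -1; -1; -2; 0; 0; -1; -1; 1; -1; 0; 2; 0; -1; 0; 0; 0; 0; -1];
  [:: 4; 0; 1; 2; 0; 1; -2; 1; -1; 1; 2; 0; -2; 2; 0; 0; 2; 1; -1; 1; -1; 0; 1; -1];
  [:: -2; 0; -3; -1; 3; 2; 1; -1; -3; -3; -3; -2; 1; 1; 0; 0; 0; -2; -2; 0; 2; -1; -1; -2];
  [:: 6; -1; 0; 4; 2; 2; -1; 1; -2; 1; 0; 0; -1; 1; 1; 1; 1; 1; 0; 2; 0; -1; 1; 0];
  [:: -4; 2; 1; -2; 0; 0; 3; 1; 3; -2; -1; 1; 1; -2; 0; 0; -2; -1; 0; -1; 1; 0; -1; 1];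
  [:: -4; 0; -1; -4; -3; -3; 0; -2; 2; 0; -1; 0; 2; -1; -1; -2; -1; -1; 2; -1; 0; 1; -1; 0];
  [:: -4; 1; 0; -1; 1; 2; 3; 1; -1; -1; -1; -1; 0; -1; 0; 2; 0; 0; -1; -1; 1; 0; 0; 0];
  [:: 6; -2; 0; 2; 0; 0; -1; 1; 1; 0; 0; 1; 0; 1; 1; 0; -1; 1; 1; 1; -1; -1; 0; 1];
  [:: 0; 1; 4; 2; -1; -1; 1; 2; 3; 2; 2; 2; -1; -3; 1; 1; -1; 1; 1; 0; 0; 1; 1; 2];
  [:: 0; 1; 3; 1; -1; -1; 1; 2; 2; 2; 2; 1; -1; -2; 1; 1; -1; 2; 1; -1; -1; 2; 1; 1];
  [:: -2; 0; 1; -2; -2; -1; 0; 0; 2; 0; 1; 1; 1; 0; -1; -1; 0; -1; 0; -1; 0; 0; -1; 0];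
  [:: -2; 2; 1; -3; -2; -1; 1; 0; 3; 0; 0; 1; 1; -1; -1; -1; -1; 0; 1; -1; -1; 1; 0; 1];
  [:: 8; 0; 1; 4; 3; 3; 0; 2; 0; 1; 0; 0; 1; 0; 2; 1; -1; 0; 0; 1; 0; -1; 1; 1];
  [:: 0; 0; 3; 1; 0; 1; 1; 2; 2; -1; 1; 1; -1; 0; 0; 1; -1; 0; -1; 0; 0; 0; 0; 0];
  [:: -4; 1; 1; -1; -2; -1; 3; 0; 3; -1; 0; 1; 1; -2; 1; 0; -3; -1; 1; -2; 0; 1; 0; 1];
  [:: 0; 2; 6; 1; -3; -1; -2; 2; 3; 3; 5; 2; -4; -1; -1; 1; 2; 2; 0; 0; -3; 1; 2; 1];
  [:: -4; 1; 0; -1; 0; 1; 2; 0; 0; -1; -2; 0; 0; -1; 0; 1; 0; -1; 0; 0; 1; -1; 0; 1];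
  [:: 6; -1; -2; 3; 4; 2; -1; 0; -3; 0; -1; -1; 2; 1; 2; 0; 0; 0; -1; 1; 2; 0; 0; -1];
  [:: -4; 0; -1; -5; -2; -2; 0; -1; 2; -3; -2; 1; 1; 1; -2; -2; 0; -2; 0; 0; 1; -1; -2; -1];
  [:: 0; 1; 4; 0; -3; -1; 2; 2; 4; 2; 3; 1; 0; -3; 1; 1; -2; 1; 2; -1; -2; 1; 1; 2];
  [:: 0; -2; -1; 0; 1; -1; -3; -1; -3; 0; 0; 0; 0; 2; -1; -1; 2; -1; -2; 1; 2; 0; -1; -2];
  [:: -8; 1; 2; -4; -5; -3; 1; -1; 3; 0; 1; 0; -1; -2; -2; 0; 0; 0; 2; -1; -2; 1; 0; 1];
  [:: 6; -1; -1; 3; 5; 2; 0; 1; -1; 0; -1; 0; 2; 0; 1; 0; -2; -1; -1; 1; 2; -1; 0; 1];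
  [:: -4; -1; -1; -1; -1; 0; 0; -2; -1; -1; -1; -1; 0; 1; -1; 0; 0; -1; 0; 0; 0; -1; -1; 0]]%BZ.

(* gen1L and gen2L generate the copy of SL_2(25) in the automorphism group which commutes with
   alpha. *)
Definition gen1L : seq (seq Z) := [::
  [:: 0; -1; -4; -2; 1; 0; 0; -1; -1; -2; -3; -1; 1; 2; -1; -1; 0; -1; 0; 0; 1; -1; -1; -1];
  [:: -6; 0; -2; -3; -2; -1; 1; -2; 0; -2; -2; -1; 0; 1; -1; -1; 0; -1; 0; -1; 0; 0; -1; -1];
  [:: -3; 1; -1; -3; 0; 1; 2; 0; 1; -3; -3; 0; 1; 0; -1; 0; -1; -2; 0; 0; 1; -2; -1; 0];
  [:: 1; -1; -2; 0; 0; -1; -1; -1; -1; 0; 0; -1; 0; 1; 0; -1; 0; 0; 0; 0; 0; 0; 0; -1];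
  [:: 1; 3; 5; 1; 0; 2; 2; 3; 3; 1; 2; 1; -1; -3; 1; 2; -1; 1; 0; 0; -1; 0; 1; 2];
  [:: -1; 0; 2; 1; -1; -1; -1; 0; 0; 2; 2; 1; 0; -1; 0; 0; 1; 0; 0; 0; 0; 1; 0; 0];
  [:: 5; 0; 0; 2; 2; 1; 0; 2; 0; 1; 1; 0; -1; 0; 1; 1; 0; 2; 0; 0; 0; 0; 1; 1];
  [:: -1; 0; 2; 2; -1; 0; 0; 0; -1; 1; 2; 0; -1; -1; 1; 1; 0; 1; 0; 0; -1; 1; 1; 0];
  [:: 4; 0; 1; 2; 1; 0; -1; 1; 0; 2; 2; 0; 0; -1; 1; 0; 0; 1; 0; 0; 0; 1; 1; 0];
  [:: 0; 0; 2; 1; 0; -1; -1; 0; 0; 2; 2; 1; 0; -1; 0; 0; 1; 1; 0; 0; 0; 1; 0; 1];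
  [:: -2; 2; 5; 2; -2; 0; 2; 2; 3; 2; 3; 1; -2; -3; 1; 2; -1; 2; 1; -1; -2; 2; 2; 2];
  [:: 1; 1; 2; 2; 1; 2; 1; 1; 0; 1; 1; 0; 0; -1; 1; 1; 0; 0; 0; 0; 0; 0; 0; 1];
  [:: 0; 0; 2; 2; 0; 1; 1; 1; 0; 0; 1; 0; -1; -1; 1; 1; -1; 0; 0; 0; 0; 0; 1; 0];
  [:: -8; 2; 2; -2; -3; 0; 3; -1; 2; -1; 0; 0; 0; -2; 0; 1; -1; 0; 1; -2; -1; 1; 0; 1];
  [:: 7; 0; 2; 4; 3; 2; -1; 2; -1; 2; 2; 1; 0; -1; 2; 1; 0; 1; -1; 1; 0; 0; 1; 1];
  [:: -2; -1; -3; -1; 1; 0; 0; -2; -1; -2; -3; -1; 1; 2; -1; -1; 0; -1; 0; 0; 1; 0; -1; -1];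
  [:: 12; -2; -1; 5; 5; 2; -2; 3; -2; 1; 1; 0; -1; 1; 2; 1; 0; 2; -1; 2; 1; -1; 1; 0];
  [:: -4; 1; 2; -1; -2; 0; 1; 0; 1; 0; 1; 0; 0; -1; 0; 0; 0; -1; 0; -1; 0; 0; 0; 0];
  [:: -3; 3; 5; 1; -2; 1; 3; 2; 3; 1; 2; 1; -1; -3; 1; 2; -1; 1; 1; -1; -2; 1; 1; 2];
  [:: 1; 0; 3; 3; -1; -1; -1; 1; 0; 3; 3; 1; -2; -1; 1; 1; 1; 2; 0; 0; -1; 2; 2; 0];
  [:: -7; 0; -1; -3; -3; -2; 1; -2; 1; -1; -1; 0; 1; 0; -1; -1; 0; -1; 1; -2; 0; 1; -1; 0];
  [:: -2; -1; -4; -2; 0; -1; -1; -2; -2; -1; -3; -1; 1; 2; -1; -1; 1; -1; 0; 0; 1; 0; -1; -2];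
  [:: 1; 0; 2; 1; 0; 1; 1; 1; 1; 0; 1; 1; 0; -1; 1; 1; -1; 0; 0; 0; 0; 0; 0; 1];
  [:: -1; -2; -3; -2; -1; -2; -2; -2; -1; -1; -1; 0; 0; 2; -1; -1; 1; 0; 0; 0; 0; 0; -1; -1]]%BZ.

Definition gen2L : seq (seq Z) := [::
  [:: 6; -1; -2; 2; 3; 2; -1; 1; -2; 0; 0; -1; 0; 1; 1; 0; 0; 0; -1; 1; 1; -1; 0; -1];
  [:: 6; -1; 1; 3; 2; 0; -3; 1; -1; 2; 3; 1; -1; 0; 1; 0; 1; 2; -1; 1; 0; 0; 0; 1];
  [:: -3; 1; -2; -3; 0; 1; 2; 0; 1; -3; -3; -1; 0; 0; -1; 0; -1; -2; 0; 0; 1; -2; -1; -1];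
  [:: 1; -1; -1; 0; 1; 0; -2; -1; -2; 0; 1; 0; 1; 1; 0; -1; 1; 0; -2; 0; 1; 0; -1; -1];
  [:: -6; 2; 3; -2; -4; -2; 3; 1; 4; 0; 0; 1; -2; -2; -1; 1; -1; 1; 2; -1; -2; 1; 1; 1];
  [:: -3; 0; 0; 0; -1; 0; 1; -1; 0; 0; -1; -1; 1; 0; 0; 0; 0; -1; 1; -1; 0; 1; 1; 0];
  [:: 1; 0; -1; 1; 1; 2; 2; 1; -1; -1; -1; -1; 0; 0; 1; 1; -1; 0; 0; 0; 0; 0; 0; -1];
  [:: -3; 0; 0; -2; -1; -2; -1; -2; 0; 0; 0; 1; 1; 0; -1; -1; 1; 0; 0; 0; 0; 0; -1; 1];
  [:: -4; 1; 2; 0; -2; 0; 2; 0; 1; 0; 0; 0; 0; -1; 0; 1; -1; 0; 1; -1; -1; 1; 1; 0];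
  [:: -3; 1; 2; 0; -2; 0; 2; 0; 2; 0; 0; 0; 0; -1; 0; 1; -1; 0; 2; -1; -2; 1; 1; 1];
  [:: -2; 0; 2; 0; -2; -2; 0; 0; 1; 1; 1; 1; -1; -1; 0; 0; 0; 1; 1; 0; -1; 1; 0; 1];
  [:: 1; 1; 2; 2; -1; 0; 1; 1; 1; 2; 2; 0; -1; -1; 1; 1; 0; 2; 1; -1; -2; 2; 2; 1];
  [:: -7; 1; 0; -3; -2; -1; 1; -2; 0; -1; -1; 0; 1; -1; -1; 0; 0; -1; 0; -1; 0; 0; -1; 0];
  [:: -5; 2; 3; -1; -3; -1; 2; 0; 3; 0; 1; 1; -1; -2; 0; 1; -1; 1; 2; -1; -2; 1; 0; 2];
  [:: -2; 2; 2; 0; -1; 0; 2; 1; 2; 0; -1; 1; -1; -1; 0; 1; -1; 0; 1; 0; -1; 0; 1; 1];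
  [:: 5; 0; 2; 2; -1; -1; -2; 1; 1; 3; 4; 1; -1; -1; 1; 0; 0; 2; 1; 0; -2; 1; 1; 1];
  [:: 3; -1; -3; 1; 2; 1; 0; 0; -3; 0; -1; -1; 1; 1; 1; 0; 0; 0; -1; 0; 1; 0; 0; -2];
  [:: -8; 1; 0; -3; -1; 1; 3; -1; 1; -3; -3; -1; 1; -1; -1; 1; -1; -2; 0; -1; 1; -1; -1; 0];
  [:: -1; 0; 0; 0; 0; -1; 1; 0; 1; 0; -1; 0; 0; -1; 0; 0; -1; 0; 1; 0; 0; 0; 0; 1];
  [:: -3; 0; 2; 1; -1; -1; 0; -1; 0; 1; 0; 1; 1; -1; 0; 0; 0; -1; 1; 0; 0; 1; 0; 1];
  [:: 4; -1; -1; 2; 3; 2; 0; 1; -1; -1; -1; -1; 0; 0; 1; 1; -1; 0; 0; 1; 1; -1; 0; 0];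
  [:: 5; -1; 0; 3; 2; 1; -1; 1; -1; 1; 1; 0; 0; 0; 1; 0; 0; 0; 0; 1; 1; 0; 1; 0];
  [:: -4; 1; 0; -2; -2; -1; 1; -1; 1; 0; -1; 0; 0; 0; -1; 0; 0; 0; 1; -1; -1; 1; 0; 0];
  [:: 6; -1; -1; 2; 3; 1; -2; 1; -2; 1; 1; 0; 0; 1; 1; 0; 1; 1; -1; 1; 1; 0; 0; 0]]%BZ.

(* u classL mod 2 is the class of u modulo the image of alpha, since classL unclassL = alpha' mod 2;
   the generators act on these classes through gen1_classL and gen2_classL. *)
Definition classL : seq (seq Z) := [::
  [:: 1; 0; 1; 1; 0; 0; 1; 1; 0; 0; 0; 0];
  [:: 0; 1; 1; 0; 0; 1; 0; 1; 1; 1; 0; 0];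
  [:: 0; 0; 0; 1; 1; 0; 1; 1; 1; 1; 1; 0];
  [:: 0; 1; 0; 1; 0; 0; 1; 1; 0; 1; 0; 1];
  [:: 0; 0; 1; 0; 1; 0; 1; 1; 1; 0; 1; 0];
  [:: 0; 0; 1; 0; 1; 0; 0; 0; 0; 0; 1; 0];
  [:: 0; 1; 0; 1; 1; 0; 0; 1; 1; 1; 1; 0];
  [:: 0; 0; 0; 0; 0; 0; 1; 0; 1; 0; 0; 0];
  [:: 0; 1; 0; 0; 1; 1; 1; 0; 0; 0; 0; 1];
  [:: 0; 1; 1; 1; 1; 1; 1; 0; 0; 1; 0; 1];
  [:: 0; 0; 1; 0; 0; 1; 0; 0; 0; 0; 0; 1];
  [:: 0; 0; 1; 1; 0; 1; 1; 0; 1; 0; 0; 1];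
  [:: 0; 0; 1; 0; 1; 1; 0; 0; 0; 1; 0; 1];
  [:: 0; 0; 1; 1; 0; 1; 1; 0; 0; 1; 1; 1];
  [:: 0; 1; 1; 1; 0; 1; 1; 0; 1; 1; 0; 0];
  [:: 0; 0; 0; 1; 1; 1; 0; 0; 1; 1; 1; 0];
  [:: 0; 1; 0; 1; 0; 1; 0; 0; 0; 1; 0; 1];
  [:: 0; 1; 0; 1; 0; 0; 1; 0; 1; 0; 1; 0];
  [:: 0; 0; 1; 1; 0; 0; 0; 1; 0; 1; 0; 0];
  [:: 0; 1; 0; 0; 1; 1; 0; 0; 0; 0; 1; 1];
  [:: 0; 0; 1; 0; 1; 1; 1; 1; 1; 0; 0; 1];
  [:: 0; 1; 0; 0; 1; 1; 1; 1; 1; 0; 1; 0];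
  [:: 0; 1; 1; 1; 1; 0; 0; 1; 1; 0; 1; 0];
  [:: 0; 1; 1; 1; 1; 0; 0; 0; 1; 1; 1; 0]]%BZ.

Definition unclassL : seq (seq Z) := [::
  [:: 1; 0; 0; 0; 0; 0; 0; 0; 0; 0; 0; 0; 1; 1; 0; 0; 1; 0; 1; 1; 0; 0; 0; 0];
  [:: 0; 1; 0; 0; 0; 0; 0; 0; 0; 0; 0; 0; 1; 0; 1; 0; 1; 1; 0; 0; 0; 0; 1; 0];
  [:: 0; 0; 1; 0; 0; 0; 0; 0; 0; 0; 0; 0; 1; 0; 1; 0; 0; 0; 0; 0; 1; 1; 1; 1];
  [:: 0; 0; 0; 1; 0; 0; 0; 0; 0; 0; 0; 0; 0; 0; 1; 0; 0; 0; 0; 1; 0; 0; 1; 0];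
  [:: 0; 0; 0; 0; 1; 0; 0; 0; 0; 0; 0; 0; 0; 1; 1; 0; 1; 0; 0; 0; 0; 1; 0; 1];
  [:: 0; 0; 0; 0; 0; 1; 0; 0; 0; 0; 0; 1; 0; 0; 0; 0; 1; 0; 0; 0; 0; 1; 1; 1];
  [:: 0; 0; 0; 0; 0; 0; 1; 0; 0; 0; 0; 1; 0; 0; 1; 0; 1; 1; 1; 1; 1; 1; 0; 0];
  [:: 0; 0; 0; 0; 0; 0; 0; 1; 0; 0; 0; 0; 1; 0; 0; 0; 0; 1; 1; 1; 0; 0; 0; 0];
  [:: 0; 0; 0; 0; 0; 0; 0; 0; 1; 0; 0; 0; 0; 1; 0; 0; 0; 0; 0; 0; 0; 0; 0; 1];
  [:: 0; 0; 0; 0; 0; 0; 0; 0; 0; 1; 0; 1; 1; 1; 0; 0; 0; 1; 0; 0; 0; 0; 0; 0];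
  [:: 0; 0; 0; 0; 0; 0; 0; 0; 0; 0; 1; 0; 1; 0; 1; 0; 0; 1; 0; 1; 1; 1; 0; 0];
  [:: 0; 0; 0; 0; 0; 0; 0; 0; 0; 0; 0; 0; 0; 0; 0; 1; 1; 1; 0; 1; 1; 0; 1; 0]]%BZ.

Definition gen1_classL : seq (seq Z) := [::
  [:: 0; 0; 1; 1; 0; 1; 0; 1; 0; 0; 0; 1];
  [:: 0; 1; 1; 0; 0; 1; 1; 1; 1; 1; 0; 1];
  [:: 1; 0; 1; 1; 1; 0; 1; 0; 1; 0; 0; 0];
  [:: 0; 1; 1; 0; 0; 1; 0; 1; 1; 1; 0; 0];
  [:: 1; 0; 1; 0; 0; 1; 1; 1; 1; 1; 1; 1];
  [:: 0; 0; 0; 1; 0; 1; 0; 1; 0; 0; 1; 1];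
  [:: 0; 0; 0; 1; 1; 0; 1; 1; 0; 1; 1; 1];
  [:: 1; 0; 0; 1; 0; 1; 0; 0; 1; 1; 1; 1];
  [:: 1; 0; 0; 0; 1; 0; 0; 0; 1; 0; 1; 0];
  [:: 1; 0; 0; 0; 0; 0; 1; 1; 1; 0; 1; 1];
  [:: 1; 0; 1; 1; 1; 1; 0; 0; 0; 1; 0; 1];
  [:: 1; 0; 0; 0; 0; 0; 0; 1; 0; 1; 0; 1]]%BZ.

Definition gen1_class_invL : seq (seq Z) := [::
  [:: 1; 1; 0; 1; 1; 1; 1; 1; 1; 1; 0; 1];
  [:: 1; 1; 0; 0; 1; 1; 0; 1; 1; 0; 1; 0];
  [:: 1; 1; 0; 1; 1; 1; 1; 0; 0; 1; 1; 1];
  [:: 0; 1; 0; 1; 0; 1; 1; 1; 1; 0; 0; 0];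
  [:: 0; 0; 1; 0; 0; 0; 1; 1; 0; 0; 1; 1];
  [:: 1; 1; 0; 1; 1; 0; 0; 1; 0; 0; 0; 0];
  [:: 1; 1; 1; 1; 0; 0; 1; 1; 0; 0; 0; 0];
  [:: 0; 1; 1; 1; 0; 0; 1; 1; 1; 1; 1; 1];
  [:: 1; 0; 1; 0; 0; 1; 1; 0; 0; 0; 0; 1];
  [:: 0; 0; 0; 0; 1; 1; 1; 1; 0; 0; 1; 1];
  [:: 0; 1; 0; 1; 1; 0; 1; 0; 0; 1; 1; 1];
  [:: 1; 0; 1; 0; 0; 0; 1; 1; 0; 0; 0; 0]]%BZ.

Definition gen2_classL : seq (seq Z) := [::
  [:: 1; 1; 0; 0; 1; 1; 1; 0; 1; 0; 0; 1];
  [:: 0; 1; 0; 0; 0; 0; 0; 0; 0; 0; 0; 0];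
  [:: 1; 0; 0; 1; 1; 1; 1; 1; 0; 1; 1; 0];
  [:: 0; 0; 1; 1; 1; 0; 1; 0; 1; 1; 1; 0];
  [:: 1; 1; 0; 1; 1; 0; 0; 0; 1; 0; 1; 1];
  [:: 0; 1; 0; 0; 1; 0; 0; 1; 0; 0; 1; 1];
  [:: 0; 1; 1; 1; 0; 1; 0; 1; 1; 1; 1; 1];
  [:: 0; 0; 0; 1; 1; 0; 0; 0; 0; 1; 1; 0];
  [:: 1; 0; 0; 1; 0; 0; 0; 1; 0; 1; 0; 0];
  [:: 0; 0; 1; 1; 1; 1; 1; 0; 1; 0; 1; 0];
  [:: 1; 0; 1; 0; 0; 0; 1; 1; 0; 0; 0; 1];
  [:: 1; 0; 0; 1; 0; 1; 0; 1; 1; 0; 0; 0]]%BZ.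

Definition gen2_class_invL : seq (seq Z) := [::
  [:: 1; 1; 0; 0; 0; 1; 1; 0; 1; 0; 1; 0];
  [:: 0; 1; 0; 0; 0; 0; 0; 0; 0; 0; 0; 0];
  [:: 1; 0; 1; 0; 1; 1; 1; 0; 0; 0; 0; 1];
  [:: 1; 0; 0; 1; 1; 1; 1; 0; 0; 0; 0; 0];
  [:: 0; 0; 1; 1; 0; 1; 1; 0; 1; 0; 0; 0];
  [:: 0; 0; 0; 0; 1; 1; 0; 0; 0; 0; 0; 1];
  [:: 1; 0; 1; 0; 1; 1; 1; 1; 1; 1; 0; 0];
  [:: 0; 1; 0; 0; 0; 1; 0; 0; 0; 1; 1; 1];
  [:: 0; 0; 0; 1; 0; 0; 0; 0; 1; 1; 0; 1];
  [:: 0; 0; 0; 1; 1; 1; 0; 0; 0; 1; 0; 1];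
  [:: 1; 0; 1; 1; 0; 1; 0; 1; 1; 1; 0; 1];
  [:: 1; 0; 0; 0; 0; 0; 1; 1; 0; 0; 1; 0]]%BZ.

(* golayL generates the Golay code; golay_coordL golayL = half_basisL mod 2. *)
Definition golay_coordL : seq (seq Z) := [::
  [:: 1; 1; 1; 1; 1; 1; 1; 1; 1; 1; 1; 1];
  [:: 0; 0; 1; 0; 0; 0; 0; 1; 0; 0; 0; 1];
  [:: 0; 0; 0; 1; 0; 0; 0; 0; 0; 0; 0; 1];
  [:: 1; 0; 0; 0; 0; 0; 0; 1; 0; 1; 1; 1];
  [:: 1; 1; 1; 0; 0; 0; 0; 1; 1; 1; 1; 0];
  [:: 0; 0; 0; 1; 0; 0; 0; 1; 0; 1; 0; 1];
  [:: 0; 1; 1; 0; 0; 0; 1; 0; 0; 0; 0; 0];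
  [:: 0; 0; 0; 0; 0; 1; 1; 1; 0; 0; 0; 1];
  [:: 0; 1; 1; 1; 0; 0; 0; 1; 0; 0; 0; 0];
  [:: 1; 0; 1; 1; 0; 0; 0; 1; 0; 1; 0; 0];
  [:: 0; 0; 0; 1; 0; 0; 0; 0; 1; 1; 1; 1];
  [:: 1; 0; 0; 0; 0; 0; 1; 1; 0; 1; 0; 0];
  [:: 0; 0; 0; 0; 1; 1; 0; 0; 0; 0; 0; 1];
  [:: 1; 0; 0; 0; 0; 0; 1; 0; 0; 1; 1; 1];
  [:: 1; 1; 1; 0; 1; 0; 0; 1; 0; 0; 1; 1];
  [:: 0; 0; 1; 0; 1; 1; 0; 0; 1; 0; 0; 1];
  [:: 1; 0; 1; 0; 0; 0; 1; 0; 1; 1; 0; 0];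
  [:: 0; 0; 0; 0; 1; 1; 0; 1; 1; 0; 0; 0];
  [:: 0; 1; 0; 0; 0; 0; 0; 0; 1; 1; 1; 0];
  [:: 0; 0; 0; 1; 1; 1; 0; 0; 0; 1; 1; 0];
  [:: 0; 0; 1; 1; 0; 0; 0; 0; 0; 0; 0; 0];
  [:: 0; 0; 1; 0; 1; 0; 0; 1; 1; 0; 0; 1];
  [:: 1; 0; 0; 0; 1; 0; 0; 1; 0; 0; 1; 0];
  [:: 0; 1; 1; 0; 0; 0; 1; 1; 1; 1; 0; 0]]%BZ.

Definition golayL : seq (seq Z) := [::
  [:: 1; 0; 0; 0; 0; 0; 0; 0; 0; 0; 0; 1; 0; 0; 1; 1; 1; 1; 1; 0; 1; 0; 0; 0];
  [:: 0; 1; 0; 0; 0; 0; 0; 0; 0; 0; 0; 1; 0; 1; 1; 1; 0; 1; 0; 0; 0; 1; 1; 0];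
  [:: 0; 0; 1; 0; 0; 0; 0; 0; 0; 0; 0; 1; 0; 0; 0; 1; 1; 1; 0; 1; 0; 0; 1; 1];
  [:: 0; 0; 0; 1; 0; 0; 0; 0; 0; 0; 0; 1; 0; 1; 1; 0; 1; 0; 1; 0; 0; 0; 1; 1];
  [:: 0; 0; 0; 0; 1; 0; 0; 0; 0; 0; 0; 1; 0; 1; 1; 0; 0; 1; 0; 1; 1; 0; 0; 1];
  [:: 0; 0; 0; 0; 0; 1; 0; 0; 0; 0; 0; 1; 0; 1; 0; 1; 1; 0; 0; 0; 1; 1; 0; 1];
  [:: 0; 0; 0; 0; 0; 0; 1; 0; 0; 0; 0; 1; 0; 0; 1; 1; 0; 0; 1; 1; 0; 1; 0; 1];
  [:: 0; 0; 0; 0; 0; 0; 0; 1; 0; 0; 0; 1; 0; 0; 0; 0; 0; 1; 1; 0; 1; 1; 1; 1];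
  [:: 0; 0; 0; 0; 0; 0; 0; 0; 1; 0; 0; 1; 0; 1; 0; 1; 0; 0; 1; 1; 1; 0; 1; 0];
  [:: 0; 0; 0; 0; 0; 0; 0; 0; 0; 1; 0; 1; 0; 1; 0; 0; 1; 1; 1; 1; 0; 1; 0; 0];
  [:: 0; 0; 0; 0; 0; 0; 0; 0; 0; 0; 1; 1; 0; 0; 1; 0; 1; 0; 0; 1; 1; 1; 1; 0];
  [:: 0; 0; 0; 0; 0; 0; 0; 0; 0; 0; 0; 0; 1; 1; 1; 1; 1; 1; 1; 1; 1; 1; 1; 1]]%BZ.

(* One orthogonal frame of minimal vectors for each of the six orbits of SL_2(25). *)
Definition frame0L : seq (seq Z) := [::
  [:: 3; -1; 2; 2; 1; 0; -1; 1; 0; 1; 2; 1; -1; 0; 0; 0; 0; 1; -1; 1; 0; 0; 0; 1];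
  [:: -5; 0; 1; -2; -2; -2; 0; -1; 1; -1; 0; 1; 0; -1; -1; 0; 0; 0; 0; 0; 0; 0; -1; 0];
  [:: 5; -1; 0; 2; 0; 0; -2; 0; -1; 2; 2; 0; 0; 1; 1; 0; 1; 2; 0; 0; -1; 1; 1; 0];
  [:: 5; -1; 0; 1; 0; -2; -3; 0; 0; 2; 2; 2; -1; 1; 0; -1; 1; 2; 0; 1; -1; 0; 0; 1];
  [:: -5; 0; -1; -3; -3; -2; 0; -2; 1; -1; 0; 0; 0; 0; -1; -1; 0; -1; 0; -1; 0; 0; -1; -1];
  [:: 1; 1; 2; 0; -1; -1; 0; 1; 2; 1; 1; 1; -1; -1; 0; 0; 0; 1; 1; 0; -1; 0; 0; 1];
  [:: -1; 0; 0; -1; -1; 0; 1; 0; 1; -1; 0; 0; 0; 0; 0; 0; -1; 0; 0; -1; -1; 0; 0; 0];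
  [:: 3; 0; 0; 0; 0; -1; 0; 1; 1; 1; 1; 0; 0; -1; 0; 0; -1; 1; 1; 0; -1; 1; 1; 0];
  [:: -1; 1; 0; -2; -2; 0; 0; 0; 1; -1; 0; 0; -1; 1; -1; -1; 1; 0; 0; 0; -1; 0; 0; -1];
  [:: -1; 3; 4; -1; -2; 0; 1; 2; 3; 1; 2; 1; -2; -2; 0; 1; 0; 1; 0; 0; -2; 0; 1; 1];
  [:: -5; 2; 0; -3; -2; 0; 1; -1; 1; -1; -1; -1; 0; 0; -1; -1; 0; -1; 0; -1; 0; 0; 0; -1];
  [:: 3; 1; 3; 2; 1; 2; 1; 3; 2; -1; 1; 1; -2; -1; 1; 2; -1; 1; 0; 1; 0; -1; 1; 1];
  [:: -3; 0; 1; -1; -2; -1; 0; -1; 1; 0; 1; 1; 1; 0; 0; -1; 0; -1; 0; -1; 0; 1; -1; 0];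
  [:: -3; 2; 3; -1; -3; -1; 1; 0; 4; 1; 1; 1; 0; -2; -1; 0; -1; 0; 2; -1; -2; 1; 1; 2];
  [:: 5; 0; 3; 4; 0; -1; -3; 1; 0; 4; 5; 1; -2; 0; 1; 0; 2; 3; 0; 0; -2; 2; 2; 1];
  [:: 1; -1; 0; 1; 0; -1; -2; 0; -1; 1; 1; 1; -1; 1; 0; 0; 1; 1; -1; 0; 0; 1; 0; -1];
  [:: -1; 0; 0; -1; -1; 0; 0; 0; 0; 0; 1; 0; 0; -1; 0; 0; 0; 0; 0; -1; 0; 0; 0; 0];
  [:: -5; 2; 1; -1; -2; 1; 3; -1; 1; 0; 0; -1; 1; -1; 0; 1; -1; 0; 2; -2; -2; 1; 0; 1];
  [:: -5; 0; 0; -4; -2; -1; 1; -1; 2; -2; -2; 0; 0; 0; -2; 0; 0; -1; 1; 0; 0; -1; -1; 0];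
  [:: -3; 1; 2; 0; -2; 0; 3; 2; 2; 0; 1; 0; -2; -2; 1; 2; -1; 2; 1; -1; -1; 1; 1; 1];
  [:: 1; 1; 1; 2; 1; 2; 2; 1; 0; 0; 0; 0; 0; -1; 1; 1; -1; 0; 0; 0; 0; 0; 1; 0];
  [:: -1; 1; 0; -1; 0; 0; 0; 0; 0; 0; 1; 0; 0; 0; 0; 0; 1; 1; -1; -1; 0; 1; 0; 0];
  [:: -1; 0; 0; 1; 0; 0; 0; -1; -1; 0; 0; 0; 0; 0; 1; 0; 0; 0; 0; 0; 0; 1; 0; 0];
  [:: -5; 1; 2; -2; -4; -2; 1; 0; 2; 0; 1; 1; -1; -1; -1; 0; 0; 0; 1; -1; -1; 1; 1; 0]]%BZ.

Definition frame1L : seq (seq Z) := [::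
  [:: 1; 1; -1; 1; 0; 1; 1; 0; -1; 1; 1; -1; 0; 0; 1; 0; 0; 1; 0; -1; -1; 1; 1; 0];
  [:: -5; 0; 0; -2; -2; -2; 0; -1; 1; 0; 0; 0; 0; -1; -1; 0; 0; 0; 0; -1; 0; 1; 0; 0];
  [:: -5; 2; 2; -2; -3; -1; 2; 1; 2; 0; 1; 0; -2; -2; 0; 1; 0; 1; 1; -1; -1; 1; 1; 0];
  [:: 5; 0; 2; 3; 0; 0; -1; 2; 1; 2; 3; 1; -1; -1; 1; 1; 0; 2; 1; 0; -1; 1; 2; 1];
  [:: -1; 2; 3; -1; -3; -1; 1; 1; 3; 1; 2; 1; -1; -2; 0; 0; -1; 1; 1; -1; -2; 1; 1; 1];
  [:: -5; 1; 0; -2; -2; -1; 0; -2; 0; 0; 0; 0; 1; 0; -1; -1; 1; -1; 0; -1; 0; 1; -1; -1];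
  [:: 3; -1; 0; 0; -1; -3; -4; -1; 0; 2; 2; 1; -1; 1; -1; -2; 2; 1; 0; 1; -1; 0; 0; 0];
  [:: -5; 1; -2; -5; -2; 0; 2; -1; 2; -3; -3; -1; 1; 0; -2; -1; -1; -2; 1; -1; 0; -1; -1; -1];
  [:: -1; 1; 2; 0; -1; 0; 0; 1; 1; 0; 1; 1; -2; 0; 0; 1; 1; 2; 0; 0; -1; 0; 0; 1];
  [:: -3; 1; 1; 0; -2; 0; 1; -1; 1; 0; 0; 0; 0; 0; 0; 0; 0; 0; 1; -1; -1; 1; 1; 0];
  [:: -3; 0; 0; -1; -2; 0; 1; -1; 0; 0; 0; -1; 1; 0; 0; 0; 0; 0; 1; -1; -1; 1; 0; 0];
  [:: 3; 0; 0; 0; 0; -1; -1; 0; 1; 1; 0; 1; 0; 0; 0; 0; 0; 1; 1; 1; -1; 0; 0; 1];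
  [:: -1; 1; 1; -1; -1; 0; 1; 1; 2; -1; 0; 0; -1; 0; 0; 0; 0; 0; 0; 0; 0; 0; 0; 0];
  [:: 1; 2; 2; 0; 1; 2; 1; 2; 1; -1; 0; 0; -1; -1; 0; 1; 0; 0; -1; 1; 0; -1; 1; 0];
  [:: 1; -1; 2; 1; -1; -1; -1; 1; 1; 0; 2; 2; -2; 0; 0; 0; 0; 1; -1; 1; 0; 0; 0; 0];
  [:: 3; 1; 2; 1; 0; 1; -1; 1; 1; 2; 2; 0; -1; 0; 0; 0; 1; 1; 0; 0; -1; 0; 1; 1];
  [:: -5; 2; 1; -2; -2; 0; 2; 0; 2; -1; -2; 0; 0; -1; -1; 0; -1; -2; 1; 0; 0; -1; 0; 0];
  [:: 5; 0; 0; 2; 1; 0; -2; 1; -1; 2; 2; 0; -1; 1; 1; 0; 1; 2; -1; 0; -1; 1; 1; -1];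
  [:: 1; 0; 1; 0; 0; -1; 0; 1; 1; 1; 1; 1; 0; -1; 0; 0; 0; 1; 0; 0; 0; 0; 0; 1];
  [:: -1; 1; 2; 1; -1; 0; 0; 0; 1; 1; 2; 1; 0; -1; 1; 0; 0; 0; 0; -1; -1; 1; 0; 1];
  [:: -3; 2; 4; -1; -3; -1; 2; 1; 4; 1; 2; 1; -1; -2; -1; 1; -1; 1; 2; -1; -3; 1; 1; 2];
  [:: -5; 0; -1; -4; -3; -1; 1; -1; 1; -2; -1; 0; 0; 0; -1; 0; 0; -1; 0; -1; 0; -1; -1; -1];
  [:: -1; 1; 1; 1; 1; 2; 3; 1; 1; -1; -1; -1; 0; -2; 1; 2; -2; 0; 1; 0; 0; -1; 0; 1];
  [:: -5; 1; 0; -3; -2; -1; 0; -2; 1; -1; 0; 0; 1; 0; -1; -1; 0; -1; 0; -1; 0; 0; -1; 0]]%BZ.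

Definition frame2L : seq (seq Z) := [::
  [:: -5; 2; 1; -1; -1; 1; 3; 0; 1; -1; -1; 0; 0; -1; 0; 1; -1; -1; 0; -1; 0; 0; 0; 0];
  [:: 3; 1; 1; 0; -1; 0; -1; 1; 1; 2; 3; 0; -1; 0; 0; 0; 1; 2; 0; -1; -2; 1; 1; 0];
  [:: -3; 2; 2; -1; -1; 1; 2; 0; 2; 0; 0; 0; 1; -2; 0; 1; -1; 0; 1; -1; -1; 0; 0; 2];
  [:: -5; 2; 1; -1; -2; 1; 3; 0; 1; -1; 0; -1; 0; -1; 1; 1; -1; 0; 1; -2; -1; 1; 0; 0];
  [:: 5; 0; 0; 3; 2; 1; 0; 1; -1; 2; 1; -1; 0; 0; 1; 1; 0; 2; 1; 0; -1; 1; 2; 1];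
  [:: -3; 1; 2; -2; -3; -2; 0; 0; 3; 0; 1; 1; -2; -1; -1; 0; 0; 1; 1; 0; -1; 0; 0; 1];
  [:: -5; 1; 1; -4; -4; -2; 0; -1; 3; -1; 0; 1; 0; 0; -2; -1; 0; -1; 1; -1; -1; 0; 0; 0];
  [:: -3; 1; 1; -2; -2; -1; 1; -1; 2; 0; 0; 0; 1; -1; -1; -1; -1; -1; 1; -1; -1; 1; 0; 0];
  [:: -3; 1; 1; -1; 0; 2; 3; 1; 1; -2; -1; -1; 0; -1; 0; 1; -1; -1; 0; 0; 1; -1; 0; 0];
  [:: -1; 1; 2; 0; -1; 1; 3; 2; 3; -1; -1; 0; -1; -2; 0; 2; -2; 0; 2; 0; -1; -1; 1; 1];
  [:: 5; 0; 4; 5; 0; 0; -1; 2; 1; 3; 5; 2; -2; -1; 2; 1; 0; 3; 0; 0; -2; 2; 2; 2];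
  [:: 3; 0; 2; 2; 1; 0; -1; 1; 1; 1; 1; 1; 0; 0; 0; 0; 0; 0; 0; 1; 0; 0; 0; 1];
  [:: 3; 0; 1; 1; 1; 0; -1; 1; 0; 0; 1; 1; -1; 0; 0; 0; 0; 1; -1; 1; 0; -1; 0; 0];
  [:: -3; -1; 0; 0; -1; -1; -1; -1; -1; 0; 1; 0; 0; 0; 0; 0; 1; 0; -1; -1; 1; 1; 0; -1];
  [:: 1; -2; 0; 0; 0; -2; -1; 0; 0; 1; 1; 1; 0; 0; 0; 0; 0; 1; 0; 0; 0; 0; -1; 1];
  [:: 1; 2; 3; 0; -1; 0; 0; 2; 2; 1; 2; 1; -2; -1; 0; 0; 1; 1; 0; 0; -1; 0; 1; 1];
  [:: -1; 1; 0; -1; 0; -1; 0; 0; 1; 0; 0; 0; 0; -1; 0; 0; 0; 0; 0; 0; 0; 0; 0; 0];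
  [:: -1; 1; 2; -1; -2; -1; 1; 2; 2; 0; 1; 1; -2; -1; 0; 1; 0; 2; 0; 0; -1; 1; 1; 0];
  [:: -1; 1; 3; 1; -1; -1; 0; 1; 1; 2; 2; 1; -1; -2; 0; 1; 0; 1; 1; 0; -1; 1; 1; 1];
  [:: 1; 0; 1; 0; 1; 1; 0; 1; 0; -1; 0; 0; -1; 0; 0; 1; 0; 0; -1; 1; 0; -1; 0; 0];
  [:: 3; 0; 0; 1; 0; 0; 0; 1; 0; 1; 1; 0; 0; -1; 1; 0; -1; 0; 0; 0; 0; 0; 1; 0];
  [:: -5; 1; 0; -2; -1; 0; 2; 0; 1; -1; -1; -1; 0; -1; -1; 0; -1; -1; 0; -1; 0; 0; 0; 0];
  [:: -5; 0; -1; -3; -2; -1; 2; -1; 1; -2; -1; 0; 1; -1; -1; 0; -1; -1; 1; -1; 0; 0; -1; 0];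
  [:: -5; 1; 1; -2; -4; -2; 0; -2; 1; 1; 1; 0; 0; 0; -1; -1; 1; 0; 1; -1; -2; 1; 0; 0]]%BZ.

Definition frame3L : seq (seq Z) := [::
  [:: -3; 3; 3; -1; -3; 0; 2; 1; 3; 1; 1; 0; -1; -2; 0; 1; 0; 1; 2; -1; -2; 1; 2; 1];
  [:: -3; 0; -1; -2; -2; -2; -1; -2; 0; 0; -1; 0; 0; 1; -1; -1; 1; 0; 1; 0; -1; 0; -1; 0];
  [:: 3; 1; 2; 4; 2; 2; 1; 2; -1; 2; 2; 0; -1; -1; 2; 2; 0; 2; 0; 0; -1; 1; 1; 1];
  [:: -1; 0; 0; 0; -1; -1; 1; 0; 1; 0; 0; 1; 0; -1; 0; 0; -1; 0; 1; 0; 0; 0; 0; 1];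
  [:: -3; 0; 0; -2; -1; 0; 2; 0; 1; -2; -1; 0; 0; -1; 0; 1; -1; 0; 0; 0; 0; -1; -1; 0];
  [:: 1; 0; 0; -1; 0; -1; 0; 0; 1; 1; 0; 0; 0; 0; -1; 0; 0; 1; 1; 0; -1; 0; 0; 1];
  [:: -3; 1; 0; -2; -2; -1; 0; 0; 0; 0; 1; 0; -1; 0; 0; 0; 1; 1; -1; -1; 0; 1; 0; -1];
  [:: -5; 0; -2; -3; -2; -1; 1; -2; 0; -1; -1; -1; 2; 0; -1; -1; 0; -1; 1; -2; 0; 1; -1; -1];
  [:: 5; 0; 2; 2; -1; 0; -1; 1; 1; 2; 3; 1; -1; 0; 1; 0; 0; 2; 1; 0; -2; 1; 1; 1];
  [:: 1; 0; 1; 1; -2; -2; -2; -1; 0; 3; 3; 1; 0; 0; 0; -1; 1; 1; 0; -1; -2; 2; 1; 0];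
  [:: -3; 1; 2; -1; -2; 0; 2; 1; 2; -1; 0; 0; -1; -1; -1; 1; -1; 0; 1; 0; -1; 0; 1; 0];
  [:: -5; 0; 0; -1; -2; -1; 1; -1; 0; -1; 0; 0; -1; 0; 0; 0; 0; 0; 0; -1; 0; 1; 0; -1];
  [:: -1; 1; 0; -1; -1; 1; 1; 0; 1; -1; 0; 0; 0; 1; 0; 0; 0; 0; 0; -1; -1; 0; 0; 0];
  [:: -5; 2; 4; 0; -2; 0; 2; 0; 3; 0; 1; 1; 0; -2; 0; 1; -1; 0; 1; -1; -1; 1; 0; 2];
  [:: -1; 0; 1; 0; -1; 0; 1; 1; 1; 0; 0; 0; -1; 0; 0; 0; 0; 0; 0; 0; 0; 0; 0; 0];
  [:: -3; 1; 0; -1; -1; 1; 2; 0; 1; -1; -1; -1; 0; -1; 0; 1; -1; -1; 1; -1; 0; -1; 0; 0];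
  [:: -1; 2; 2; -1; -2; -1; 1; 1; 3; 1; 2; 0; -1; -2; 0; 0; -1; 1; 1; -1; -2; 1; 1; 1];
  [:: -5; 2; 0; -4; -2; 0; 1; -1; 2; -2; -2; 0; 0; 0; -2; -1; 0; -2; 0; 0; 0; -1; -1; -1];
  [:: 3; -1; 1; 1; 0; -2; -2; 1; 1; 1; 1; 2; -1; 0; 0; 0; 0; 1; 0; 1; 0; 0; 0; 0];
  [:: 5; 0; 0; 2; 2; 1; 0; 2; 0; 0; 0; 0; -1; 0; 1; 1; 0; 1; 0; 1; 0; 0; 1; 0];
  [:: -5; 1; 2; -3; -3; -1; 2; 1; 3; -1; 0; 1; -1; -2; -1; 1; -1; 0; 1; -1; -1; 0; 0; 1];
  [:: 5; 0; 3; 2; 0; -1; -3; 2; 1; 2; 4; 2; -3; 0; 0; 0; 2; 3; -1; 1; -1; 0; 1; 1];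
  [:: -3; 0; 1; -2; -2; -2; -1; -1; 1; 0; 1; 1; 0; 0; -1; -1; 1; -1; 0; 0; 0; 0; -1; 0];
  [:: -1; 2; 1; -1; 0; 1; 2; 1; 1; -1; -1; 0; 0; -1; 0; 0; -1; -1; 0; 0; 0; -1; 0; 0]]%BZ.

Definition frame4L : seq (seq Z) := [::
  [:: -1; 2; 2; 0; 0; 2; 2; 2; 1; -1; 0; 0; -1; -1; 0; 1; 0; 0; 0; 0; 0; 0; 1; 0];
  [:: -3; 1; 1; -1; -3; -1; 1; 0; 1; 1; 1; 0; -1; -1; 0; 0; 0; 1; 1; -1; -1; 1; 1; 0];
  [:: -5; 1; 1; -1; -1; 0; 2; 0; 1; -1; 0; 0; 0; -2; 0; 1; -1; -1; 0; -1; 1; 0; 0; 0];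
  [:: -5; -1; -1; -4; -2; -2; 0; -1; 1; -2; -2; 0; 0; 0; -2; -1; 0; -2; 0; 0; 1; -1; -1; -1];
  [:: 1; -1; 0; 0; -1; -2; -3; -1; 0; 1; 2; 1; 0; 1; -1; -2; 1; 0; -1; 0; 0; 1; 0; -1];
  [:: -5; 0; 0; -2; -2; -3; -1; -2; 0; 0; 0; 1; 0; 0; -1; -1; 1; 0; 0; 0; 0; 1; -1; 0];
  [:: 3; 0; 1; 2; 1; 0; -1; 0; 0; 2; 1; 0; 0; 0; 0; 0; 0; 1; 1; 0; -1; 1; 1; 1];
  [:: -5; 2; 2; -2; -2; 0; 1; -1; 2; 0; 0; 0; 1; -1; -1; 0; 0; -1; 1; -1; -1; 0; 0; 1];
  [:: 1; 1; 2; 0; 0; 0; 0; 1; 1; 1; 2; 1; -1; -1; 0; 0; 0; 1; -1; 0; -1; 0; 0; 1];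
  [:: -1; 1; 3; 0; -2; -1; 1; 1; 3; 0; 1; 2; -1; -1; 0; 0; -1; 0; 1; 0; -1; 0; 0; 1];
  [:: 1; 2; 1; 0; -1; 0; -1; 0; 1; 1; 1; 0; -1; 0; 0; -1; 1; 0; 0; 0; -1; 0; 1; 0];
  [:: -3; 0; 0; 0; -1; 0; 0; -1; -1; 0; 0; 0; 0; 1; 0; 0; 1; 0; -1; -1; 0; 1; 0; -1];
  [:: -1; 0; 1; 1; 0; 1; 1; 0; 0; -1; 0; 0; 0; -1; 1; 1; -1; 0; 0; 0; 0; 0; 0; 0];
  [:: 1; 1; 4; 1; -1; 0; 0; 2; 2; 1; 2; 1; -2; -1; 0; 1; 0; 1; 0; 1; -1; 0; 1; 1];
  [:: -5; 1; 0; -1; -2; 0; 2; -1; 0; 0; 0; -1; 1; -1; 0; 0; -1; -1; 1; -2; -1; 1; 0; 0];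
  [:: -3; 2; 3; -2; -4; -2; 1; 1; 4; 1; 2; 1; -2; -2; -1; 1; 0; 2; 2; -1; -3; 1; 1; 1];
  [:: 5; -1; 1; 2; 0; -1; -3; 1; -1; 2; 4; 1; -2; 1; 1; 0; 2; 3; -1; 0; -1; 1; 1; 0];
  [:: -3; 1; 1; -3; -3; -1; 1; 0; 3; -1; 0; 1; 0; -1; -1; 0; -1; 0; 1; -1; -1; 0; 0; 1];
  [:: 1; 0; 0; 1; 1; 1; 1; 1; 0; -1; -1; 0; -1; 0; 0; 1; -1; 0; 0; 1; 0; -1; 1; 0];
  [:: 5; 0; 2; 4; 1; 0; -1; 2; 0; 3; 3; 1; -1; -1; 2; 1; 0; 2; 0; 0; -1; 2; 2; 1];
  [:: -5; 2; 1; -2; -1; 1; 3; 1; 2; -2; -1; -1; -1; -1; 0; 1; -1; 0; 0; -1; 0; 0; 0; 0];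
  [:: -3; 0; 1; 0; -2; 0; 1; -1; 1; 0; 1; 0; 0; 0; 0; 0; 0; 0; 1; -1; -1; 1; 0; 1];
  [:: -5; 1; -2; -4; -2; 0; 1; -2; 0; -2; -2; -1; 1; 1; -1; -1; 0; -2; 0; -1; 0; 0; -1; -2];
  [:: -1; 1; 0; -1; -1; 0; 2; 0; 1; 0; 0; -1; 1; -1; 0; 0; -1; 0; 1; -1; -1; 1; 1; 0]]%BZ.

Definition frame5L : seq (seq Z) := [::
  [:: -1; 0; 1; 0; 0; 0; 0; 1; 0; -1; 1; 1; -1; 0; 0; 0; 0; 0; -2; 0; 1; 0; 0; -1];
  [:: -3; 1; 2; 0; 0; 0; 1; 1; 1; 0; 0; 0; -1; -1; 0; 1; 0; 0; 0; 0; 0; 0; 0; 1];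
  [:: -3; 1; 2; -1; -2; -1; 1; 0; 2; 1; 1; 1; 0; -1; -1; 0; 0; 0; 1; -1; -1; 1; 0; 1];
  [:: 3; -1; 1; 2; 0; -1; -1; 1; 0; 2; 3; 1; -1; -1; 1; 1; 0; 2; 0; 0; -1; 1; 1; 1];
  [:: -5; 2; 2; -2; -3; 0; 3; 1; 2; -1; 0; 0; -1; -2; 0; 1; -1; 0; 1; -1; -1; 1; 1; 0];
  [:: 5; 0; 1; 2; 1; 0; -3; 1; -1; 2; 2; 1; -2; 1; 0; 0; 2; 2; -1; 1; -1; 0; 1; 0];
  [:: -1; -1; 0; 1; -1; -2; -2; -2; -1; 1; 1; 1; 0; 1; 0; -1; 1; 0; 0; 0; 0; 1; 0; 0];
  [:: -5; 2; 2; -2; -3; -1; 1; -1; 2; 0; 1; 0; 0; -1; -1; 0; 0; 0; 1; -1; -2; 1; 0; 0];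
  [:: 1; 0; 1; 1; 0; 0; 0; 0; 1; 1; 1; 0; 1; -1; 0; 0; -1; 0; 1; -1; -1; 1; 1; 1];
  [:: -5; 1; 1; -3; -1; 1; 2; 0; 2; -3; -2; 0; 0; -1; -1; 1; -1; -2; 0; 0; 1; -2; -1; 0];
  [:: 3; 1; 3; 4; 1; 2; 1; 2; 0; 2; 2; 0; -1; -1; 2; 2; 0; 2; 0; 0; -1; 1; 2; 1];
  [:: 5; 0; 1; 2; 1; 1; 0; 2; 0; 1; 2; 0; -1; 0; 1; 1; 0; 2; 0; 0; -1; 0; 1; 1];
  [:: 1; 1; 2; 1; 0; 0; 1; 2; 2; 0; 0; 1; -1; -2; 0; 1; -1; 0; 1; 1; 0; -1; 1; 1];
  [:: -5; 2; 2; -3; -4; -1; 2; 0; 4; -1; 0; 1; -1; -1; -1; 0; -1; 0; 1; -1; -2; 0; 0; 1];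
  [:: -3; 0; 0; -3; -2; -2; -1; -1; 1; 0; 0; 0; 0; 0; -2; -1; 1; 0; 0; 0; 0; 0; 0; 0];
  [:: -1; 2; 3; -1; -3; -2; 0; 1; 3; 2; 3; 1; -2; -2; 0; 0; 0; 2; 1; -1; -2; 1; 1; 1];
  [:: -1; -2; -1; -2; -2; -3; -2; -1; 0; 0; 0; 1; 0; 1; -1; -1; 1; 0; 0; 0; 0; 0; -1; -1];
  [:: -1; 1; 1; 0; -2; 0; 0; 0; 1; 1; 1; 0; 0; 0; 0; 0; 0; 0; 1; -1; -1; 1; 1; 0];
  [:: -5; 1; -1; -2; -2; 0; 1; -1; 0; -1; 0; -1; 0; 0; 0; 0; 1; 0; 0; -2; 0; 1; 0; -1];
  [:: 1; 1; 2; 0; -1; 0; -1; 0; 1; 1; 2; 1; 0; 0; 0; -1; 1; 0; 0; 0; -1; 0; 0; 1];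
  [:: 5; -1; 2; 3; 1; -1; -3; 1; 0; 2; 3; 2; -1; 0; 1; 0; 1; 2; -1; 1; 0; 1; 0; 1];
  [:: -1; -1; 1; 1; -1; 0; 0; 0; 0; 0; 1; 0; -1; 0; 0; 0; 0; 0; 0; 0; 0; 0; 0; 0];
  [:: 3; 0; 2; 1; 0; 0; 0; 2; 2; 0; 1; 1; -2; 0; 0; 1; 0; 2; 1; 1; -1; 0; 1; 1];
  [:: -5; 0; 0; -1; -1; 0; 2; -1; 0; -1; -1; 0; 1; -1; 0; 1; -1; 0; 1; -1; 0; 0; -1; 1]]%BZ.

Definition gramL : seq (seq Z) :=
  Eval vm_compute in mapZ (fun x => Z.div x 8) (mulTZ leech_basisL leech_basisL).
Definition half_gramL : seq (seq Z) := Eval vm_compute in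
  mkseq (fun i => mkseq (fun j => if (i < j)%N then entryZ gramL i j else
    if i == j then Z.div (entryZ gramL i j) 2 else Z0) 24) 24.
Definition alpha'L : seq (seq Z) := Eval vm_compute in
  mkseq (fun i => mkseq (fun j => Z.sub (if i == j then Zpos xH else Z0) (entryZ alphaL i j)) 24) 24.
(** The even rows are halved and the odd first row is kept: for a vector whose first coefficient is
    even it is that coefficient which gets halved. *)
Definition half_basisL : seq (seq Z) := Eval vm_compute in
  head [::] leech_basisL :: mapZ (fun x => Z.div x 2) (behead leech_basisL).

(** * The Leech lattice *)

Local Notation vec := 'rV[int]_24.

Definition basis : 'M[int]_24 := mxZ 24 24 leech_basisL.
Definition gram : 'M[int]_24 := mxZ 24 24 gramL.
Definition gram_inv : 'M[int]_24 := mxZ 24 24 gram_invL.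
Definition alpha : 'M[int]_24 := mxZ 24 24 alphaL.
Definition alpha' : 'M[int]_24 := mxZ 24 24 alpha'L.

Lemma scalar_mxZ (n : nat) (a : Z) (b : int) : b = int_of_Z a -> b%:M = mxZ n n (diagZ n a) :> 'M_n.
Proof. by move=> ->; rewrite mxZ_diag. Qed.

Lemma basis_basisT : basis *m basis^T = 8%:M *m gram.
Proof.
rewrite (scalar_mxZ 24 (a := 8%BZ)) // mxZ_mulT; last by vm_compute.
by rewrite mxZ_mul; [congr mxZ; vm_compute | vm_compute].
Qed.

Lemma gram_sym : gram^T = gram.
Proof. by rewrite mxZ_tr; congr mxZ; vm_compute. Qed.

Lemma gramK : gram *m gram_inv = 1%:M.
Proof.
rewrite (scalar_mxZ 24 (a := 1%BZ)) // mxZ_mul; last by vm_compute.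
by congr mxZ; vm_compute.
Qed.

(** It turns u G u^T into 2 u h u^T, which shows that the lattice is even. *)
Lemma half_gram : exists h : 'M[int]_24, gram = h + h^T.
Proof.
exists (mxZ 24 24 half_gramL); apply/matrixP => i j; rewrite !mxE -rmorphD; congr int_of_Z.
have /all_iotaP h : all_iota 24 (fun i j => entryZ gramL i j ==
    Z.add (entryZ half_gramL i j) (entryZ half_gramL j i)) by vm_compute.
exact/eqP/h.
Qed.

Lemma alpha_alpha' : alpha *m alpha' = 2%:M.
Proof.
rewrite (scalar_mxZ 24 (a := 2%BZ)) // mxZ_mul; last by vm_compute.
by congr mxZ; vm_compute.
Qed.

Lemma alpha'_alpha : alpha' *m alpha = 2%:M.
Proof.
rewrite (scalar_mxZ 24 (a := 2%BZ)) // mxZ_mul; last by vm_compute.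
by congr mxZ; vm_compute.
Qed.

Lemma alphaD : alpha + alpha' = 1%:M.
Proof.
apply/matrixP => i j; rewrite !mxE -rmorphD -val_eqE /=.
transitivity (int_of_Z (if i == j :> nat then Zpos xH else Z0)); last by case: eqP.
congr int_of_Z.
have /all_iotaP h : all_iota 24 (fun i j => Z.add (entryZ alphaL i j) (entryZ alpha'L i j) ==
    if i == j then Zpos xH else Z0) by vm_compute.
exact/eqP/h.
Qed.

(** This says that [alpha'] is the adjoint of [alpha]: the structure is Hermitian. *)
Lemma alpha_gram : alpha *m gram = gram *m alpha'^T.
Proof.
rewrite mxZ_mul; last by vm_compute.
rewrite mxZ_mulT; last by vm_compute.
by congr mxZ; vm_compute.
Qed.

Lemma basisT_gram_inv_basis : basis^T *m gram_inv *m basis = 8%:M.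
Proof.
rewrite (scalar_mxZ 24 (a := 8%BZ)) // mxZ_tr mxZ_mul; last by vm_compute.
rewrite mxZ_mul; last by vm_compute.
by congr mxZ; vm_compute.
Qed.

Lemma mx11_tr (X : 'M[int]_1) : X 0 0 = X^T 0 0.
Proof. by rewrite mxE. Qed.

Definition dot (u v : vec) : int := (u *m gram *m v^T) 0 0.

Lemma row_form (m n p : nat) (A : 'M[int]_(m, n)) (X : 'M[int]_(n, n)) (C : 'M[int]_(p, n)) i j :
  (row i A *m X *m (row j C)^T) 0 0 = (A *m X *m C^T) i j.
Proof. by rewrite -row_mul [LHS]mxE [RHS]mxE; apply: eq_bigr => k _; rewrite !mxE. Qed.

Lemma dotDl (u v w : vec) : dot (u + v) w = dot u w + dot v w.
Proof. by rewrite /dot !mulmxDl mxE. Qed.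

Lemma dotC (u v : vec) : dot u v = dot v u.
Proof. by rewrite /dot [LHS]mx11_tr !trmx_mul trmxK gram_sym mulmxA. Qed.

Lemma dotDr (u v w : vec) : dot u (v + w) = dot u v + dot u w.
Proof. by rewrite dotC dotDl !(dotC _ u). Qed.

Lemma dotZl (a : int) (u v : vec) : dot (a *: u) v = a * dot u v.
Proof. by rewrite /dot -!scalemxAl mxE. Qed.

Lemma dotZr (a : int) (u v : vec) : dot u (a *: v) = a * dot u v.
Proof. by rewrite dotC dotZl dotC. Qed.

Lemma dotNl (u v : vec) : dot (- u) v = - dot u v.
Proof. by rewrite -scaleN1r dotZl mulN1r. Qed.

Lemma dotNr (u v : vec) : dot u (- v) = - dot u v.
Proof. by rewrite dotC dotNl dotC. Qed.

Lemma dot0l (u : vec) : dot 0 u = 0.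
Proof. by rewrite /dot !mul0mx mxE. Qed.

Lemma dot_alpha (u v : vec) : dot (u *m alpha) v = dot u (v *m alpha').
Proof. by rewrite /dot trmx_mul !mulmxA -!(mulmxA u) alpha_gram. Qed.

Lemma dot_alpha' (u v : vec) : dot (u *m alpha') v = dot u (v *m alpha).
Proof. by rewrite dotC -dot_alpha dotC. Qed.

Lemma dot_even (u : vec) : exists n, dot u u = 2 * n.
Proof.
have [h hE] := half_gram; exists ((u *m h *m u^T) 0 0).
rewrite /dot hE mulmxDr mulmxDl mxE mulr_natl mulr2n; congr (_ + _).
by rewrite [LHS]mx11_tr !trmx_mul !trmxK mulmxA.
Qed.

Lemma sum_sqr_basis (u : vec) : \sum_i (u *m basis) 0 i ^+ 2 = 8 * dot u u.
Proof.
transitivity ((u *m basis *m (u *m basis)^T) 0 0).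
  by rewrite [RHS]mxE; apply: eq_bigr => i _; rewrite [X in _ = _ * X]mxE expr2.
by rewrite trmx_mul !mulmxA -(mulmxA u) basis_basisT !mulmxA mul_mx_scalar -!scalemxAl mxE.
Qed.

Lemma scale_mx_inj (m n : nat) (a : int) (X Y : 'M[int]_(m, n)) :
  a != 0 -> a *: X = a *: Y -> X = Y.
Proof.
move=> a0 /matrixP h; apply/matrixP => i j; apply: (mulfI a0).
by have := h i j; rewrite !mxE.
Qed.

Lemma gram_inj (u : vec) : u *m gram = 0 -> u = 0.
Proof. by move=> h; rewrite -[u]mulmx1 -gramK mulmxA h mul0mx. Qed.

Lemma sum_sqr_eq0 (n : nat) (x : 'rV[int]_n) : \sum_i x 0 i ^+ 2 = 0 -> x = 0.
Proof.
move=> /eqP; rewrite psumr_eq0 => [/allP h|i _]; last exact: sqr_ge0.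
apply/matrixP => i j; rewrite ord1 mxE; apply/eqP.
by have := h j (mem_index_enum j); rewrite sqrf_eq0.
Qed.

Lemma dot_eq0 (u : vec) : dot u u = 0 -> u = 0.
Proof.
move=> h; have /sum_sqr_eq0 x0 : \sum_i (u *m basis) 0 i ^+ 2 = 0 by rewrite sum_sqr_basis h mulr0.
apply: gram_inj; apply: (@scale_mx_inj _ _ 8) => //.
by rewrite -mul_mx_scalar -mulmxA scalar_mxC -basis_basisT mulmxA x0 mul0mx scaler0.
Qed.

Lemma dot_ge0 (u : vec) : 0 <= dot u u.
Proof.
have : 0 <= 8 * dot u u by rewrite -sum_sqr_basis sumr_ge0 // => i _; exact: sqr_ge0.
by lia.
Qed.

Lemma parity_sqr_ge1 (x : int) : parity x -> 1 <= x ^+ 2.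
Proof. by rewrite /parity => h; have : x != 0 by [lia|]; nia. Qed.

(** * The Golay code and the minimum of the Leech lattice *)

Lemma count_odd_le (n : nat) (y : 'rV[int]_n) :
  (count id (bitsv y))%:Z <= \sum_i y 0 i ^+ 2.
Proof.
rewrite /bitsv count_map -sum1_count big_mkcond big_enum /= raddf_sum.
apply: ler_sum => i _; case: ifP => [/parity_sqr_ge1 //|_]; exact: sqr_ge0.
Qed.

(** Settled by enumeration of the 4096 codewords. The bound 4 is the square sum of the halved
    coordinates of a vector of norm 2. *)
Lemma golay_weight (c : seq bool) : size c = 12%N ->
  let w := span c (bits golayL) (nseq 24 false) in (count id w == 0)%N || (4 < count id w)%N.
Proof.
move=> c12; apply: (all_spanP (p := fun w => (count id w == 0)%N || (4 < count id w)%N)).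
  by rewrite c12; vm_compute.
by vm_compute.
Qed.

Lemma half_basis_golay (u : vec) : exists c : 'rV[int]_12,
  bitsv (u *m mxZ 24 24 half_basisL) = bitsv (c *m mxZ 12 24 golayL).
Proof.
exists (u *m mxZ 24 12 golay_coordL); apply/bitsv_eqP => k.
rewrite -mulmxA; apply: parity_mx => i; rewrite mxZ_mul; last by vm_compute.
have /all_iotaP h : all_iota 24 (fun i j => entryB (bits half_basisL) i j ==
  entryB (bits (mulZ 24 golay_coordL golayL)) i j) by vm_compute.
by rewrite !parity_mxZ; apply/eqP/h.
Qed.

Lemma basis_row_parity (i j : 'I_24) : parity (basis i j) = (i == 0).
Proof.
have /all_iotaP h : all_iota 24 (fun i j => entryB (bits leech_basisL) i j == (i == 0%N)) by vm_compute.
by rewrite parity_mxZ; apply/eqP/h.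
Qed.

Lemma int_of_ZM (x y : Z) : int_of_Z (Z.mul x y) = int_of_Z x * int_of_Z y.
Proof. exact: (rmorphM int_of_Z). Qed.

Lemma basis_half (i j : 'I_24) :
  (if i == 0 then 2 else 1) * basis i j = 2 * mxZ 24 24 half_basisL i j.
Proof.
have /all_iotaP/(_ i j)/eqP : all_iota 24 (fun i j =>
    Z.mul (if i == 0%N then 2 else 1)%BZ (entryZ leech_basisL i j) ==
    Z.mul 2 (entryZ half_basisL i j)) by vm_compute.
move=> /(congr1 int_of_Z); rewrite !int_of_ZM !mxE => h; rewrite -[RHS]h.
by congr (_ * _); rewrite -val_eqE /=; case: eqP.
Qed.

(** The first row has sum 20 and the others have sums divisible by 8, so a vector with even first
    coefficient has coordinate sum divisible by 8. *)
Lemma basis_row_sum : exists q : 'cV[int]_24,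
  basis *m const_mx 1 = \col_i ((if i == 0 then 4 else 8) * q i 0).
Proof.
pose quotients := [seq [seq Z.div x (if i == 0%N then 4 else 8)%BZ |
  x <- nth [::] (mulTZ leech_basisL [:: nseq 24 1%BZ]) i] | i <- iota 0 24].
exists (mxZ 24 1 quotients).
have -> : const_mx 1 = (mxZ 1 24 [:: nseq 24 1%BZ])^T.
  by apply/matrixP => i j; rewrite !mxE ord1 /entryZ nth_nseq ltn_ord.
rewrite mxZ_mulT; last by vm_compute.
apply/matrixP => i j; rewrite !mxE ord1.
have /all_iotaP/(_ i 0) /eqP : all_iota 24 (fun i _ =>
    entryZ (mulTZ leech_basisL [:: nseq 24 1%BZ]) i 0 ==
    Z.mul (if i == 0%N then 4 else 8)%BZ (entryZ quotients i 0)) by vm_compute.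
move=> ->; rewrite int_of_ZM; congr (_ * _).
by rewrite -val_eqE /=; case: eqP.
Qed.

(* A vector of norm 2 has standard coordinates with sum of squares 16, hence even; halving them gives
   a Golay codeword of weight at most 4 modulo 2, so they are (0, ..., +-4, ..., 0), whose sum is
   not divisible by 8. *)
Theorem leech_min (u : vec) : u != 0 -> 4 <= dot u u.
Proof.
move=> u0; have [n nE] := dot_even u.
have n_gt0 : 0 < n.
  have := dot_ge0 u; rewrite nE; suff : n != 0 by lia.
  apply: contraNneq u0 => n0; apply/eqP/dot_eq0; by rewrite nE n0.
suff : n != 1 by move: nE n_gt0; clear; lia.
apply/eqP => n1; have {n nE n_gt0 n1 u0} d2 : dot u u = 2 by rewrite nE n1.
have x16 := sum_sqr_basis u; rewrite d2 in x16.
have xpar (j : 'I_24) : parity ((u *m basis) 0 j) = parity (u 0 0).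
  rewrite mxE parity_sum (bigD1 ord0) //= big1 => [|i i0].
    by rewrite parityM basis_row_parity eqxx andbT addbF.
  by rewrite parityM basis_row_parity (negPf i0) andbF.
case u0odd: (parity (u 0 0)).
  have : \sum_(i < 24) (1 : int) <= \sum_i (u *m basis) 0 i ^+ 2.
    by apply: ler_sum => i _; apply: parity_sqr_ge1; rewrite xpar.
  by rewrite x16 sumr_const card_ord; lia.
have [a aE] := parityF u0odd.
pose u' : vec := \row_i if i == 0 then a else u 0 i.
pose y := u' *m mxZ 24 24 half_basisL.
have xy : u *m basis = 2 *: y.
  apply/matrixP => i j; rewrite ord1 !mxE mulr_sumr; apply: eq_bigr => k _.
  have := basis_half k j; case: (k =P 0) => [-> e|/eqP].
    by rewrite aE; transitivity (a * (2 * basis 0 j)); [ring|rewrite e [u' 0 0]mxE eqxx; ring].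
  move=> /negbTE kn; rewrite mul1r => ->; rewrite [u' 0 k]mxE kn; ring.
have y4 : \sum_i y 0 i ^+ 2 = 4.
  apply: (@mulfI _ (4 : int)) => //; rewrite -[RHS]x16 mulr_sumr; apply: eq_bigr => i _.
  by rewrite xy [in RHS]mxE; ring.
have ycount : count id (bitsv y) = 0%N.
  have [c cE] := half_basis_golay u'; have := count_odd_le y; rewrite y4.
  rewrite /y cE bitsv_mul //; have := golay_weight (size_bitsv c).
  by case/orP => [/eqP //|]; clear; lia.
have yeven (i : 'I_1) (j : 'I_24) : parity (y i j) = false.
  apply/negbTE/negP => yj; move/eqP: ycount; rewrite eqn0Ngt -has_count => /hasP; apply.
  by exists true => //; rewrite -yj ord1 -(nth_bitsv y j) mem_nth // size_bitsv.
have [z yz] := parity_mxF yeven.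
have z1 : \sum_i z 0 i ^+ 2 = 1.
  apply: (@mulfI _ (4 : int)) => //; rewrite mulr1 -[RHS]y4 mulr_sumr; apply: eq_bigr => i _.
  by rewrite yz [in RHS]mxE; ring.
have zodd : parity (\sum_i z 0 i).
  have <- : parity (\sum_i z 0 i ^+ 2) = parity (\sum_i z 0 i).
    by rewrite !parity_sum; apply: eq_bigr => i _; rewrite expr2 parityM andbb.
  by rewrite z1.
have [q qE] := basis_row_sum.
have [r rE] : exists r, (u *m basis *m (const_mx 1 : 'cV_24)) 0 0 = 8 * r.
  rewrite -mulmxA qE; exists ((u' *m q) 0 0); rewrite !mxE mulr_sumr; apply: eq_bigr => k _.
  rewrite !mxE; case: eqP => [->|_]; [rewrite aE|]; ring.
have : 8 * r = 4 * \sum_i z 0 i.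
  rewrite -rE xy yz mxE mulr_sumr; apply: eq_bigr => i _.
  by rewrite !mxE; ring.
by move: zodd; move: (\sum_i _) => s; rewrite /parity; clear; lia.
Qed.

(** * Minimal vectors of the Leech lattice modulo alpha *)

Inductive trie := Leaf | Node of bool & trie & trie.

Fixpoint trie_mem (c : seq bool) (t : trie) : bool :=
  if t is Node b l r then
    if c is x :: c' then trie_mem c' (if x then r else l) else b
  else false.

Fixpoint trie_add (c : seq bool) (t : trie) : trie :=
  let: (b, l, r) := if t is Node b l r then (b, l, r) else (false, Leaf, Leaf) in
  if c is x :: c' then if x then Node b l (trie_add c' r) else Node b (trie_add c' l) r
  else Node true l r.

Lemma trie_mem_add (c d : seq bool) (t : trie) :
  trie_mem d (trie_add c t) -> d = c \/ trie_mem d t.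
Proof.
have leaf (e : seq bool) : trie_mem e Leaf = false by case: e.
elim: c d t => [|x c IH] d t; first by case: t => [|b l r]; case: d => [|[] d] /=; rewrite ?leaf; auto.
case: t => [|b l r]; case: d => [|y d] /=; case: x => /=; auto; case: y => /=; rewrite ?leaf; auto;
  by move=> /IH [->|]; rewrite ?leaf; auto.
Qed.

Fixpoint trie_full (n : nat) (t : trie) : bool :=
  if t is Node b l r then if n is m.+1 then trie_full m l && trie_full m r else b else false.

Lemma trie_fullP (n : nat) (t : trie) (c : seq bool) : trie_full n t -> size c = n -> trie_mem c t.
Proof.
elim: n t c => [|n IH] [|b l r] [|x c] //= /andP[hl hr] [cn].
by case: x; apply: IH.
Qed.

Local Notation word := (seq bool).

Section Orbit.
Variable act : seq (seq bool) -> word -> word.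
Variable gens : seq (seq (seq bool) * seq (seq bool)).

(** [g.1] only proposes a word [d]; the test that [g.2] maps [d] back to [c] justifies adding it,
    since goodness is pulled back along [g.2]. *)
Definition orbit_step (c : word) (s : trie * seq word) (g : seq (seq bool) * seq (seq bool)) :=
  let d := act g.1 c in
  if trie_mem d s.1 then s
  else if act g.2 d == c then (trie_add d s.1, d :: s.2) else s.

(** [t] collects the words found and [w] those still to be expanded; running out of fuel can only
    make the result smaller. *)
Fixpoint orbits (fuel : nat) (t : trie) (w : seq word) : trie :=
  if fuel is f.+1 then
    if w is c :: w' then let s := foldl (orbit_step c) (t, w') gens in orbits f s.1 s.2 else t
  else t.

Variable good : word -> Prop.
Hypothesis good_act : forall g d, g \in gens -> good (act g.2 d) -> good d.

Let all_good (s : trie * seq word) : Prop :=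
  (forall c, trie_mem c s.1 -> good c) /\ (forall c, c \in s.2 -> good c).

Lemma orbit_step_good (c : word) (s : trie * seq word) g :
  good c -> g \in gens -> all_good s -> all_good (orbit_step c s g).
Proof.
move=> cg gg [tg wg]; rewrite /orbit_step; case: ifP => // _; case: eqP => //= e.
have dg : good (act g.1 c) by apply: (@good_act g); rewrite ?e.
split=> d /=; first by move=> /trie_mem_add [-> //|]; apply: tg.
by rewrite inE => /orP[/eqP -> //|]; apply: wg.
Qed.

Lemma orbits_good (fuel : nat) (t : trie) (w : seq word) :
  all_good (t, w) -> forall c, trie_mem c (orbits fuel t w) -> good c.
Proof.
elim: fuel t w => [|f IH] t [|c w] [] //= tg wg; apply: IH.
have cg : good c by apply: wg; rewrite inE eqxx.
rewrite -surjective_pairing; have : all_good (t, w).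
  by split=> //= d dw; apply: wg; rewrite inE dw orbT.
have : {subset gens <= gens} by [].
move: (t, w); elim: {1 3}gens => [//|g l IHl] s sub sg /=; apply: IHl.
  by move=> x xl; apply: sub; rewrite inE xl orbT.
by apply: orbit_step_good => //; apply: sub; rewrite inE eqxx.
Qed.

End Orbit.

(** * Classes modulo alpha and their frames *)

Definition cls (u : vec) : word := bitsv (u *m mxZ 24 12 classL).

Lemma dot_alpha_alpha (u : vec) : dot (u *m alpha) (u *m alpha) = 2 * dot u u.
Proof. by rewrite dot_alpha -mulmxA alpha_alpha' mul_mx_scalar dotZr. Qed.

(** If [u *m classL] is even, so is u alpha', because classL unclassL = alpha' modulo 2. From u
    alpha' = 2 z follows 2 u = 2 z alpha. *)
Lemma class_kernel (u : vec) : (forall k, parity ((u *m mxZ 24 12 classL) 0 k) = false) ->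
  exists z, u = z *m alpha.
Proof.
move=> h; have [i j|y yE] := @parity_mxF _ _ (u *m mxZ 24 12 classL); first by rewrite ord1.
have [i j|z zE] := @parity_mxF _ _ (u *m alpha').
  have <- : parity ((u *m (mxZ 24 12 classL *m mxZ 12 24 unclassL)) i j) = parity ((u *m alpha') i j).
    apply: parity_mx => k; rewrite mxZ_mul; last by vm_compute.
    have /all_iotaP/(_ k j)/eqP e : all_iota 24 (fun i j => entryB (bits (mulZ 24 classL unclassL)) i j ==
      entryB (bits alpha'L) i j) by vm_compute.
    by rewrite !parity_mxZ.
  by rewrite mulmxA yE -scalemxAl mxE parityM.
exists z; apply: (@scale_mx_inj _ _ 2) => //.
by rewrite -mul_mx_scalar -alpha'_alpha mulmxA zE -scalemxAl.
Qed.

Lemma parityN (x : int) : parity (- x) = parity x.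
Proof. by rewrite /parity; lia. Qed.

Lemma cls_eq (u v : vec) : cls u = cls v -> exists z, u - v = z *m alpha.
Proof.
move=> /bitsv_eqP h; apply: class_kernel => k.
rewrite mulmxBl; move: (h k); move: (u *m _) (v *m _) => a b e.
by rewrite !mxE parityD parityN e addbb.
Qed.

Lemma cls_congr (u v z : vec) : u - v = z *m alpha -> cls u = cls v.
Proof.
move=> h; apply/bitsv_eqP => k; rewrite -[u](subrK v) h mulmxDl mxE parityD -mulmxA.
have -> : parity ((z *m (alpha *m mxZ 24 12 classL)) 0 k) = parity ((z *m 0) 0 k); last by rewrite mulmx0 mxE.
apply: parity_mx => i; rewrite mxZ_mul; last by vm_compute.
have /all_iotaP/(_ i (widen_ord (isT : (12 <= 24)%N) k))/eqP e :
  all_iota 24 (fun i j => entryB (bits (mulZ 12 alphaL classL)) i j == false) by vm_compute.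
by rewrite parity_mxZ e mxE.
Qed.

(** A class failing this would give Nebe's lattice a vector of norm 6. *)
Definition good_class (c : word) : Prop := forall u1 u2 u3 : vec,
  dot u1 u1 = 4 -> dot u2 u2 = 4 -> dot u3 u3 = 4 -> cls u1 = c -> cls u2 = c -> cls u3 = c ->
  ~ exists z, u1 + u2 + u3 = z *m alpha'.

(** To be applied to the images of a frame under [alpha], modulo 2. A sum in alpha' L is mapped by
    [alpha] into 2 L, so the three words would add up to 0; signs vanish modulo 2. *)
Definition no_triple (W : seq word) : bool :=
  all (fun a => all (fun b => all (fun c => xors a b != c) W) W) W.

(** The product in the opposite order, [mulZ 24 (mulTZ gramL F) F], shows that only 0 is orthogonal
    to the whole frame. *)
Definition frame_check (F : seq (seq Z)) (c : word) : bool :=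
  [&& widthZ 24 F && widthZ 24 (mulTZ gramL F),
      mulZ 24 F (mulTZ gramL F) == diagZ 24 4, mulZ 24 (mulTZ gramL F) F == diagZ 24 4,
      bits (mulZ 12 F classL) == nseq 24 c & no_triple (bits (mulZ 24 F alphaL))].

Lemma frame_check_gram (F : seq (seq Z)) (c : word) : frame_check F c ->
  mxZ 24 24 F *m gram *m (mxZ 24 24 F)^T = 4%:M.
Proof.
by move=> /and5P[/andP[F24 GF24] /eqP FGF _ _ _]; rewrite -mulmxA mxZ_mulT // mxZ_mul // FGF mxZ_diag.
Qed.

(* Two minimal vectors in the same class are equal, opposite or orthogonal, because the image of
   alpha has no vectors of norm less than 8; so a frame contained in a class exhausts it. *)
Lemma frame_good (F : seq (seq Z)) (c : word) : size c = 12%N -> frame_check F c -> good_class c.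
Proof.
move=> c12 Fch; have FGF := frame_check_gram Fch.
move: Fch => /and5P[/andP[F24 GF24] _ /eqP GFF /eqP Fc noF].
pose f (i : 'I_24) : vec := row i (mxZ 24 24 F).
have fdot i : dot (f i) (f i) = 4.
  by rewrite /dot /f row_form FGF mxE eqxx.
have fcls i : cls (f i) = c.
  apply: (@eq_from_nth _ false); rewrite size_bitsv ?c12 // => k k12.
  rewrite -[k]/(val (Ordinal k12)) nth_bitsv /f -row_mul mxE mxZ_mul // parity_mxZ Fc.
  by rewrite /entryB nth_nseq ltn_ord.
have forth (u : vec) : (forall i, dot u (f i) = 0) -> u = 0.
  move=> h; apply: (@scale_mx_inj _ _ 4) => //; rewrite scaler0 -mul_mx_scalar.
  have -> : 4%:M = gram *m (mxZ 24 24 F)^T *m mxZ 24 24 F.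
    by rewrite mxZ_mulT // mxZ_mul // GFF mxZ_diag.
  rewrite !mulmxA (_ : u *m gram *m _ = 0) ?mul0mx //.
  apply/rowP => i; rewrite [RHS]mxE -(h i) /dot /f tr_row.
  by rewrite [LHS]mxE [RHS]mxE; apply: eq_bigr => k _; rewrite !mxE.
have mem u : dot u u = 4 -> cls u = c -> exists i, u = f i \/ u = - f i.
  move=> u4 uc.
  have [/existsP[i /orP[] /eqP ->]|] := boolP [exists i, (u == f i) || (u == - f i)]; try by exists i; tauto.
  rewrite negb_exists => /forallP nf; suff u0 : u = 0 by move: u4; rewrite u0 dot0l.
  apply: forth => i; have := nf i; rewrite negb_or => /andP[n1 n2].
  have [z zE] := cls_eq (etrans uc (esym (fcls i))).
  have [z' zE'] : exists z', u + f i = z' *m alpha.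
    rewrite -[f i]opprK; apply: cls_eq; rewrite uc -(fcls i).
    by apply/bitsv_eqP => k; rewrite mulNmx [in RHS]mxE parityN.
  have z4 : 4 <= dot z z by apply: leech_min; apply: contraNneq n1 => z0; rewrite -subr_eq0 zE z0 mul0mx.
  have z4' : 4 <= dot z' z' by apply: leech_min; apply: contraNneq n2 => z0; rewrite -addr_eq0 zE' z0 mul0mx.
  have := dot_alpha_alpha z; have := dot_alpha_alpha z'; rewrite -zE -zE'.
  rewrite !(dotDl, dotDr, dotNl, dotNr) (dotC (f i) u) u4 fdot.
  by move: z4 z4'; clear; lia.
move=> u1 u2 u3 h1 h2 h3 c1 c2 c3 [z zE].
have [i1 e1] := mem u1 h1 c1; have [i2 e2] := mem u2 h2 c2; have [i3 e3] := mem u3 h3 c3.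
pose W i j := entryB (bits (mulZ 24 F alphaL)) i j.
have fW i (j : 'I_24) : parity ((f i *m alpha) 0 j) = W i j.
  by rewrite /f -row_mul mxE mxZ_mul // parity_mxZ.
have uW u i (j : 'I_24) : u = f i \/ u = - f i -> parity ((u *m alpha) 0 j) = W i j.
  by case=> ->; rewrite -fW // mulNmx mxE parityN.
have xW (j : 'I_24) : W i1 j (+) W i2 j = W i3 j.
  rewrite -(uW u1 i1) // -(uW u2 i2) // -(uW u3 i3) //.
  have : parity (((u1 + u2 + u3) *m alpha) 0 j) = false.
    by rewrite zE -mulmxA alpha'_alpha mul_mx_scalar mxE parityM.
  rewrite !mulmxDl; move: (u1 *m _) (u2 *m _) (u3 *m _) => a b d.
  by rewrite !mxE !parityD; do 3!case: parity.
set Wl := bits (mulZ 24 F alphaL) in noF.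
have sF : size F = 24 by have := congr1 size Fc; rewrite size_nseq !size_map.
have inW (i : 'I_24) : nth [::] Wl i \in Wl by rewrite mem_nth // !size_map sF.
have sW (i : 'I_24) : size (nth [::] Wl i) = 24.
  rewrite /Wl /bits (nth_map [::]) ?size_map ?sF //.
  by rewrite /mulZ /mulTZ (nth_map [::]) ?sF // !size_map size_iota.
have /allP/(_ _ (inW i1))/allP/(_ _ (inW i2))/allP/(_ _ (inW i3))/eqP := noF; apply.
apply: (@eq_from_nth _ false); rewrite (size_xors (n := 24)) ?sW // => j j24.
by rewrite (nth_xors (n := 24)) ?sW // -[j]/(val (Ordinal j24)) [LHS]xW.
Qed.

Definition zero_word : word := nseq 12 false.

Definition generators : seq (seq (seq bool) * seq (seq bool)) :=
  [:: (bits gen1_class_invL, bits gen1_classL); (bits gen2_class_invL, bits gen2_classL)].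

Definition apply_bits (M : seq (seq bool)) (c : word) : word := span c M zero_word.

Definition frames : seq (seq (seq Z)) := [:: frame0L; frame1L; frame2L; frame3L; frame4L; frame5L].

Definition frame_class (F : seq (seq Z)) : word := nth [::] (bits (mulZ 12 F classL)) 0.

Lemma frames_check : all (fun F => (size (frame_class F) == 12%N) && frame_check F (frame_class F)) frames.
Proof. by vm_compute. Qed.

Definition generator_check (g gc : seq (seq Z)) : bool :=
  widthZ 24 g && widthZ 24 (mulTZ gramL g) && (mulZ 24 g (mulTZ gramL g) == gramL) &&
  (mulZ 24 g alphaL == mulZ 24 alphaL g) && (mulZ 24 g alpha'L == mulZ 24 alpha'L g) &&
  (bits (mulZ 12 g classL) == bits (mulZ 12 classL gc)) &&
  all (fun r => size r == 12%N) gc && (size gc == 12%N).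

(** An isometry commuting with [alpha] and [alpha'] carries a forbidden triple in class [c] to one
    in the image class. *)
Lemma generator_isometry (g gc : seq (seq Z)) (c : word) : generator_check g gc ->
  good_class (apply_bits (bits gc) c) -> good_class c.
Proof.
do 7!case/andP; move=> g24 Gg24 /eqP gG /eqP gA /eqP gA' /eqP gC gcw /eqP gcs good u1 u2 u3.
pose g' : 'M[int]_24 := mxZ 24 24 g.
have gdot u : dot (u *m g') (u *m g') = dot u u.
  have gg : g' *m gram *m g'^T = gram by rewrite -mulmxA mxZ_mulT // mxZ_mul // gG.
  by rewrite /dot trmx_mul -[in RHS]gg !mulmxA.
have gcls u : cls u = c -> cls (u *m g') = apply_bits (bits gc) c.
  move=> <-; rewrite /cls /apply_bits -bitsv_mul //; apply/bitsv_eqP => k.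
  rewrite -!mulmxA; apply: parity_mx => i.
  by rewrite !mxZ_mul // !parity_mxZ gC.
move=> d1 d2 d3 /gcls c1 /gcls c2 /gcls c3 [z zE].
apply: (good (u1 *m g') (u2 *m g') (u3 *m g')); rewrite ?gdot //.
exists (z *m g'); rewrite -!mulmxDl zE -!mulmxA; congr (_ *m _).
by rewrite !mxZ_mul // gA'.
Qed.

Lemma gen1_check : generator_check gen1L gen1_classL. Proof. by vm_compute. Qed.

Lemma gen2_check : generator_check gen2L gen2_classL. Proof. by vm_compute. Qed.

Definition initial_classes : seq word := [seq frame_class F | F <- frames].

Definition initial_trie : trie := foldr trie_add Leaf (zero_word :: initial_classes).

(* 4200 exceeds the number 4095 of nonzero classes. *)
Lemma orbits_full : trie_full 12 (orbits apply_bits generators 4200 initial_trie initial_classes).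
Proof. by vm_compute. Qed.

Lemma mem_foldr_trie_add (d : word) (l : seq word) :
  trie_mem d (foldr trie_add Leaf l) -> d \in l.
Proof.
elim: l => [|x l IH]; first by case: (d).
by move=> /trie_mem_add [->|/IH h]; rewrite inE ?eqxx // h orbT.
Qed.

(** The zero class is alpha L, which has no vectors of norm 4. *)
Lemma zero_word_good : good_class zero_word.
Proof.
move=> u1 u2 u3 h1 _ _ c1 _ _ _.
have [z zE] : exists z, u1 = z *m alpha.
  apply: class_kernel => k; have := congr1 (nth false ^~ k) c1.
  by rewrite nth_bitsv nth_nseq ltn_ord.
have := dot_alpha_alpha z; rewrite -zE h1 => z2.
have : 4 <= dot z z by apply: leech_min; apply: contra_eq_neq h1 => z0; rewrite zE z0 mul0mx dot0l.
by move: z2; clear; lia.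
Qed.

Lemma initial_classes_good (d : word) : d \in initial_classes -> good_class d.
Proof.
move=> /mapP[F Fin ->]; have /allP/(_ F Fin)/andP[/eqP F12 Fch] := frames_check.
exact: frame_good Fch.
Qed.

Lemma initial_trie_good (d : word) : trie_mem d initial_trie -> good_class d.
Proof.
move=> /mem_foldr_trie_add; rewrite inE => /orP[/eqP ->|]; first exact: zero_word_good.
exact: initial_classes_good.
Qed.

Lemma good_class_all (c : word) : size c = 12%N -> good_class c.
Proof.
move=> c12; move: (trie_fullP orbits_full c12); apply: orbits_good; last first.
  by split; [exact: initial_trie_good | exact: initial_classes_good].
move=> g d; rewrite !inE => /orP[] /eqP -> h.
  exact: (generator_isometry gen1_check h).
exact: (generator_isometry gen2_check h).
Qed.

Theorem no_bad_triple (u1 u2 u3 : vec) :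
  dot u1 u1 = 4 -> dot u2 u2 = 4 -> dot u3 u3 = 4 ->
  (exists z, u2 - u1 = z *m alpha) -> (exists z, u3 - u1 = z *m alpha) ->
  ~ exists z, u1 + u2 + u3 = z *m alpha'.
Proof.
move=> h1 h2 h3 [z2 e2] [z3 e3].
by apply: (@good_class_all (cls u1)); rewrite ?size_bitsv // (cls_congr e2, cls_congr e3).
Qed.

(** * Orthogonal frames of the Leech lattice *)

Definition leech_frame (m : int) : Prop := exists F : 'M[int]_24, F *m gram *m F^T = m%:M.

(** [X] consists of standard coordinates. By unimodularity its rows lie in the lattice when their
    products with the basis are divisible by 8, and [K *m gram_inv] then gives their
    coefficients. *)
Lemma leech_frame_coords (m : int) (X K : 'M[int]_24) :
  X *m X^T = (8 * m)%:M -> X *m basis^T = 8 *: K -> leech_frame m.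
Proof.
move=> XX XB; exists (K *m gram_inv).
have FB : K *m gram_inv *m basis = X.
  apply: (@scale_mx_inj _ _ 8) => //.
  by rewrite !scalemxAl -XB -!mulmxA (mulmxA basis^T) basisT_gram_inv_basis mul_mx_scalar.
apply: (@scale_mx_inj _ _ 8) => //; rewrite scalemxAl scalemxAr -mul_scalar_mx -basis_basisT.
by rewrite -[in LHS]mulmxA -[in LHS](mulmxA basis) -trmx_mul mulmxA FB XX scale_scalar_mx.
Qed.

Lemma sum_mxtens (m n : nat) (f : 'I_(m * n) -> int) :
  \sum_k f k = \sum_i \sum_j f (mxtens_index (i, j)).
Proof.
rewrite pair_bigA /= (reindex (@mxtens_index m n)); last first.
  by exists (@mxtens_unindex m n) => k _; rewrite ?mxtens_indexK ?mxtens_unindexK.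
by apply: eq_bigr => -[i j].
Qed.

(** The columns are the indicators of the two dodecads. *)
Definition half_indicatorL : seq (seq Z) :=
  mkseq (fun k => if (k < 12)%N then [:: 1; 0]%BZ else [:: 0; 1]%BZ) 24.

Lemma half_indicatorE (h h' : 'I_2) (j : 'I_12) :
  mxZ 24 2 half_indicatorL (mxtens_index (h', j)) h = (h' == h)%:R.
Proof.
rewrite mxE -[RHS](_ : int_of_Z (if h' == h then 1 else 0)%BZ = _); last by case: eqP.
congr int_of_Z; have /all_iotaP e : all_iota 24 (fun i j => entryZ half_indicatorL i j ==
  if (i %/ 12 == j)%N then 1%BZ else 0%BZ) by vm_compute.
have /eqP -> := e (mxtens_index (h', j)) (widen_ord (isT : (2 <= 24)%N) h).
by rewrite /= divnMDl // divn_small ?ltn_ord // addn0.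
Qed.

Lemma basis_half_sum (r : 'I_24) (h : 'I_2) : exists q, \sum_(j < 12) basis r (mxtens_index (h, j)) = 4 * q.
Proof.
have -> : \sum_(j < 12) basis r (mxtens_index (h, j)) = (basis *m mxZ 24 2 half_indicatorL) r h.
  rewrite [RHS]mxE (@sum_mxtens 2 12) (bigD1 h) //= [X in _ + X]big1 ?addr0 => [|h' h'h].
    by apply: eq_bigr => j _; rewrite half_indicatorE eqxx mulr1.
  by apply: big1 => j _; rewrite half_indicatorE (negPf h'h) mulr0.
rewrite mxZ_mul; last by vm_compute.
have /all_iotaP/(_ r (widen_ord (isT : (2 <= 24)%N) h))/eqP e : all_iota 24 (fun i j =>
  Z.modulo (entryZ (mulZ 2 leech_basisL half_indicatorL) i j) 4 == 0%BZ) by vm_compute.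
rewrite mxE; set x := entryZ _ r h in e *.
have {}e : Z.modulo x 4 = 0%BZ := e.
exists (int_of_Z (Z.div x 4)); have := Z.div_mod x 4; rewrite e.
by move: (Z.div x 4) => y; clear; lia.
Qed.

(** Writing z = 1 + 2y and b = beta + 2c gives z b = b + beta (z - 1) + 4 y c, and each of the three
    sums is divisible by 4. *)
Lemma sum_odd_mul (n : nat) (z b : 'I_n -> int) (beta : bool) :
  (4 %| n)%N -> (forall j, odd_int (z j)) -> (forall j, parity (b j) = beta) ->
  (exists q, \sum_j z j = 4 * q) -> (exists q, \sum_j b j = 4 * q) ->
  exists q, \sum_j z j * b j = 4 * q.
Proof.
move=> /dvdnP[m nE] zo bp [q qE] [r rE].
pose y j := (z j %/ 2)%Z; pose c j := (b j %/ 2)%Z.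
have zE j : z j = 1 + 2 * y j by have [x] := zo j; rewrite /y; lia.
have bE j : b j = beta%:R + 2 * c j by have := bp j; rewrite /c /parity; case: (beta); lia.
exists (r + beta%:R * (q - m%:R) + \sum_j y j * c j).
rewrite [LHS](_ : _ = \sum_j b j + beta%:R * (\sum_j z j - \sum_(j < n) 1) + 4 * \sum_j y j * c j).
  by rewrite qE rE sumr_const card_ord (_ : n%:R = 4 * m%:R); [ring|rewrite nE natrM mulrC].
rewrite -sumrB !mulr_sumr -!big_split /=; apply: eq_bigr => j _.
by rewrite zE bE; ring.
Qed.

(* The rows of Y / 2 lie in D12+, and sqrt 2 D12+ is the part of the Leech lattice supported on a
   dodecad. *)
Lemma leech_frame_blocks (m : int) (Y : 'M[int]_12) :
  Y *m Y^T = (4 * m)%:M -> (forall i j, odd_int (Y i j)) ->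
  (forall i, exists q, \sum_j Y i j = 4 * q) -> leech_frame (2 * m).
Proof.
move=> ZZ Zo Zs; pose X : 'M[int]_24 := 2 *: ((1%:M : 'M_2) *t Y).
have XB (i r : 'I_24) : exists q, (X *m basis^T) i r = 8 * q.
  case: (mxtens_indexP (i : 'I_(2 * 12))) => h i'.
  have [|||||q qE] := @sum_odd_mul 12 (Y i') (fun j => basis r (mxtens_index (h, j))) (r == 0).
  - by [].
  - by move=> j; apply: Zo.
  - by move=> j; rewrite basis_row_parity.
  - exact: Zs.
  - exact: basis_half_sum.
  exists q; rewrite mxE (@sum_mxtens 2 12) (bigD1 h) //= [X in _ + X]big1 ?addr0 => [|h' h'h].
    rewrite (_ : 8 = 2 * 4) // -mulrA -qE mulr_sumr; apply: eq_bigr => j _.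
    by rewrite !mxE !mxtens_indexK eqxx mul1r mulrA.
  by apply: big1 => j _; rewrite !mxE !mxtens_indexK /= eq_sym (negPf h'h) mul0r mulr0 mul0r.
apply: (@leech_frame_coords _ X (\matrix_(i, j) ((X *m basis^T) i j %/ 8)%Z)); last first.
  by apply/matrixP => i j; rewrite [RHS]mxE [X in _ = _ * X]mxE; have [q ->] := XB i j; rewrite mulKz.
have T1 : ((1%:M : 'M[int]_2) *t Y)^T = 1%:M *t Y^T by rewrite trmx_tens trmx1.
have T2 : ((1%:M : 'M[int]_2) *t Y) *m (1%:M *t Y^T) = 1%:M *t (4 * m)%:M.
  by rewrite tensmx_mul mulmx1 ZZ.
rewrite /X [(_ *: _)^T]linearZ /= -scalemxAl -scalemxAr scalerA T1 T2.
apply/matrixP => i j.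
case: (mxtens_indexP (i : 'I_(2 * 12))) => h i'; case: (mxtens_indexP (j : 'I_(2 * 12))) => k j'.
rewrite !mxE !mxtens_indexK /=.
have -> : (mxtens_index (h, i') == mxtens_index (k, j') :> 'I_24) = (h == k) && (i' == j').
  exact: (can_eq (@mxtens_indexK 2 12)).
by case: eqP => _; case: eqP => _; rewrite ?mulr0n ?mulr1n ?mul0r ?mulr0 //; ring.
Qed.

(** The rows are q, iq, jq, kq for the quaternion q = a + bi + cj + dk: this is right multiplication
    by q. *)
Definition qmx (a b c d : int) : 'M[int]_4 := \matrix_(i, j)
  nth 0 (nth [::] [:: [:: a; b; c; d]; [:: - b; a; - d; c]; [:: - c; d; a; - b]; [:: - d; - c; b; a]] i) j.

(** The cross terms of the Williamson array have this form; equal arguments give the norm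
    identity. *)
Lemma qmx_polar (a b c d a' b' c' d' : int) :
  qmx a b c d *m (qmx a' b' c' d')^T + qmx a' b' c' d' *m (qmx a b c d)^T =
  (2 * (a * a' + b * b' + c * c' + d * d'))%:M.
Proof.
apply/matrixP => -[[|[|[|[|//]]]] hi] [[|[|[|[|//]]]] hj];
rewrite !(mxE, big_ord_recl, big_ord0) /= -?val_eqE /= ?mulr0n ?mulr1n; ring.
Qed.

Lemma qmx_mulT (a b c d : int) : qmx a b c d *m (qmx a b c d)^T = (sumsq4 a b c d)%:M.
Proof.
apply: (@scale_mx_inj _ _ 2) => //; rewrite scaler_nat mulr2n qmx_polar scale_scalar_mx.
by congr (_ %:M); rewrite /sumsq4; ring.
Qed.

Lemma leech_frameM (m : int) (n : nat) : leech_frame m -> leech_frame (n%:Z * m).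
Proof.
move=> [F FF]; have [a [b [c [d sE]]]] := lagrange_four_squares n.
pose Q : 'M[int]_24 := qmx a b c d *t (1%:M : 'M_6).
have QT : (qmx a b c d *t (1%:M : 'M[int]_6))^T = (qmx a b c d)^T *t 1%:M by rewrite trmx_tens trmx1.
have QQ : (qmx a b c d *t (1%:M : 'M[int]_6)) *m ((qmx a b c d)^T *t 1%:M) = n%:Z%:M *t 1%:M.
  by rewrite tensmx_mul mulmx1 qmx_mulT sE.
have Q24 : Q *m Q^T = n%:Z%:M.
  rewrite /Q QT QQ; apply/matrixP => i j.
  case: (mxtens_indexP (i : 'I_(4 * 6))) => h i'; case: (mxtens_indexP (j : 'I_(4 * 6))) => k j'.
  rewrite !mxE !mxtens_indexK /=.
  have -> : (mxtens_index (h, i') == mxtens_index (k, j') :> 'I_24) = (h == k) && (i' == j').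
    exact: (can_eq (@mxtens_indexK 4 6)).
  by case: eqP => _; case: eqP => _; rewrite ?mulr0n ?mulr1n ?mul0r ?mulr0 ?mulr1.
exists (Q *m F); rewrite trmx_mul !mulmxA -(mulmxA Q) -(mulmxA Q) FF mul_mx_scalar -scalemxAl Q24.
by rewrite scale_scalar_mx mulrC.
Qed.

Lemma leech_frame_4 : leech_frame 4.
Proof.
have frame0 : frame0L \in frames by rewrite inE eqxx.
have /allP/(_ _ frame0)/andP[_ /frame_check_gram h] := frames_check.
by exists (mxZ 24 24 frame0L).
Qed.

(* Williamson's array with the 3 x 3 circulants u_i I + b_i J, where u_i = 2 s_i:
   its product with its transpose is |u|^2 I + (2 u.b + 3 |b|^2) J, and |u + 3 b| = |u|. *)
Lemma leech_frame_williamson (m : int) : williamson_data m -> leech_frame (2 * m).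
Proof.
move=> [s0 [s1 [s2 [s3 [b0 [b1 [b2 [b3 [[o0 o1 o2 o3] sE tE [r rE]]]]]]]]]].
pose U := qmx (2 * s0) (2 * s1) (2 * s2) (2 * s3); pose V := qmx b0 b1 b2 b3.
pose W : 'M[int]_12 := \matrix_(i, j)
  let: ((a, i'), (c, j')) := (mxtens_unindex (i : 'I_(4 * 3)), mxtens_unindex (j : 'I_(4 * 3))) in
  U a c * (i' == j')%:R + V a c.
have WE (a c : 'I_4) (i' j' : 'I_3) :
    W (mxtens_index (a, i')) (mxtens_index (c, j')) = U a c * (i' == j')%:R + V a c.
  by rewrite mxE !mxtens_indexK.
apply: (@leech_frame_blocks m W).
- have UU a c : (U *m U^T) a c = 4 * m * (a == c)%:R.
    rewrite qmx_mulT mxE mulr_natr (_ : sumsq4 _ _ _ _ = 4 * m) // -sE /sumsq4; ring.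
  have UV a c : (U *m V^T) a c + (V *m U^T) a c + 3 * (V *m V^T) a c = 0.
    transitivity ((U *m V^T + V *m U^T) a c + 3 * (V *m V^T) a c).
      by congr (_ + _); rewrite [RHS]mxE.
    rewrite qmx_polar qmx_mulT !mxE; case: eqP => _; rewrite ?mulr0n ?mulr1n ?mulr0 ?addr0 //.
    apply: (@mulfI _ (3 : int)) => //; rewrite mulr0.
    transitivity (4 * m - 4 * m); last by rewrite subrr.
    by rewrite -{1}tE -sE /sumsq4; ring.
  apply/matrixP => i j.
  case: (mxtens_indexP (i : 'I_(4 * 3))) => a i'; case: (mxtens_indexP (j : 'I_(4 * 3))) => c j'.
  have idx : (mxtens_index (a, i') == mxtens_index (c, j') :> 'I_12) = (a == c) && (i' == j').
    exact: (can_eq (@mxtens_indexK 4 3)).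
  rewrite [RHS]mxE idx mxE (@sum_mxtens 4 3).
  transitivity ((U *m U^T) a c * (i' == j')%:R +
    ((U *m V^T) a c + (V *m U^T) a c + 3 * (V *m V^T) a c)); last first.
    by rewrite UU UV addr0; case: eqP => _; case: eqP => _; rewrite ?mulr0n ?mulr1n /=; ring.
  rewrite ![(_ *m _^T) a c]mxE mulr_sumr mulr_suml -!big_split /=; apply: eq_bigr => e _.
  transitivity (\sum_(k < 3) (U a e * (i' == k)%:R + V a e) * (U c e * (j' == k)%:R + V c e)).
    by apply: eq_bigr => k _; rewrite WE [_^T _ _]mxE WE.
  rewrite !mxE; move: (U a e) (V a e) (U c e) (V c e) => x y x' y'.
  by case: i' j' {idx} => -[|[|[|//]]] hi [[|[|[|//]]] hj]; rewrite !(big_ord_recl, big_ord0) -!val_eqE /=; ring.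
- move=> i j; case: (mxtens_indexP (i : 'I_(4 * 3))) => a i'; case: (mxtens_indexP (j : 'I_(4 * 3))) => c j'.
  have ev : exists q, U a c = 2 * q.
    case: a c => -[|[|[|[|//]]]] ha [[|[|[|[|//]]]] hc]; rewrite mxE /=;
    first [by eexists | by eexists; rewrite -mulrN].
  have [q qE] : odd_int (V a c).
    have oN x : odd_int x -> odd_int (- x) by move=> [y ->]; exists (- y - 1); ring.
    by case: a c {ev} => -[|[|[|[|//]]]] ha [[|[|[|[|//]]]] hc]; rewrite mxE /=; auto.
  by rewrite WE; have [q' ->] := ev; rewrite qE; exists (q' * (i' == j')%:R + q); ring.
move=> i; case: (mxtens_indexP (i : 'I_(4 * 3))) => a i'.
have -> : \sum_j W (mxtens_index (a, i')) j = \sum_c (U a c + 3 * V a c).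
  rewrite (@sum_mxtens 4 3); apply: eq_bigr => c _.
  transitivity (\sum_(k < 3) (U a c * (i' == k)%:R + V a c)); first by apply: eq_bigr => k _; rewrite WE.
  by case: i' => -[|[|[|//]]] hi; rewrite !(big_ord_recl, big_ord0) -!val_eqE /=; ring.
move: o0 o1 o2 o3 rE => [p0 p0E] [p1 p1E] [p2 p2E] [p3 p3E]; rewrite p0E p1E p2E p3E => rE.
rewrite !(big_ord_recl, big_ord0) /U /V p0E p1E p2E p3E; case: a => -[|[|[|[|//]]]] ha; rewrite !mxE /=.
- by exists r; rewrite -rE; ring.
- by exists (r - s1 - 3 * p1 - 3 - s3 - 3 * p3); move: rE; clear; lia.
- by exists (r - s2 - 3 * p2 - 3 - s1 - 3 * p1); move: rE; clear; lia.
by exists (r - s3 - 3 * p3 - 3 - s2 - 3 * p2); move: rE; clear; lia.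
Qed.

Theorem leech_frames (k : nat) : (2 <= k)%N -> leech_frame (2 * k%:Z).
Proof.
move=> k2; have pp := pdiv_prime k2; have [n kE] := dvdnP (pdiv_dvd k).
rewrite kE PoszM mulrCA; apply: leech_frameM.
(* For the prime 2 a frame of minimal vectors serves. *)
have [->|podd] := even_prime pp; first exact: leech_frame_4.
exact/leech_frame_williamson/williamson_prime.
Qed.

(** * The Nebe lattice *)

(* w_i = a_i alpha + x alpha' with x common to all i encodes congruence modulo alpha, because
   x = x alpha + x alpha'.  The norm of Nebe's lattice is half of dot3. *)
Definition nebe3 (w0 w1 w2 : vec) : Prop := exists a0 a1 a2 x t : vec,
  [/\ w0 = a0 *m alpha + x *m alpha', w1 = a1 *m alpha + x *m alpha',
      w2 = a2 *m alpha + x *m alpha' & a0 + a1 + a2 = t *m alpha'].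

Definition dot3 (u0 u1 u2 v0 v1 v2 : vec) : int := dot u0 v0 + dot u1 v1 + dot u2 v2.

Lemma alphaC : alpha *m alpha' = alpha' *m alpha.
Proof. by rewrite alpha_alpha' alpha'_alpha. Qed.

Lemma nebe3D (u0 u1 u2 v0 v1 v2 : vec) :
  nebe3 u0 u1 u2 -> nebe3 v0 v1 v2 -> nebe3 (u0 + v0) (u1 + v1) (u2 + v2).
Proof.
move=> [a0 [a1 [a2 [x [t [-> -> -> e]]]]]] [b0 [b1 [b2 [y [s [-> -> -> f]]]]]].
exists (a0 + b0), (a1 + b1), (a2 + b2), (x + y), (t + s).
split; rewrite ?mulmxDl; try by rewrite addrACA.
by rewrite -e -f [RHS]addrACA [in RHS](addrACA a0).
Qed.

Lemma nebe3Z (c : int) (u0 u1 u2 : vec) : nebe3 u0 u1 u2 -> nebe3 (c *: u0) (c *: u1) (c *: u2).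
Proof.
move=> [a0 [a1 [a2 [x [t [-> -> -> e]]]]]].
exists (c *: a0), (c *: a1), (c *: a2), (c *: x), (c *: t).
by split; rewrite -?scalemxAl -?scalerDr ?e.
Qed.

(** The factorization 2 = alpha' alpha supplies the witnesses, with x = 0. This puts twice a frame
    vector of the Leech lattice, in any one component, into Nebe's lattice. *)
Lemma nebe3_double (u0 u1 u2 : vec) : nebe3 (2 *: u0) (2 *: u1) (2 *: u2).
Proof.
exists (u0 *m alpha'), (u1 *m alpha'), (u2 *m alpha'), 0, (u0 + u1 + u2).
by split; rewrite ?mul0mx ?addr0 -?mulmxA ?alpha'_alpha ?mul_mx_scalar // !mulmxDl.
Qed.

Lemma dot_alpha'_alpha' (u : vec) : dot (u *m alpha') (u *m alpha') = 2 * dot u u.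
Proof. by rewrite dot_alpha' -mulmxA alpha'_alpha mul_mx_scalar dotZr. Qed.

(** A component has norm 2 |a|^2 + 2 (a alpha, x alpha') + 2 |x|^2. The mixed products add up to (t
    alpha' alpha, x alpha') = 2 (t, x alpha'), and |a|^2 and |x|^2 are even. *)
Lemma nebe3_norm (u0 u1 u2 : vec) : nebe3 u0 u1 u2 -> exists n, dot3 u0 u1 u2 u0 u1 u2 = 4 * n.
Proof.
move=> [a0 [a1 [a2 [x [t [-> -> -> e]]]]]]; rewrite /dot3.
have sq a : dot (a *m alpha + x *m alpha') (a *m alpha + x *m alpha') =
    2 * dot a a + 2 * dot (a *m alpha) (x *m alpha') + 2 * dot x x.
  rewrite !(dotDl, dotDr) dot_alpha_alpha dot_alpha'_alpha' (dotC (x *m _) (a *m _)); ring.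
have cross : dot (a0 *m alpha) (x *m alpha') + dot (a1 *m alpha) (x *m alpha') +
    dot (a2 *m alpha) (x *m alpha') = 2 * dot t (x *m alpha').
  by rewrite -!dotDl -!mulmxDl e -mulmxA alpha'_alpha mul_mx_scalar dotZl.
have [n0 e0] := dot_even a0; have [n1 e1] := dot_even a1; have [n2 e2] := dot_even a2.
have [n ex] := dot_even x.
exists (n0 + n1 + n2 + dot t (x *m alpha') + 3 * n).
transitivity (2 * (dot a0 a0 + dot a1 a1 + dot a2 a2) + 2 * (2 * dot t (x *m alpha')) + 6 * dot x x).
  by rewrite -cross !sq; ring.
by rewrite e0 e1 e2 ex; ring.
Qed.

Lemma nebe3_pair (u0 u1 u2 v0 v1 v2 : vec) : nebe3 u0 u1 u2 -> nebe3 v0 v1 v2 ->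
  exists n, dot3 u0 u1 u2 v0 v1 v2 = 2 * n.
Proof.
move=> hu hv; have [n nE] := nebe3_norm (nebe3D hu hv).
have [p pE] := nebe3_norm hu; have [q qE] := nebe3_norm hv.
exists (n - p - q); apply: (@mulfI _ (2 : int)) => //.
transitivity (4 * n - 4 * p - 4 * q); last by ring.
rewrite -nE -pE -qE /dot3 !(dotDl, dotDr) (dotC v0 u0) (dotC v1 u1) (dotC v2 u2); ring.
Qed.

Definition in_alpha (u : vec) : Prop := exists z, u = z *m alpha.

Lemma alpha_norm (u : vec) : in_alpha u -> u = 0 \/ 8 <= dot u u.
Proof.
move=> [z ->]; have [->|z0] := eqVneq z 0; [left; exact: mul0mx|right].
by rewrite dot_alpha_alpha; have := leech_min z0; lia.
Qed.

(** The intersection of alpha L and alpha' L is 2 L, because u = u alpha + u alpha'. *)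
Lemma alpha_alpha'_norm (u : vec) : in_alpha u -> (exists z, u = z *m alpha') -> u = 0 \/ 16 <= dot u u.
Proof.
move=> [y yE] [z zE].
have uE : u = 2 *: (y + z).
  rewrite -[LHS]mulmx1 -alphaD mulmxDr {1}zE {1}yE -!mulmxA alphaC alpha'_alpha !mul_mx_scalar.
  by rewrite -scalerDr addrC.
have [e|yz] := eqVneq (y + z) 0; [left; by rewrite uE e scaler0|right].
by rewrite uE dotZl dotZr; have := leech_min yz; lia.
Qed.

Lemma nebe3_sum (u0 u1 u2 : vec) : nebe3 u0 u1 u2 -> exists z, u0 + u1 + u2 = z *m alpha'.
Proof.
move=> [a0 [a1 [a2 [x [t [-> -> -> e]]]]]]; exists (t *m alpha + x + x + x).
have E : (a0 + a1 + a2) *m alpha = t *m alpha *m alpha' by rewrite e -!mulmxA alphaC.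
rewrite !mulmxDl in E; rewrite !mulmxDl -E.
move: (a0 *m alpha) (a1 *m alpha) (a2 *m alpha) (x *m alpha') => p q r y.
by apply/matrixP => i j; rewrite !mxE; ring.
Qed.

Lemma nebe3_diff (u0 u1 u2 : vec) : nebe3 u0 u1 u2 -> in_alpha (u1 - u0) /\ in_alpha (u2 - u0).
Proof.
move=> [a0 [a1 [a2 [x [t [-> -> -> e]]]]]].
by split; [exists (a1 - a0)|exists (a2 - a0)]; rewrite opprD addrACA subrr addr0 mulmxBl.
Qed.

Lemma nebe3_swap (u0 u1 u2 : vec) : nebe3 u0 u1 u2 -> nebe3 u1 u0 u2.
Proof.
by move=> [a0 [a1 [a2 [x [t [e0 e1 e2 e]]]]]]; exists a1, a0, a2, x, t; split; rewrite // (addrC a1).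
Qed.

Lemma nebe3_rot (u0 u1 u2 : vec) : nebe3 u0 u1 u2 -> nebe3 u2 u0 u1.
Proof.
move=> [a0 [a1 [a2 [x [t [e0 e1 e2 e]]]]]]; exists a2, a0, a1, x, t.
by split; rewrite // -e -addrA addrC.
Qed.

(** Both components lie in alpha L, where nonzero norms are at least 8. If only one of them is
    nonzero, it lies in alpha' L as well. *)
Lemma nebe3_min0 (u1 u2 : vec) : nebe3 0 u1 u2 ->
  (u1 = 0 /\ u2 = 0) \/ 16 <= dot u1 u1 + dot u2 u2.
Proof.
move=> h; have [] := nebe3_diff h; rewrite !subr0 => i1 i2.
have := nebe3_sum h; rewrite add0r => s12.
have p1 := dot_ge0 u1; have p2 := dot_ge0 u2.
case: (alpha_norm i1) => [u10|n1].
  rewrite u10 add0r in s12; case: (alpha_alpha'_norm i2 s12) => [->|]; [by left|right; lia].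
case: (alpha_norm i2) => [u20|n2]; last by right; lia.
by rewrite u20 addr0 in s12; case: (alpha_alpha'_norm i1 s12) => [->|]; [left|right; lia].
Qed.

Theorem nebe3_min (u0 u1 u2 : vec) : nebe3 u0 u1 u2 ->
  (u0 = 0 /\ u1 = 0 /\ u2 = 0) \/ 16 <= dot3 u0 u1 u2 u0 u1 u2.
Proof.
move=> h; rewrite /dot3; have h2 := nebe3_swap h; have h3 := nebe3_rot h.
have [z0|/leech_min n0] := eqVneq u0 0.
  move: h; rewrite z0 dot0l => /nebe3_min0 [[-> ->]|]; [by left|right; lia].
have [z1|/leech_min n1] := eqVneq u1 0.
  move: h2; rewrite z1 dot0l => /nebe3_min0 [[-> ->]|]; [by left|right; lia].
have [z2|/leech_min n2] := eqVneq u2 0.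
  move: h3; rewrite z2 dot0l => /nebe3_min0 [[-> ->]|]; [by left|right; lia].
right; have [n nE] := nebe3_norm h; rewrite /dot3 in nE.
(* Three nonzero components contribute at least 12, so among the multiples of 4 only 12 is left to
   exclude. *)
suff : n != 3 by move: n0 n1 n2 nE; clear; lia.
apply/eqP => n3; have [d1 d2] := nebe3_diff h.
have [e0 e1 e2] : [/\ dot u0 u0 = 4, dot u1 u1 = 4 & dot u2 u2 = 4].
  by move: n0 n1 n2 nE; rewrite n3; clear; split; lia.
exact: (no_bad_triple e0 e1 e2 d1 d2 (nebe3_sum h)).
Qed.

(** Unimodularity of the Leech lattice, read modulo 2. *)
Lemma even_dot (v : vec) : (forall u, exists n, dot u v = 2 * n) -> exists z, v = 2 *: z.
Proof.
move=> h; have [i j|y yE] := @parity_mxF _ _ (v *m gram).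
  have [n] := h (delta_mx 0 j); rewrite dotC /dot trmx_delta -colE !mxE ord1 => ->.
  by rewrite parityM.
by exists (y *m gram_inv); rewrite scalemxAl -yE -mulmxA gramK mulmx1.
Qed.

(** The lattice vectors (-u alpha, u alpha, 0), (-u alpha, 0, u alpha) and (u alpha', u alpha', u
    alpha') suffice as tests. As [alpha] and [alpha'] are adjoint, they force the differences into
    alpha L and the sum into alpha' L. *)
Theorem nebe3_dual (v0 v1 v2 : vec) :
  (forall u0 u1 u2, nebe3 u0 u1 u2 -> exists n, dot3 u0 u1 u2 v0 v1 v2 = 2 * n) -> nebe3 v0 v1 v2.
Proof.
move=> h.
have alpha_of (v : vec) : (forall u, exists n, dot (u *m alpha) v = 2 * n) -> in_alpha v.
  move=> hv; have [|z zE] := @even_dot (v *m alpha'); first by move=> u; rewrite -dot_alpha; apply: hv.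
  by exists z; apply: (@scale_mx_inj _ _ 2) => //; rewrite -mul_mx_scalar -alpha'_alpha mulmxA zE scalemxAl.
have alpha'_of (v : vec) : (forall u, exists n, dot (u *m alpha') v = 2 * n) -> exists z, v = z *m alpha'.
  move=> hv; have [|z zE] := @even_dot (v *m alpha); first by move=> u; rewrite -dot_alpha'; apply: hv.
  by exists z; apply: (@scale_mx_inj _ _ 2) => //; rewrite -mul_mx_scalar -alpha_alpha' mulmxA zE scalemxAl.
have [d1 e1] : in_alpha (v1 - v0).
  apply: alpha_of => u; have [|n nE] := h (- u *m alpha) (u *m alpha) 0.
    by exists (- u), u, 0, 0, 0; split; rewrite ?mul0mx ?addr0 ?addNr.
  by exists n; rewrite -nE /dot3 dot0l !(mulNmx, dotNl, dotDr, dotNr); ring.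
have [d2 e2] : in_alpha (v2 - v0).
  apply: alpha_of => u; have [|n nE] := h (- u *m alpha) 0 (u *m alpha).
    by exists (- u), 0, u, 0, 0; split; rewrite ?mul0mx ?addr0 ?addNr.
  by exists n; rewrite -nE /dot3 dot0l !(mulNmx, dotNl, dotDr, dotNr); ring.
have [s sE] : exists z, v0 + v1 + v2 = z *m alpha'.
  apply: alpha'_of => u; have [|n nE] := h (u *m alpha') (u *m alpha') (u *m alpha').
    by exists 0, 0, 0, u, 0; split; rewrite ?mul0mx ?add0r ?addr0.
  by exists n; rewrite -nE /dot3 !dotDr; ring.
have vE (v : vec) : v = v *m alpha + v *m alpha' by rewrite -mulmxDr alphaD mulmx1.
(* By v = v alpha + v alpha' one may take a0 = x = v0; then the a_i add up to s alpha' + (d1 + d2)(1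
   - alpha). *)
exists v0, (v0 + d1), (v0 + d2), v0, (s + d1 + d2).
split; first exact: vE.
- by rewrite mulmxDl addrAC -vE -e1 addrC subrK.
- by rewrite mulmxDl addrAC -vE -e2 addrC subrK.
have v1E : v1 = v0 + d1 *m alpha by rewrite -e1 addrC subrK.
have v2E : v2 = v0 + d2 *m alpha by rewrite -e2 addrC subrK.
rewrite !mulmxDl -sE v1E v2E {1}(vE d1) {1}(vE d2).
move: (d1 *m alpha) (d2 *m alpha) (d1 *m alpha') (d2 *m alpha') => p q r y.
by apply/matrixP => i j; rewrite !mxE; ring.
Qed.

(** * The code *)

(** A (B A - c) = 0, and multiplying by the adjugate of A turns A into its nonzero determinant. *)
Lemma mulmx_scalar_comm (n : nat) (A B : 'M[int]_n) (c : int) :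
  c != 0 -> A *m B = c%:M -> B *m A = c%:M.
Proof.
move=> c0 AB; have ABA : A *m (B *m A - c%:M) = 0.
  by rewrite mulmxBr mulmxA AB mul_scalar_mx mul_mx_scalar subrr.
have dA : \det A != 0.
  have : \det A * \det B = c ^+ n by rewrite -det_mulmx AB det_scalar.
  by apply: contra_eq_neq => ->; rewrite mul0r eq_sym expf_neq0.
apply/eqP; rewrite -subr_eq0; apply/eqP; apply: (scale_mx_inj dA).
by rewrite scaler0 -mul_scalar_mx -mul_adj_mx -mulmxA ABA mulmx0.
Qed.

(** * Residues modulo m and their centered representatives *)

Section Zm.
Variable m : nat.
Hypothesis m_gt1 : (1 < m)%N.

Lemma intr_Zm_eq0 (z : int) : z%:~R = 0 :> 'Z_m -> exists q, z = m%:Z * q.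
Proof.
have nat0 (n : nat) : n%:R = 0 :> 'Z_m -> exists q, n = (q * m)%N.
  move=> /(congr1 val) /=; rewrite val_Zp_nat // => h; exists (n %/ m)%N.
  by rewrite {1}(divn_eq n m) h addn0.
case: z => n; first by move=> /nat0 [q ->]; exists q%:Z; lia.
rewrite NegzE mulrNz => /eqP; rewrite oppr_eq0 => /eqP /nat0 [q ->]; exists (- q%:Z); lia.
Qed.

Lemma intr_Zm_mul (q : int) : (m%:Z * q)%:~R = 0 :> 'Z_m.
Proof. by rewrite intrM (_ : m%:~R = 0) ?mul0r // -[LHS]/(m%:R) pchar_Zp. Qed.

Lemma intr_Zm_congr (y z : int) : y%:~R = z%:~R :> 'Z_m -> exists q, y = z + m%:Z * q.
Proof.
move=> h; have [|q qE] := @intr_Zm_eq0 (y - z); first by rewrite intrB h subrr.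
by exists q; rewrite -qE addrC subrK.
Qed.

Lemma map_intr_Zm_congr (n : nat) (a b : 'rV[int]_n) :
  map_mx intr a = map_mx intr b :> 'rV['Z_m]_n -> exists d, a = b + m%:Z *: d.
Proof.
move=> /rowP h; exists (\row_i divz (a ord0 i - b ord0 i) m%:Z); apply/rowP => i.
have := h i; rewrite !mxE => /intr_Zm_congr [d ->].
by rewrite (addrC (b _ _)) addrK mulKz 1?addrC //; lia.
Qed.

Definition centered (x : 'Z_m) : int := if (2 * val x <= m)%N then (val x)%:Z else (val x)%:Z - m%:Z.

Lemma val_Zm_lt (x : 'Z_m) : (val x < m)%N.
Proof. by rewrite -[X in (_ < X)%N](Zp_cast m_gt1); apply: ltn_ord. Qed.

Lemma intr_centered (x : 'Z_m) : (centered x)%:~R = x.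
Proof.
have e : (val x)%:Z%:~R = x by rewrite -[LHS]/((val x)%:R) natr_Zp.
rewrite /centered; case: ifP => // _; rewrite intrB e -[m%:Z]mulr1 intr_Zm_mul subr0 //.
Qed.

Lemma euclid_entryE (x : 'Z_m) : (euclid_entry x)%:Z = centered x ^+ 2.
Proof.
rewrite /euclid_entry /centered; have := val_Zm_lt x; move: (val x) => v vm.
case: ifP => h.
  by rewrite (_ : minn v (m - v) = v)%N; [rewrite -!mulnn expr2 PoszM|lia].
by rewrite (_ : minn v (m - v) = m - v)%N; [rewrite -!mulnn expr2 PoszM; lia|lia].
Qed.

Lemma centered_min (x : 'Z_m) (z : int) : z%:~R = x -> centered x ^+ 2 <= z ^+ 2.
Proof.
move=> zx; have [q ->] := intr_Zm_congr (etrans zx (esym (intr_centered x))).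
have : -m%:Z <= 2 * centered x <= m%:Z.
  by rewrite /centered; have := val_Zm_lt x; case: ifP; lia.
move: (centered x) => c /andP[c1 c2].
have [->|q0] := eqVneq q 0; first by rewrite mulr0 addr0.
(* This is the difference of the two squares; it is nonnegative because |2c| <= m. *)
have : 0 <= m%:Z * q * (2 * c + m%:Z * q); last by lia.
have [qp|qn] := ltP 0 q.
  by rewrite mulr_ge0 //; nia.
by rewrite mulr_le0 //; nia.
Qed.

End Zm.

(** * Nebe's lattice as integer matrices with three rows *)

Local Notation r0 := (@ord0 2).
Local Notation r1 := (lift (@ord0 2) (@ord0 1)).
Local Notation r2 := (lift (@ord0 2) (lift (@ord0 1) (@ord0 0))).

Definition nebe (w : 'M[int]_(3, 24)) : Prop := nebe3 (row r0 w) (row r1 w) (row r2 w).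

Definition tdot (w v : 'M[int]_(3, 24)) : int := \sum_i dot (row i w) (row i v).

Lemma tdotE (w v : 'M[int]_(3, 24)) :
  tdot w v = dot3 (row r0 w) (row r1 w) (row r2 w) (row r0 v) (row r1 v) (row r2 v).
Proof. by rewrite /tdot /dot3 !big_ord_recl big_ord0 addr0 addrA. Qed.

Definition stack (u0 u1 u2 : vec) : 'M[int]_(3, 24) := \matrix_(i < 3) nth 0 [:: u0; u1; u2] i.

Lemma nebe_stack (u0 u1 u2 : vec) : nebe (stack u0 u1 u2) <-> nebe3 u0 u1 u2.
Proof. by rewrite /nebe !rowK. Qed.

Lemma stackE (w : 'M[int]_(3, 24)) : w = stack (row r0 w) (row r1 w) (row r2 w).
Proof.
apply/row_matrixP => i; rewrite rowK; case: i => -[|[|[|//]]] hi /=; congr (row _ w); exact: val_inj.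
Qed.

Lemma nebeD (w v : 'M[int]_(3, 24)) : nebe w -> nebe v -> nebe (w + v).
Proof. by rewrite /nebe !linearD; apply: nebe3D. Qed.

Lemma nebeZ (c : int) (w : 'M[int]_(3, 24)) : nebe w -> nebe (c *: w).
Proof. by rewrite /nebe !linearZ; apply: nebe3Z. Qed.

Lemma nebe_double (w : 'M[int]_(3, 24)) : nebe (2 *: w).
Proof. by rewrite /nebe !linearZ; apply: nebe3_double. Qed.

Lemma nebe_norm (w : 'M[int]_(3, 24)) : nebe w -> exists n, tdot w w = 4 * n.
Proof. by rewrite tdotE; apply: nebe3_norm. Qed.

Lemma nebe_pair (w v : 'M[int]_(3, 24)) : nebe w -> nebe v -> exists n, tdot w v = 2 * n.
Proof. by rewrite tdotE; apply: nebe3_pair. Qed.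

Lemma nebe_min (w : 'M[int]_(3, 24)) : nebe w -> w != 0 -> 16 <= tdot w w.
Proof.
rewrite tdotE => /nebe3_min [[z0 [z1 z2]]|//]; rewrite (stackE w) z0 z1 z2 => /eqP; case.
by apply/row_matrixP => i; rewrite rowK row0; case: i => -[|[|[|]]].
Qed.

Lemma nebe_dual (v : 'M[int]_(3, 24)) :
  (forall w, nebe w -> exists n, tdot w v = 2 * n) -> nebe v.
Proof.
move=> h; apply: nebe3_dual => u0 u1 u2 /nebe_stack /h [n nE].
by exists n; rewrite -nE tdotE !rowK.
Qed.

(** * The code of a frame *)

Section Code.
Variables (k : nat) (F : 'M[int]_24).
Hypothesis k_ge2 : (2 <= k)%N.
Hypothesis FF : F *m gram *m F^T = (2 * k%:Z)%:M.

Let m : nat := (2 * (2 * k))%N.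

Let m_gt1 : (1 < m)%N. Proof. by rewrite /m; lia. Qed.

(* The inner products, in Nebe's lattice, of w with the vectors having twice a row of F in one
   component and 0 in the others. *)
Definition coords (w : 'M[int]_(3, 24)) : 'rV[int]_(3 * 24) := mxvec (w *m (gram *m F^T)).

Definition encode (w : 'M[int]_(3, 24)) : 'rV['Z_m]_(3 * 24) := map_mx intr (coords w).

Lemma frameK : gram *m F^T *m F = (2 * k%:Z)%:M.
Proof. by apply: mulmx_scalar_comm; [lia|rewrite mulmxA FF]. Qed.

Lemma coordsD (w v : 'M[int]_(3, 24)) : coords (w + v) = coords w + coords v.
Proof. by rewrite /coords mulmxDl linearD. Qed.

Lemma coordsZ (c : int) (w : 'M[int]_(3, 24)) : coords (c *: w) = c *: coords w.
Proof. by rewrite /coords -scalemxAl linearZ. Qed.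

Lemma coords_mul (y : 'M[int]_(3, 24)) : coords (y *m F) = (2 * k%:Z) *: mxvec y.
Proof. by rewrite /coords -mulmxA (mulmxA F) FF mul_mx_scalar linearZ. Qed.

Lemma dot_mxvec (y z : 'M[int]_(3, 24)) :
  \sum_i mxvec y 0 i * mxvec z 0 i = \sum_i \sum_j y i j * z i j.
Proof.
rewrite pair_bigA /= (reindex _ (curry_mxvec_bij _ _)) /=.
by apply: eq_bigr => -[i j] _ /=; rewrite !mxvecE.
Qed.

Lemma dot_coords_mxvec (w y : 'M[int]_(3, 24)) :
  \sum_i coords w 0 i * mxvec y 0 i = tdot w (y *m F).
Proof.
rewrite dot_mxvec; apply: eq_bigr => i _; rewrite /dot row_form trmx_mul.
rewrite [in RHS]mulmxA [RHS]mxE; apply: eq_bigr => j _.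
by rewrite mulmxA [X in _ = _ * X]mxE.
Qed.

(** Parseval's identity for the frame. *)
Lemma dot_coords (w v : 'M[int]_(3, 24)) :
  \sum_i coords w 0 i * coords v 0 i = (2 * k%:Z) * tdot w v.
Proof.
rewrite [LHS]dot_coords_mxvec /tdot mulr_sumr; apply: eq_bigr => i _.
by rewrite -mulmxA frameK mul_mx_scalar linearZ /= dotZr.
Qed.

(** The image of an infinite lattice, hence the classical truth value in a finite set. *)
Definition nebe_code : {set 'rV['Z_m]_72} := [set c | `[< exists w, nebe w /\ c = encode w >]].

Lemma nebe_codeP (c : 'rV['Z_m]_72) : reflect (exists w, nebe w /\ c = encode w) (c \in nebe_code).
Proof. by rewrite inE; apply: asboolP. Qed.

(** Changing one coordinate by 4k amounts to adding twice a row of [F] in one component, which stays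
    in the lattice; so every integer lift of a codeword comes from a lattice vector. *)
Lemma encode_lift (w : 'M[int]_(3, 24)) (y : 'M[int]_(3, 24)) : nebe w ->
  map_mx intr (mxvec y) = encode w -> exists v, [/\ nebe v, coords v = mxvec y & encode v = encode w].
Proof.
move=> hw yw; have [d dE] := map_intr_Zm_congr m_gt1 yw.
pose z : 'M[int]_(3, 24) := vec_mx d.
have zE : mxvec y = coords w + (2 * (2 * k%:Z)) *: mxvec z.
  by rewrite vec_mxK dE /m !PoszM.
exists (w + 2 *: (z *m F)); have vE : coords (w + 2 *: (z *m F)) = mxvec y.
  by rewrite coordsD coordsZ coords_mul scalerA zE.
by split; [apply: nebeD => //; apply: nebe_double|exact: vE|rewrite -yw /encode vE].
Qed.

Lemma encode0_coords (w : 'M[int]_(3, 24)) : encode w = 0 ->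
  exists z, w = 2 *: (z *m F).
Proof.
move=> h; have [z zE] : exists z : 'M[int]_(3, 24), coords w = (2 * (2 * k%:Z)) *: mxvec z.
  have [|d dE] := @map_intr_Zm_congr m m_gt1 _ (coords w) 0; first by rewrite -/(encode w) h map_mx0.
  by exists (vec_mx d); rewrite vec_mxK dE add0r /m !PoszM.
exists z; apply: (@scale_mx_inj _ _ (2 * k%:Z)); first by lia.
have : w *m (gram *m F^T) = (2 * (2 * k%:Z)) *: z.
  by apply: (can_inj mxvecK); rewrite -/(coords w) zE linearZ.
move=> /(congr1 (mulmx^~ F)); rewrite -mulmxA frameK mul_mx_scalar => ->.
by rewrite -scalemxAl scalerA mulrC.
Qed.

Lemma encodeD (w v : 'M[int]_(3, 24)) : encode (w + v) = encode w + encode v.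
Proof. by rewrite /encode coordsD map_mxD. Qed.

Lemma encodeZ (c : int) (w : 'M[int]_(3, 24)) : encode (c *: w) = c%:~R *: encode w.
Proof. by rewrite /encode coordsZ map_mxZ. Qed.

Lemma encode0 : encode 0 = 0.
Proof. by rewrite /encode /coords mul0mx linear0 map_mx0. Qed.

Lemma nebe0 : nebe 0.
Proof. by rewrite -(scaler0 _ 2); apply: nebe_double. Qed.

Lemma nebe_code_is_code : is_code nebe_code.
Proof.
split.
- apply/nebe_codeP; exists 0; split; first exact: nebe0.
  by rewrite encode0.
- move=> x y /nebe_codeP [w [hw ->]] /nebe_codeP [v [hv ->]]; apply/nebe_codeP.
  by exists (w + v); rewrite encodeD; split=> //; apply: nebeD.
move=> a x /nebe_codeP [w [hw ->]]; apply/nebe_codeP; exists ((val a)%:Z *: w).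
split; first exact: nebeZ.
by rewrite encodeZ; congr (_ *: _); rewrite -[RHS]/((val a)%:R) natr_Zp.
Qed.

Lemma inner_encode (w y : 'M[int]_(3, 24)) :
  @inner m (3 * 24) (encode w) (map_mx intr (mxvec y)) = (tdot w (y *m F))%:~R.
Proof.
rewrite /inner -dot_coords_mxvec rmorph_sum; apply: eq_bigr => i _.
by rewrite !mxE rmorphM.
Qed.

Lemma nebe_code_self_dual : self_dual nebe_code.
Proof.
apply/setP => c; apply/idP/idP.
  move=> /nebe_codeP [w [hw ->]]; rewrite inE; apply/forall_inP => x /nebe_codeP [v [hv ->]].
  apply/eqP; have -> : inner (encode v) (encode w) = (2 * k%:Z * tdot v w)%:~R.
    rewrite /inner -dot_coords rmorph_sum; apply: eq_bigr => i _; by rewrite !mxE rmorphM.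
  have [n ->] := nebe_pair hv hw.
  by rewrite (_ : _ * _ = m%:Z * n); [exact: intr_Zm_mul|rewrite /m; lia].
rewrite inE => /forall_inP hc.
pose y : 'M[int]_(3, 24) := vec_mx (map_mx (@centered m) (c : 'rV_(3 * 24))).
have yc : map_mx intr (mxvec y) = c :> 'rV['Z_m]_(3 * 24).
  by rewrite vec_mxK; apply/rowP => i; rewrite !mxE intr_centered.
have pair w : nebe w -> exists n, tdot w (y *m F) = 2 * (2 * k%:Z) * n.
  move=> hw; have /hc : encode w \in nebe_code by apply/nebe_codeP; exists w.
  rewrite -yc => /eqP; rewrite inner_encode => /(intr_Zm_eq0 m_gt1) [n ->].
  by exists n; rewrite /m; lia.
(* [v] has coordinates [y]. It is integral: pairing with 2e, for every matrix unit e, shows that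
   [y *m F *m gram] is divisible by 2k, and [gram] is invertible over the integers. *)
have [v vE] : exists v : 'M[int]_(3, 24), y *m F = (2 * k%:Z) *: v.
  pose X := y *m F *m gram.
  have XE i j : exists n, X i j = (2 * k%:Z) * n.
    pose e : 'M[int]_(3, 24) := delta_mx i j.
    have [n nE] := pair _ (nebe_double e); exists n; apply: (@mulfI _ (2 : int)) => //.
    rewrite mulrA -nE /tdot (bigD1 i) //= big1 ?addr0 => [|i' i'i].
      rewrite [row i (2 *: e)]linearZ /= dotZl; congr (_ * _); rewrite dotC /dot row_form -/X [RHS]mxE.
      rewrite (bigD1 j) //= big1 ?addr0 => [|l lj].
        by rewrite [e^T _ _]mxE /e [delta_mx _ _ _ _]mxE !eqxx mulr1.
      by rewrite [e^T _ _]mxE /e [delta_mx _ _ _ _]mxE (negPf lj) andbF mulr0.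
    by rewrite [row i' (2 *: e)]linearZ /= (_ : row i' e = 0) ?scaler0 ?dot0l //; apply/rowP => l;
      rewrite !mxE (negPf i'i).
  exists ((\matrix_(i, j) (X i j %/ (2 * k%:Z))%Z) *m gram_inv).
  rewrite scalemxAl -[LHS]mulmx1 -gramK mulmxA -/X; congr (_ *m _); apply/matrixP => i j.
  by rewrite [RHS]mxE [Y in _ = _ * Y]mxE; have [n ->] := XE i j; rewrite mulKz //; lia.
apply/nebe_codeP; exists v; split.
  apply: nebe_dual => w hw; have [n nE] := pair _ hw; exists n.
  apply: (@mulfI _ (2 * k%:Z)); first by lia.
  transitivity (tdot w (y *m F)); last by rewrite nE; ring.
  by rewrite vE /tdot mulr_sumr; apply: eq_bigr => i _; rewrite linearZ /= dotZr.
rewrite -yc /encode; congr map_mx; apply: (@scale_mx_inj _ _ (2 * k%:Z)); first by lia.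
by rewrite -coordsZ -vE coords_mul.
Qed.

Lemma euclid_weightE (c : 'rV['Z_m]_(3 * 24)) :
  (euclid_weight c)%:Z = \sum_i centered (c 0 i) ^+ 2.
Proof.
rewrite /euclid_weight -natz natr_sum; apply: eq_bigr => i _.
by rewrite natz euclid_entryE.
Qed.

(** The centered representatives form an integer lift, and the lattice vector behind it has the
    weight as its norm, up to the factor. *)
Lemma euclid_weight_nebe (w : 'M[int]_(3, 24)) : nebe w ->
  exists v, [/\ nebe v, encode v = encode w &
    (euclid_weight (encode w))%:Z = 2 * k%:Z * tdot v v].
Proof.
move=> hw; pose y : 'M[int]_(3, 24) := vec_mx (map_mx (@centered m) (encode w)).
have yE i : mxvec y 0 i = centered (encode w 0 i) by rewrite vec_mxK mxE.
have [|v [hv vy ve]] := @encode_lift w y hw.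
  by apply/rowP => i; rewrite mxE yE intr_centered.
exists v; split=> //; rewrite euclid_weightE -dot_coords vy.
by apply: eq_bigr => i _; rewrite yE expr2.
Qed.

Lemma euclid_weight_le (w : 'M[int]_(3, 24)) :
  (euclid_weight (encode w))%:Z <= 2 * k%:Z * tdot w w.
Proof.
rewrite euclid_weightE -dot_coords; apply: ler_sum => i _; rewrite -expr2.
by apply: centered_min => //; rewrite [RHS]mxE.
Qed.

Lemma nebe_code_weight (c : 'rV['Z_m]_72) : c \in nebe_code -> (4 * (2 * k) %| euclid_weight c)%N.
Proof.
move=> /nebe_codeP [w [hw ->]]; have [v [hv _ e]] := euclid_weight_nebe hw.
have [n nE] := nebe_norm hv; rewrite nE in e; apply/dvdnP; exists `|n|%N.
have n0 : 0 <= n by have := e; clear -k_ge2; nia.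
move: e n0; move: (euclid_weight _) => W; clear; nia.
Qed.

Lemma nebe_code_min (c : 'rV['Z_m]_72) : c \in nebe_code -> c != 0 -> (32 * k <= euclid_weight c)%N.
Proof.
move=> /nebe_codeP [w [hw ->]] c0; have [v [hv vw e]] := euclid_weight_nebe hw.
have v0 : v != 0.
  by apply: contraNneq c0 => v0; rewrite -vw v0 encode0.
by have := nebe_min hv v0; move: e; move: (tdot v v) (euclid_weight _) => t W; clear; nia.
Qed.

(** For a minimal vector u of the Leech lattice, (u alpha, -u alpha, 0) attains the minimum 16 of
    [tdot]. *)
Lemma nebe_code_attained : exists c, [/\ c \in nebe_code, c != 0 & (euclid_weight c <= 32 * k)%N].
Proof.
pose u : vec := row 0 (mxZ 24 24 frame0L).
have u4 : dot u u = 4.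
  have frame0 : frame0L \in frames by rewrite inE eqxx.
  have /allP/(_ _ frame0)/andP[_ /frame_check_gram h] := frames_check.
  by rewrite /dot row_form h mxE eqxx.
pose w := stack (u *m alpha) (- (u *m alpha)) 0.
have hw : nebe w.
  apply/nebe_stack; exists u, (- u), 0, 0, 0.
  by split; rewrite ?mul0mx ?addr0 ?mulNmx ?subrr.
exists (encode w); split.
- by apply/nebe_codeP; exists w.
(* Otherwise u alpha would be 2 z F, of norm 8k |z|^2, whereas its norm is 8; this contradicts k >=
   2. *)
- apply/eqP => /encode0_coords [z zE].
  have : row r0 w = 2 *: (row r0 z *m F) by rewrite {1}zE linearZ /= row_mul.
  rewrite rowK /= => e; have : dot (u *m alpha) (u *m alpha) = 8 by rewrite dot_alpha_alpha u4.
  have zF : row r0 z *m F *m gram *m F^T = (2 * k%:Z) *: row r0 z.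
    by rewrite -!mulmxA (mulmxA F) FF mul_mx_scalar.
  rewrite e dotZl dotZr /dot trmx_mul mulmxA zF -scalemxAl mxE.
  move: (_ 0 0) => t e8; have [t0|t1] : t <= 0 \/ 1 <= t by lia.
    by move: e8 t0; clear -k_ge2; nia.
  by move: e8 t1; clear -k_ge2; nia.
rewrite -lez_nat; apply: le_trans (euclid_weight_le w) _.
rewrite tdotE /dot3 !rowK /= dotNl dotNr opprK dot0l addr0 dot_alpha_alpha u4; lia.
Qed.

End Code.

(** * Extremality *)

Lemma bigminn_le (I : eqType) (s : seq I) (P : pred I) (f : I -> nat) (d : nat) (i : I) :
  i \in s -> P i -> (\big[minn/d]_(j <- s | P j) f j <= f i)%N.
Proof.
elim: s => // j s IH; rewrite inE big_cons => /orP[/eqP <-|/IH h] Pi; first by rewrite Pi geq_minl.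
by case: ifP => _; rewrite ?geq_min h ?orbT.
Qed.

Theorem nebe_code_extremal (k : nat) (F : 'M[int]_24) : (2 <= k)%N -> F *m gram *m F^T = (2 * k%:Z)%:M ->
  extremal_typeII (nebe_code k F).
Proof.
move=> k2 FF; split.
  split; first exact: nebe_code_is_code.
  split; first exact: nebe_code_self_dual.
  by move=> c; apply: nebe_code_weight.
have -> : (4 * (2 * k) * (72 %/ 24) + 4 * (2 * k) = 32 * k)%N by rewrite (_ : 72 %/ 24 = 3)%N //; lia.
apply/eqP; rewrite eqn_leq; apply/andP; split.
  have [c [cC c0 cw]] := nebe_code_attained k2 FF.
  apply: leq_trans cw; rewrite /dE; apply: bigminn_le.
    by rewrite mem_index_enum.
  by rewrite cC.
rewrite /dE; apply: (big_ind (fun n => 32 * k <= n)%N).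
(* The default value of the minimum is 72 (2k)^2 + 1, which exceeds 32k. *)
- by rewrite (_ : 2 * (2 * k) %/ 2 = 2 * k)%N; nia.
- by move=> a b ha hb; rewrite leq_min ha.
by move=> c /andP[cC c0]; apply: (nebe_code_min k2 FF).
Qed.

(* Z_{4k} = Z_{2r} with r = 2k *)
Theorem theorem8p1 (k : nat) (hk : (2 <= k)%N) :
  exists C : {set 'rV['Z_(2 * (2 * k))]_72}, extremal_typeII C.
Proof.
by have [F FF] := leech_frames hk; exists (nebe_code k F); apply: nebe_code_extremal.
Qed.
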